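(* Let $p$ be a prime and $g\ge2$. There is an algorithm which, given as input invertible matrices $\gamma_1,\dots,\gamma_g\in\mathbb{Q}_p^{2\times 2}$ generating a group $\Gamma\le PGL(2,K)$, terminates after finitely many steps and does one of the following: (i) returns $g$ free generators of $\Gamma$ in good position together with a good fundamental domain corresponding to them (so that $\Gamma$ is Schottky); (ii) returns a nonempty reduced word in $\gamma_1^{\pm1},\dots,\gamma_g^{\pm1}$ representing the identity (so that $\gamma_1,\dots,\gamma_g$ do not freely generate $\Gamma$); (iii) returns a non-identity, non-hyperbolic element of $\Gamma$ (so that $\Gamma$ is not Schottky). Moreover, if $\Gamma$ is Schottky and freely generated by $\gamma_1,\dots,\gamma_g$, the outcome is (i); otherwise the outcome is (ii) or (iii).
   Context: $K=\mathbb{C}_p$ is the completion of an algebraic closure of $\mathbb{Q}_p$, and $PGL(2,K)$ acts on $\mathbb{P}^1=\mathbb{P}^1(K)$ by fractional linear transformations; matrices are identified with their classes in $PGL(2,K)$. Exact arithmetic in $\mathbb{Q}_p$, computation and comparison of valuations, equality tests, and computation of eigenvalues and eigenvectors of hyperbolic matrices over $\mathbb{Q}_p$ are treated as elementary steps; balls are output by giving a center and a radius. A $2\times2$ matrix is hyperbolic if it has two eigenvalues with different valuations. A Schottky group is a finitely generated subgroup $\Gamma\le PGL(2,K)$ all of whose non-identity elements are hyperbolic; such a group is free. A word $h_1\cdots h_k$ with $h_l\in\{\gamma_1^{\pm1},\dots,\gamma_g^{\pm1}\}$ is reduced if no two consecutive letters are (formally) inverse to each other. Balls: $B(a,r)=\{x\in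 K:|x-a|<r\}$, $B(a,r)^+=\{x\in K:|x-a|\le r\}$. An open ball in $\mathbb{P}^1$ is some $B(a,r)$ or some $\mathbb{P}^1\setminus B(a,r)^+$; the corresponding closed ball $B^+$ is $B(a,r)^+$, respectively $\mathbb{P}^1\setminus B(a,r)$. A good fundamental domain corresponding to generators $a_1,\dots,a_g$ is $F=\mathbb{P}^1\setminus(B_1\cup\dots\cup B_g\cup B_1'\cup\dots\cup B_g')$ with $B_i,B_i'$ open balls such that the $2g$ corresponding closed balls $B_i^+,B_i'^+$ are pairwise disjoint and $a_i(\mathbb{P}^1\setminus B_i')=B_i^+$, $a_i^{-1}(\mathbb{P}^1\setminus B_i)=B_i'^+$ for all $i$. Free generators are in good position if a good fundamental domain corresponding to them exists. *)

(* Defs.v *)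
From mathcomp Require Import all_boot all_order all_algebra.
From mathcomp Require Import all_classical all_reals all_analysis.

Set Implicit Arguments.
Unset Strict Implicit.
Unset Printing Implicit Defensive.

Import Order.TTheory GRing.Theory Num.Theory.

Local Open Scope classical_set_scope.
Local Open Scope ring_scope.

(** * The field C_p *)

Section ValuedField.
Variables (R : realType) (K : fieldType) (abs : K -> R).

Definition converges_to (u : nat -> K) (l : K) : Prop :=
  forall e : R, 0 < e ->
    exists N : nat, forall n, (N <= n)%N -> abs (u n - l) < e.

Definition cauchy_sequence (u : nat -> K) : Prop :=
  forall e : R, 0 < e ->
    exists N : nat, forall m n, (N <= m)%N -> (N <= n)%N -> abs (u m - u n) < e.

(* In a complete K with `|p| = 1/p, the topological closure of the rationals
   is the completion of the rationals for the p-adic absolute value: it is the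
   copy of Q_p contained in K. *)
Definition Qp : set K :=
  [set x | forall e : R, 0 < e -> exists q : rat, abs (x - ratr q) < e].

Definition algebraic_over_Qp (x : K) : Prop :=
  exists q : {poly K}, [/\ q != 0, forall i, Qp q`_i & root q x].

(* (K, abs) is a completion of an algebraic closure of Q_p: K is complete, and
   the elements algebraic over Q_p form an algebraically closed field (hence an
   algebraic closure of Q_p) that is dense in K. These properties determine
   (K, abs) up to isometric isomorphism. *)
Record is_Cp (p : nat) : Prop := {
  abs_nonneg : forall x, 0 <= abs x;
  abs_eq0P : forall x, abs x = 0 <-> x = 0;
  abs_mul : forall x y, abs (x * y) = abs x * abs y;
  abs_ultrametric : forall x y, abs (x + y) <= Num.max (abs x) (abs y);
  abs_p : abs p%:R = p%:R^-1;
  Cp_complete : forall u, cauchy_sequence u -> exists l, converges_to u l;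
  algebraic_closed : forall q : {poly K}, (1 < size q)%N ->
    (forall i, algebraic_over_Qp q`_i) -> exists x, root q x;
  algebraic_dense : forall x (e : R), 0 < e ->
    exists2 y, algebraic_over_Qp y & abs (x - y) < e }.

(** * Subgroups of PGL(2, K)

   A class in PGL(2, K) is handled through its representatives, and a subset of
   PGL(2, K) is a set of invertible matrices stable under nonzero scaling. The
   identity class is the set of (invertible) scalar matrices. *)

Definition hyperbolic (M : 'M[K]_2) : Prop :=
  exists l m : K, [/\ eigenvalue M l, eigenvalue M m & abs l <> abs m].

(* The letter (i, false) stands for the i-th generator and (i, true) for its
   inverse; a word is multiplied out from left to right. *)
Definition letter g (gamma : 'I_g -> 'M[K]_2) (l : 'I_g * bool) : 'M[K]_2 :=
  if l.2 then invmx (gamma l.1) else gamma l.1.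

Definition word_value g (gamma : 'I_g -> 'M[K]_2) (w : seq ('I_g * bool)) :
    'M[K]_2 :=
  \prod_(l <- w) letter gamma l.

Definition reduced g (w : seq ('I_g * bool)) : bool :=
  sorted (fun l m => ~~ ((l.1 == m.1) && (l.2 != m.2))) w.

Definition generated_group g (gamma : 'I_g -> 'M[K]_2) : set 'M[K]_2 :=
  [set M | exists (c : K) (w : seq ('I_g * bool)),
             c != 0 /\ M = c *: word_value gamma w].

Definition freely_generate g (gamma : 'I_g -> 'M[K]_2) : Prop :=
  forall w : seq ('I_g * bool),
    reduced w -> w != [::] -> ~ is_scalar_mx (word_value gamma w).

Definition Schottky_group (G : set 'M[K]_2) : Prop :=
  (exists (n : nat) (delta : 'I_n -> 'M[K]_2),
     (forall i, delta i \in unitmx) /\ G = generated_group delta) /\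
  (forall M, G M -> ~ is_scalar_mx M -> hyperbolic M).

(** * The projective line, balls and good fundamental domains *)

(* None is the point at infinity. *)
Definition P1 : Type := option K.

Definition fractional_linear (M : 'M[K]_2) (z : P1) : P1 :=
  match z with
  | Some x => let d := M 1 0 * x + M 1 1 in
              if d == 0 then None else Some ((M 0 0 * x + M 0 1) / d)
  | None => if M 1 0 == 0 then None else Some (M 0 0 / M 1 0)
  end.

(* A presentation of an open ball by a center and a radius, either as B(a, r)
   or (if [outer]) as the complement of B(a, r)^+. The corresponding closed
   ball depends on the radius, and not only on the set of points of the open
   ball, when r is not in the value group. *)
Record P1ball := MkP1ball { outer : bool; center : K; radius : R }.

Definition open_ball (B : P1ball) : set P1 :=
  if outer B then ~` [set Some x | x in [set x | abs (x - center B) <= radius B]]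
  else [set Some x | x in [set x | abs (x - center B) < radius B]].

Definition closed_ball (B : P1ball) : set P1 :=
  if outer B then ~` [set Some x | x in [set x | abs (x - center B) < radius B]]
  else [set Some x | x in [set x | abs (x - center B) <= radius B]].

Definition good_fundamental_domain g (a : 'I_g -> 'M[K]_2)
    (B B' : 'I_g -> P1ball) (F : set P1) : Prop :=
  [/\ F = ~` (\bigcup_(i in [set: 'I_g])
                (open_ball (B i) `|` open_ball (B' i))),
      forall i, 0 < radius (B i) /\ 0 < radius (B' i),
      trivIset [set: 'I_g * bool]
        (fun u => closed_ball (if u.2 then B' u.1 else B u.1)),
      forall i,
        fractional_linear (a i) @` (~` open_ball (B' i)) = closed_ball (B i) &
      forall i, fractional_linear (invmx (a i)) @` (~` open_ball (B i))
                = closed_ball (B' i)].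

Definition good_position g (a : 'I_g -> 'M[K]_2) : Prop :=
  exists B B' F, good_fundamental_domain a B B' F.

End ValuedField.

(** * Algorithms

   Algorithms are finite programs of a small typed language whose data are
   booleans, integers, p-adic numbers, and finite tuples, tagged unions and
   lists of these. The only operations on p-adic numbers are the elementary
   steps: exact arithmetic, equality test, valuation (valuations are integers
   and are compared as such), and eigenvalues and eigenvectors of a hyperbolic
   matrix. *)

Inductive ty : Type :=
| Unit | Bool | Int | Num
| Prod of ty & ty
| Sum of ty & ty
| List of ty.

Definition Vec : ty := Prod Num Num.
(* A matrix is stored as the pair of its rows. *)
Definition Mat : ty := Prod Vec Vec.

Inductive prog : ty -> ty -> Type :=
| Id a : prog a a
| Comp a b c : prog a b -> prog b c -> prog a c
| ToUnit a : prog a Unit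
| Fork a b c : prog a b -> prog a c -> prog a (Prod b c)
| Fst a b : prog (Prod a b) a
| Snd a b : prog (Prod a b) b
| Inl a b : prog a (Sum a b)
| Inr a b : prog b (Sum a b)
| Case a b c d :
    prog (Prod a c) d -> prog (Prod b c) d -> prog (Prod (Sum a b) c) d
| Nil a : prog Unit (List a)
| Cons a : prog (Prod a (List a)) (List a)
| Uncons a : prog (List a) (Sum Unit (Prod a (List a)))
| BoolConst of bool : prog Unit Bool
| If a b : prog a b -> prog a b -> prog (Prod Bool a) b
| IntConst of int : prog Unit Int
| IntAdd : prog (Prod Int Int) Int
| IntMul : prog (Prod Int Int) Int
| IntOpp : prog Int Int
| IntLe : prog (Prod Int Int) Bool
| NumOfInt : prog Int Num
| NumAdd : prog (Prod Num Num) Num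
| NumMul : prog (Prod Num Num) Num
| NumOpp : prog Num Num
| NumInv : prog Num Num
| NumEq : prog (Prod Num Num) Bool
| Valuation : prog Num Int
| Eigen : prog Mat (Prod (Prod Num Vec) (Prod Num Vec))
| Loop a b : prog a (Sum a b) -> prog a b.

Fixpoint den (K : Type) (t : ty) : Type :=
  match t with
  | Unit => unit
  | Bool => bool
  | Int => int
  | Num => K
  | Prod a b => den K a * den K b
  | Sum a b => den K a + den K b
  | List a => seq (den K a)
  end.

Definition some_such (T : Type) (P : T -> Prop) : option T :=
  match pselect (exists x, P x) with
  | left h => Some (projT1 (cid h))
  | right _ => None
  end.

Fixpoint iterate (A B : Type) (f : A -> option (A + B)) (n : nat) (x : A) :
    option B :=
  match n with
  | 0%N => None
  | n'.+1 => match f x with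
             | Some (inl x') => iterate f n' x'
             | Some (inr y) => Some y
             | None => None
             end
  end.

Section Semantics.
Variables (p : nat) (R : realType) (K : fieldType) (abs : K -> R).

Local Notation D := (den K).

Definition mx_code (M : 'M[K]_2) : D Mat :=
  ((M 0 0, M 0 1), (M 1 0, M 1 1)).

Definition vec_code (v : 'cV[K]_2) : D Vec := (v 0 0, v 1 0).

Definition valuation_is (x : K) (v : int) : Prop :=
  Qp abs x /\ abs x = p%:R ^ (- v).

(* The two eigenvalues of a hyperbolic matrix over Q_p, by increasing
   valuation, each followed by some eigenvector over Q_p. *)
Definition eigen_data_of (m : D Mat)
    (e : D (Prod (Prod Num Vec) (Prod Num Vec))) : Prop :=
  exists (M : 'M[K]_2) (l1 l2 : K) (v1 v2 : 'cV[K]_2),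
    [/\ m = mx_code M /\ e = ((l1, vec_code v1), (l2, vec_code v2)),
        forall i j, Qp abs (M i j),
        abs l2 < abs l1,
        [/\ v1 != 0, M *m v1 = l1 *: v1 & forall i, Qp abs (v1 i 0)] &
        [/\ v2 != 0, M *m v2 = l2 *: v2 & forall i, Qp abs (v2 i 0)]].

(* [run n P x] executes P on x, every loop being cut off after n rounds. It is
   [None] if a loop is cut off or an operation is applied outside its domain
   (inverse or valuation of 0, eigenvectors of a non-hyperbolic matrix). A run
   that succeeds does so with the same result for all larger n, so P halts on
   x with result y iff [run n P x = Some y] for some n; see [run_mono]. *)
Fixpoint run (n : nat) (a b : ty) (P : prog a b) {struct P} :
    D a -> option (D b) :=
  match P in prog a b return D a -> option (D b) with
  | Id _ => fun x => Some x
  | Comp _ _ _ f h => fun x => obind (run n h) (run n f x)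
  | ToUnit _ => fun _ => Some tt
  | Fork _ _ _ f h => fun x =>
      obind (fun y => omap (fun z => (y, z)) (run n h x)) (run n f x)
  | Fst _ _ => fun x => Some x.1
  | Snd _ _ => fun x => Some x.2
  | Inl _ _ => fun x => Some (inl x)
  | Inr _ _ => fun x => Some (inr x)
  | Case _ _ _ _ f h => fun x =>
      match x.1 with
      | inl y => run n f (y, x.2)
      | inr y => run n h (y, x.2)
      end
  | Nil _ => fun _ => Some [::]
  | Cons _ => fun x => Some (x.1 :: x.2)
  | Uncons _ => fun x =>
      Some (match x with [::] => inl tt | y :: s => inr (y, s) end)
  | BoolConst c => fun _ => Some c
  | If _ _ f h => fun x => if x.1 then run n f x.2 else run n h x.2
  | IntConst c => fun _ => Some c
  | IntAdd => fun x => Some (x.1 + x.2)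
  | IntMul => fun x => Some (x.1 * x.2)
  | IntOpp => fun x => Some (- x)
  | IntLe => fun x => Some (x.1 <= x.2)
  | NumOfInt => fun x => Some x%:~R
  | NumAdd => fun x => Some (x.1 + x.2)
  | NumMul => fun x => Some (x.1 * x.2)
  | NumOpp => fun x => Some (- x)
  | NumInv => fun x => if x == 0 then None else Some x^-1
  | NumEq => fun x => Some (x.1 == x.2)
  | Valuation => fun x => some_such (valuation_is x)
  | Eigen => fun x => some_such (eigen_data_of x)
  | Loop _ _ f => fun x => iterate (run n f) n x
  end.

Lemma iterate_mono (A B : Type) (f h : A -> option (A + B)) m n x y :
  (forall x y, f x = Some y -> h x = Some y) -> (m <= n)%N ->
  iterate f m x = Some y -> iterate h n x = Some y.
Proof.
move=> fh; elim: m n x => [//|m IH] [//|n] x /= mn.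
by case E: (f x) => [[x'|y']|] //; rewrite (fh _ _ E) //; apply: IH.
Qed.

Lemma run_mono m n a b (P : prog a b) x y : (m <= n)%N ->
  run m P x = Some y -> run n P x = Some y.
Proof.
move=> mn; elim: P x y => //=.
- move=> {}a {}b c f IHf h IHh x y.
  by case E: (run m f x) => [z|] //=; rewrite (IHf _ _ E) /=; apply: IHh.
- move=> {}a {}b c f IHf h IHh x y.
  case E: (run m f x) => [z|] //=; rewrite (IHf _ _ E) /=.
  by case E': (run m h x) => [z'|] //=; rewrite (IHh _ _ E').
- by move=> {}a {}b c d f IHf h IHh [[u|u] z] y; [apply: IHf|apply: IHh].
- by move=> {}a {}b f IHf h IHh [[] z] y; [apply: IHf|apply: IHh].
- by move=> {}a {}b f IHf x y; apply: iterate_mono.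
Qed.

(** * Input and output of the algorithm *)

Definition InputTy : ty := List Mat.

(* ((outer, center), (m, n)), for a ball of radius p ^ (m / n). *)
Definition BallTy : ty := Prod (Prod Bool Num) (Prod Int Int).

(* (index of the generator, is it inverted) *)
Definition LetterTy : ty := Prod Int Bool.

(* Respectively: the list of the a_i with their pairs of balls (B_i, B'_i);
   a word; a matrix. *)
Definition OutputTy : ty :=
  Sum (List (Prod Mat (Prod BallTy BallTy))) (Sum (List LetterTy) Mat).

Definition input_code g (gamma : 'I_g -> 'M[K]_2) : D InputTy :=
  [seq mx_code (gamma i) | i <- enum 'I_g].

Definition ball_of_code (b : D BallTy) : P1ball R K :=
  MkP1ball b.1.1 b.1.2 (p%:R `^ (b.2.1%:~R / b.2.2%:~R)).

Definition letter_code g (l : 'I_g * bool) : D LetterTy :=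
  (Posz (nat_of_ord l.1), l.2).

Definition outcome_good g (gamma : 'I_g -> 'M[K]_2) (y : D OutputTy) : Prop :=
  exists (a : 'I_g -> 'M[K]_2) (b b' : 'I_g -> D BallTy) (F : set (P1 K)),
    [/\ y = inl [seq (mx_code (a i), (b i, b' i)) | i <- enum 'I_g],
        forall i, a i \in unitmx,
        [/\ generated_group a = generated_group gamma, freely_generate a &
            good_position abs a],
        good_fundamental_domain abs a (fun i => ball_of_code (b i))
          (fun i => ball_of_code (b' i)) F &
        Schottky_group abs (generated_group gamma)].

Definition outcome_relation g (gamma : 'I_g -> 'M[K]_2) (y : D OutputTy) :
    Prop :=
  exists w : seq ('I_g * bool),
    [/\ y = inr (inl [seq letter_code l | l <- w]),
        w != [::], reduced w, is_scalar_mx (word_value gamma w) &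
        ~ freely_generate gamma].

Definition outcome_not_hyperbolic g (gamma : 'I_g -> 'M[K]_2)
    (y : D OutputTy) : Prop :=
  exists M : 'M[K]_2,
    [/\ y = inr (inr (mx_code M)),
        generated_group gamma M, ~ is_scalar_mx M, ~ hyperbolic abs M &
        ~ Schottky_group abs (generated_group gamma)].

End Semantics.

(* Main.v *)
From mathcomp Require Import all_boot all_order all_fingroup all_algebra.
From mathcomp Require Import all_classical all_reals all_analysis.
From mathcomp Require Import ring lra.
Require Import Defs.

(* A class of GL(2, Q_p) modulo Q_p^* GL(2, Z_p) is a vertex of the Bruhat-Tits
   tree, and Gamma is Schottky iff every non-scalar element satisfies
   |tr|^2 > |det|, in which case it fixes no vertex. Free generators a_i are in
   good position as soon as there are matrices A_i over Q_p, each standing for a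
   directed edge of the tree, such that the 2g edges A_i and a_i^-1 A_i J point
   away from each other pairwise, where J reverses edges; this is a comparison of
   valuations of matrix entries. By ping-pong such data prove that the a_i are
   free and that Gamma is Schottky; if the a_i generate Gamma, a free group of
   rank g being Hopfian, the gamma_i are free generators as well.

   Conversely, if Gamma is Schottky and freely generated by the gamma_i, a
   maximal convex set D of vertices that meets every orbit at most once (Zorn)
   meets every orbit exactly once, and the s in Gamma for which s D is adjacent
   to D generate Gamma. A minimal finite subset that generates Gamma is, together
   with the edges between D and s D, of the required kind; it has g elements by
   invariance of the rank. The condition on the A_i is open and invariant under
   scaling, so that the A_i can be taken with integral entries.

   Hence it suffices to search exhaustively for a reduced word that is scalar or
   not hyperbolic, or for words a_i and integral matrices A_i as above together
   with expressions of the gamma_i in the a_i. *)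

Set Implicit Arguments.
Unset Strict Implicit.
Unset Printing Implicit Defensive.

Import Order.TTheory GRing.Theory Num.Theory.

Local Open Scope classical_set_scope.
Local Open Scope ring_scope.

(** * The absolute value *)

(** A blind search is enough because the certificates exclude each other: one for outcome (i) proves
    that the [gamma i] freely generate a Schottky group, the other two refute this. Whichever is met
    first is the right answer, and no bound on the search is needed, only the existence of some
    certificate. As Q_p is uncountable, the candidates have to be words for the a_i and integral
    matrices for the A_i in order to be enumerable.

    The tree is never built. The distance of two vertices is read off from the norm and the
    determinant of [adj2 X * Y], and the four-point inequality replaces arguments on paths. Since
    everything is projective, adjugates can stand for inverses.

    Free groups enter through homomorphisms to finite groups. Counting those to a group of order 2
    gives the invariance of the rank. The Hopf property follows from residual finiteness, because an
    injective map between finite sets of the same size is onto. *)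

Section Abs.
Variables (p : nat) (R : realType) (K : fieldType) (abs : K -> R).
Hypotheses (hp : prime p) (hK : is_Cp abs p).

Local Notation Qp := (Qp abs).

Lemma pR_gt1 : 1 < p%:R :> R. Proof. by rewrite ltr1n prime_gt1. Qed.
Lemma pR_gt0 : 0 < p%:R :> R. Proof. by rewrite ltr0n prime_gt0. Qed.
Lemma pR_neq0 : p%:R != 0 :> R. Proof. by rewrite gt_eqF ?pR_gt0. Qed.

Lemma abs_ge0 x : 0 <= abs x. Proof. exact: (abs_nonneg hK). Qed.

Lemma abs_eq0 x : (abs x == 0) = (x == 0).
Proof. by apply/eqP/eqP => /(abs_eq0P hK). Qed.

Lemma abs0 : abs 0 = 0. Proof. by apply/eqP; rewrite abs_eq0. Qed.

Lemma abs_gt0 x : (0 < abs x) = (x != 0).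
Proof. by rewrite lt_def abs_ge0 andbT abs_eq0. Qed.

Lemma absM x y : abs (x * y) = abs x * abs y. Proof. exact: (abs_mul hK). Qed.

Lemma abs1 : abs 1 = 1.
Proof.
have h : abs 1 != 0 by rewrite abs_eq0 oner_eq0.
by apply: (mulfI h); rewrite -absM !mulr1.
Qed.

Lemma absN x : abs (- x) = abs x.
Proof.
have h : abs (-1) ^+ 2 = 1 ^+ 2 by rewrite expr2 -absM mulrNN mulr1 abs1 expr1n.
rewrite -mulN1r absM; have /eqP -> : abs (-1) == 1.
  by rewrite -(@eqrXn2 _ 2) ?abs_ge0 ?ler01 // h.
by rewrite mul1r.
Qed.

Lemma absV x : abs x^-1 = (abs x)^-1.
Proof.
have [->|x0] := eqVneq x 0; first by rewrite invr0 abs0 invr0.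
have h : abs x != 0 by rewrite abs_eq0.
by apply: (mulfI h); rewrite -absM !mulfV // abs1.
Qed.

Lemma absX x n : abs (x ^+ n) = abs x ^+ n.
Proof. by elim: n => [|n IH]; rewrite ?expr0 ?abs1 // !exprS absM IH. Qed.

Lemma absD_le x y r : abs x <= r -> abs y <= r -> abs (x + y) <= r.
Proof.
by move=> hx hy; apply: le_trans (abs_ultrametric hK _ _) _; rewrite ge_max hx hy.
Qed.

Lemma absB_le x y r : abs x <= r -> abs y <= r -> abs (x - y) <= r.
Proof. by move=> hx hy; apply: absD_le; rewrite ?absN. Qed.

Lemma absD_lt x y r : abs x < r -> abs y < r -> abs (x + y) < r.
Proof.
by move=> hx hy; apply: le_lt_trans (abs_ultrametric hK _ _) _; rewrite gt_max hx hy.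
Qed.

Lemma absB_lt x y r : abs x < r -> abs y < r -> abs (x - y) < r.
Proof. by move=> hx hy; apply: absD_lt; rewrite ?absN. Qed.

Lemma absDl x y : abs y < abs x -> abs (x + y) = abs x.
Proof.
move=> h; apply: le_anti; rewrite absD_le ?(ltW h) //=.
rewrite leNgt; apply/negP => h'.
by have := absB_lt h' h; rewrite addrK ltxx.
Qed.

Lemma absDr x y : abs x < abs y -> abs (x + y) = abs y.
Proof. by move=> h; rewrite addrC absDl. Qed.

Lemma absC x y : abs (x - y) = abs (y - x).
Proof. by rewrite -absN opprB. Qed.

Lemma abs_p_eq : abs p%:R = p%:R^-1. Proof. exact: (abs_p hK). Qed.

Lemma abs_p_lt1 : abs p%:R < 1.
Proof. by rewrite abs_p_eq invf_lt1 ?pR_gt0 // pR_gt1. Qed.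

Lemma abs_p_gt0 : 0 < abs p%:R.
Proof. by rewrite abs_p_eq invr_gt0 pR_gt0. Qed.

Lemma pK_neq0 : p%:R != 0 :> K. Proof. by rewrite -abs_gt0 abs_p_gt0. Qed.

Lemma abs_nat_le1 n : abs n%:R <= 1.
Proof. by elim: n => [|n IH]; rewrite ?abs0 // -natr1 absD_le ?abs1. Qed.

(** If |n| < 1, a Bezout relation u n - v p = 1 would write 1 as a difference of two elements of
    absolute value below 1. *)
Lemma abs_coprime n : ~~ (p %| n)%N -> abs n%:R = 1.
Proof.
move=> hn; apply/eqP; rewrite eq_le abs_nat_le1 leNgt; apply/negP => h.
have n0 : (0 < n)%N by case: n hn {h} => //; rewrite dvdn0.
case: (egcdnP p n0) => u v e _.
have g1 : gcdn n p = 1%N.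
  by apply/eqP; rewrite -[_ == _]/(coprime n p) coprime_sym prime_coprime.
rewrite g1 in e.
have : (u * n)%N%:R - (v * p)%N%:R = 1 :> K by rewrite e natrD addrC addKr.
move=> /(congr1 abs); rewrite abs1 => e1.
have : abs ((u * n)%N%:R - (v * p)%N%:R) < 1.
  apply: absB_lt; rewrite natrM absM.
    by apply: le_lt_trans h; rewrite ler_piMl ?abs_ge0 ?abs_nat_le1.
  by apply: le_lt_trans abs_p_lt1; rewrite ler_piMl ?abs_ge0 ?abs_nat_le1.
by rewrite e1 ltxx.
Qed.

Lemma abs_nat n : (0 < n)%N -> abs n%:R = p%:R ^- logn p n.
Proof.
move=> n0; have [m cpm e] := pfactor_coprime hp n0.
rewrite [in LHS]e natrM absM natrX absX abs_p_eq exprVn (@abs_coprime m) ?mul1r -?prime_coprime //.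
Qed.

Lemma natK_eq0 n : (n%:R == 0 :> K) = (n == 0%N).
Proof.
have [->|n0] := posnP n; first by rewrite !eqxx.
by rewrite -abs_eq0 abs_nat // !gt_eqF ?invr_gt0 ?exprn_gt0 ?pR_gt0.
Qed.

Lemma intK_eq0 (z : int) : (z%:~R == 0 :> K) = (z == 0).
Proof.
by case: z => n; rewrite ?NegzE ?mulrNz ?oppr_eq0 -pmulrn natK_eq0.
Qed.

(** Quotients of integers in K are easier to compute with than [ratr]. The passage between them
    needs K to have characteristic 0, which [intK_eq0] obtains from the absolute values of
    integers. *)
Lemma QpP x : Qp x <-> forall e : R, 0 < e ->
  exists n m : int, m != 0 /\ abs (x - n%:~R / m%:~R) < e.
Proof.
split=> h e e0.
  have [q hq] := h e e0; by exists (numq q), (denq q); rewrite denq_neq0.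
have [n [m [m0 hnm]]] := h e e0.
exists (n%:~R / m%:~R); suff -> : ratr (n%:~R / m%:~R) = n%:~R / m%:~R :> K by [].
set q : rat := _ / _; rewrite /ratr.
have hq : (numq q * m)%:~R = (n * denq q)%:~R :> rat.
  rewrite !intrM; apply: (@mulIf _ ((denq q)%:~R^-1)).
    by rewrite invr_eq0 intr_eq0 denq_neq0.
  rewrite mulfK ?intr_eq0 ?denq_neq0 // mulrAC divq_num_den /q divfK //.
  by rewrite intr_eq0.
move/eqP: hq; rewrite eqr_int => /eqP hq.
apply/eqP; rewrite eqr_div ?intK_eq0 ?denq_neq0 //.
by rewrite -!intrM hq.
Qed.

Lemma Qp_frac (n m : int) : Qp (n%:~R / m%:~R).
Proof.
have [->|m0] := eqVneq m 0.
  rewrite invr0 mulr0; apply/QpP => e e0; exists 0, 1.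
  by rewrite mul0r subr0 abs0.
by apply/QpP => e e0; exists n, m; rewrite subrr abs0.
Qed.

Lemma Qp_int (n : int) : Qp n%:~R.
Proof. by have := Qp_frac n 1; rewrite divr1. Qed.

Lemma Qp_nat (n : nat) : Qp n%:R. Proof. exact: (Qp_int n). Qed.
Lemma Qp0 : Qp 0. Proof. exact: (Qp_int 0). Qed.
Lemma Qp1 : Qp 1. Proof. exact: (Qp_int 1). Qed.

Lemma QpN x : Qp x -> Qp (- x).
Proof.
move=> /QpP h; apply/QpP => e e0; have [n [m [m0 hnm]]] := h e e0.
by exists (- n), m; split=> //; rewrite mulrNz mulNr -opprD absN.
Qed.

Lemma QpD x y : Qp x -> Qp y -> Qp (x + y).
Proof.
move=> /QpP hx /QpP hy; apply/QpP => e e0.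
have [n [m [m0 hnm]]] := hx e e0; have [n' [m' [m'0 hnm']]] := hy e e0.
exists (n * m' + n' * m), (m * m'); rewrite mulf_neq0 //; split=> //.
have -> : (n * m' + n' * m)%:~R / (m * m')%:~R
    = n%:~R / m%:~R + n'%:~R / m'%:~R :> K.
  by rewrite addf_div ?intK_eq0 // rmorphD !rmorphM.
by rewrite opprD addrACA absD_lt.
Qed.

Lemma QpB x y : Qp x -> Qp y -> Qp (x - y).
Proof. by move=> hx hy; apply: QpD => //; apply: QpN. Qed.

Lemma QpM x y : Qp x -> Qp y -> Qp (x * y).
Proof.
move=> /QpP hx /QpP hy; apply/QpP => e e0.
pose A := abs x + abs y + 1.
have A1 : 1 <= A by rewrite /A lerDr addr_ge0 ?abs_ge0.
have A0 : 0 < A by apply: lt_le_trans A1.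
have eA : 0 < e / A by rewrite divr_gt0.
have e1 : 0 < Num.min 1 (e / A) by rewrite lt_min ltr01 eA.
have [n [m [m0]]] := hx _ eA; have [n' [m' [m'0]]] := hy _ e1.
set r := n'%:~R / _; set q := n%:~R / _ ; rewrite lt_min => /andP[r1 re] qe.
exists (n * n'), (m * m'); rewrite mulf_neq0 //; split=> //.
have -> : (n * n')%:~R / (m * m')%:~R = q * r :> K.
  by rewrite /q /r !rmorphM /= mulf_div.
have -> : x * y - q * r = x * (y - r) + (x - q) * r by ring.
have hr : abs r <= A.
  have -> : r = y - (y - r) by ring.
  apply: absB_le; rewrite /A; last by rewrite (le_trans (ltW r1)).
  by rewrite -addrA addrCA lerDl addr_ge0 ?abs_ge0 // ler01.
have hxA : abs x <= A by rewrite /A -addrA lerDl addr_ge0 ?abs_ge0 ?ler01.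
apply: absD_lt; rewrite absM.
  apply: le_lt_trans (_ : A * abs (y - r) < _); first by rewrite ler_wpM2r ?abs_ge0.
  by rewrite mulrC -ltr_pdivlMr.
apply: le_lt_trans (_ : abs (x - q) * A < _); first by rewrite ler_wpM2l ?abs_ge0.
by rewrite -ltr_pdivlMr.
Qed.

Lemma QpV x : Qp x -> Qp x^-1.
Proof.
have [->|x0] := eqVneq x 0; first by rewrite invr0.
move=> /QpP h; apply/QpP => e e0.
have ax : 0 < abs x by rewrite abs_gt0.
have : 0 < Num.min (abs x) (e * abs x ^+ 2) by rewrite lt_min ax mulr_gt0 ?exprn_gt0.
move=> /h[n [m [m0]]]; set q := n%:~R / _; rewrite lt_min => /andP[h1 h2].
have aq : abs q = abs x.
  by rewrite -[q](subrK x) absDr // absC.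
have q0 : q != 0 by rewrite -abs_gt0 aq.
have n0 : n != 0 by apply: contraNneq q0 => n0; rewrite /q n0 mul0r.
exists m, n; split=> //.
have -> : m%:~R / n%:~R = q^-1 :> K by rewrite /q invf_div.
have -> : x^-1 - q^-1 = (q - x) / (x * q).
  by field; rewrite x0 q0.
by rewrite absM absV absM aq absC ltr_pdivrMr ?mulr_gt0 // -expr2.
Qed.

Lemma QpX x n : Qp x -> Qp (x ^+ n).
Proof.
by move=> h; elim: n => [|n IH]; rewrite ?expr0 ?exprS; [exact: Qp1|exact: QpM].
Qed.

(** A rational closer to x than |x| has the absolute value of x, so the values on [Qp] are those of
    the rationals. *)
Lemma Qp_abs x : Qp x -> x != 0 -> exists v : int, abs x = p%:R ^ v.
Proof.
move=> /QpP h x0; have : 0 < abs x by rewrite abs_gt0.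
move=> /h[n [m [m0]]]; set q := n%:~R / _ => h1.
have aq : abs q = abs x by rewrite -[q](subrK x) absDr // absC.
have q0 : q != 0 by rewrite -abs_gt0 aq abs_gt0.
have n0 : n != 0 by apply: contraNneq q0 => n0; rewrite /q n0 mul0r.
have absint (z : int) : z != 0 -> abs z%:~R = p%:R ^ (- (logn p `|z|%N)%:Z).
  move=> z0; rewrite -exprnN -abs_nat ?absz_gt0 //.
  by case: z z0 => k _ //; rewrite NegzE mulrNz absN.
exists (- (logn p `|n|%N)%:Z + (logn p `|m|%N)%:Z).
by rewrite -aq absM absV !absint // expfzDr ?pR_neq0 // invr_expz opprK.
Qed.

(** Discreteness of the value group: a strict inequality in [Qp] gains a factor p, which is a full
    step in the tree. *)
Lemma Qp_discrete x y : Qp x -> Qp y -> abs x < abs y -> p%:R * abs x <= abs y.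
Proof.
move=> hx hy; have [->|x0] := eqVneq x 0; first by rewrite abs0 mulr0 => /ltW.
have [->|y0] := eqVneq y 0; first by rewrite abs0 ltNge abs_ge0.
have [v ->] := Qp_abs hx x0; have [w ->] := Qp_abs hy y0.
rewrite ltr_eXz2l ?pR_gt1 // => vw.
rewrite -{1}[p%:R]expr1z -expfzDr ?pR_neq0 // ler_eXz2l ?pR_gt1 //.
by rewrite lez1D.
Qed.

End Abs.

(** * Two by two matrices *)

Section Matrices.
Variable K : fieldType.
Implicit Types M N X Y : 'M[K]_2.

Definition mx2 (a b c d : K) : 'M[K]_2 :=
  \matrix_(i, j) if i == 0 then if j == 0 then a else b
                 else if j == 0 then c else d.

Lemma mx2E00 a b c d : mx2 a b c d 0 0 = a. Proof. by rewrite mxE. Qed.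
Lemma mx2E01 a b c d : mx2 a b c d 0 1 = b. Proof. by rewrite mxE. Qed.
Lemma mx2E10 a b c d : mx2 a b c d 1 0 = c. Proof. by rewrite mxE. Qed.
Lemma mx2E11 a b c d : mx2 a b c d 1 1 = d. Proof. by rewrite mxE. Qed.
Definition mx2E := (mx2E00, mx2E01, mx2E10, mx2E11).

Lemma ord2P (P : 'I_2 -> Prop) : P 0 -> P 1 -> forall i, P i.
Proof.
move=> h0 h1 [[|[|//]] hi].
  by have -> : Ordinal hi = 0 by apply: val_inj.
by have -> : Ordinal hi = 1 by apply: val_inj.
Qed.

Lemma mx2_eta M : M = mx2 (M 0 0) (M 0 1) (M 1 0) (M 1 1).
Proof. by apply/matrixP; apply: ord2P; apply: ord2P; rewrite mx2E. Qed.

Lemma mx2_inj M N : [/\ M 0 0 = N 0 0, M 0 1 = N 0 1, M 1 0 = N 1 0 & M 1 1 = N 1 1] ->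
  M = N.
Proof. by case=> e1 e2 e3 e4; rewrite [M]mx2_eta [N]mx2_eta e1 e2 e3 e4. Qed.

Lemma mul2E M N i j : (M * N) i j = M i 0 * N 0 j + M i 1 * N 1 j.
Proof. by rewrite mxE big_ord_recl big_ord1; congr (_ + M i _ * N _ j); apply: val_inj. Qed.

Lemma det2E M : \det M = M 0 0 * M 1 1 - M 0 1 * M 1 0.
Proof.
rewrite (expand_det_row _ 0) big_ord_recl big_ord1 /cofactor !det_mx11 !mxE /=.
have e0 (i : 'I_1) : i = 0 by apply: val_inj; case: i => [[]].
have -> : lift 0 0 = 1 :> 'I_2 by apply: val_inj.
have -> : lift 1 0 = 0 :> 'I_2 by apply: val_inj.
by rewrite expr0 expr1 mul1r mulN1r mulrN.
Qed.

Lemma tr2E M : \tr M = M 0 0 + M 1 1.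
Proof. by rewrite /mxtrace big_ord_recl big_ord1; congr (_ + M _ _); apply: val_inj. Qed.

Lemma scal2E (c : K) : c%:M = mx2 c 0 0 c :> 'M[K]_2.
Proof. by apply/matrixP; apply: ord2P; apply: ord2P; rewrite !mxE. Qed.

Definition adj2 M : 'M[K]_2 := mx2 (M 1 1) (- M 0 1) (- M 1 0) (M 0 0).

Lemma scale2E (c : K) M i j : (c *: M) i j = c * M i j.
Proof. by rewrite mxE. Qed.
Lemma add2E M N i j : (M + N) i j = M i j + N i j.
Proof. by rewrite mxE. Qed.
Lemma opp2E M i j : (- M) i j = - M i j.
Proof. by rewrite mxE. Qed.
Lemma one2E : 1 = mx2 1 0 0 1. Proof. exact: scal2E. Qed.

Definition mxE2 := (mul2E, det2E, tr2E, scal2E, one2E, mx2E, scale2E, add2E, opp2E).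

Lemma det_adj2 M : \det (adj2 M) = \det M.
Proof. by rewrite !mxE2; ring. Qed.
Lemma adj2K : involutive adj2.
Proof. by move=> M; apply: mx2_inj; rewrite /adj2 !mxE2 !opprK. Qed.
Lemma adj2M M N : adj2 (M * N) = adj2 N * adj2 M.
Proof. by apply: mx2_inj; rewrite /adj2 !mxE2; split; ring. Qed.
Lemma adj2Z c M : adj2 (c *: M) = c *: adj2 M.
Proof. by apply: mx2_inj; rewrite /adj2 !mxE2; split; ring. Qed.
Lemma mul_adj2 M : M * adj2 M = (\det M)%:M.
Proof. by apply: mx2_inj; rewrite /adj2 !mxE2; split; ring. Qed.
Lemma adj2_mul M : adj2 M * M = (\det M)%:M.
Proof. by apply: mx2_inj; rewrite /adj2 !mxE2; split; ring. Qed.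
Lemma mulmxS (c : K) M : M * c%:M = c *: M.
Proof. by apply: mx2_inj; rewrite !mxE2; split; ring. Qed.
Lemma mulSmx (c : K) M : c%:M * M = c *: M.
Proof. by apply: mx2_inj; rewrite !mxE2; split; ring. Qed.
Lemma adj2S (c : K) : adj2 c%:M = c%:M.
Proof. by apply: mx2_inj; rewrite /adj2 !mxE2 oppr0. Qed.
Lemma det2M M N : \det (M * N) = \det M * \det N.
Proof. by rewrite !mxE2; ring. Qed.
Lemma det2Z c M : \det (c *: M) = c ^+ 2 * \det M.
Proof. by rewrite !mxE2; ring. Qed.
Lemma tr2Z c M : \tr (c *: M) = c * \tr M.
Proof. by rewrite !mxE2; ring. Qed.
Lemma tr2MC M N : \tr (M * N) = \tr (N * M).
Proof. by rewrite !mxE2; ring. Qed.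
Lemma mul2Zl c M N : (c *: M) * N = c *: (M * N).
Proof. by apply: mx2_inj; rewrite !mxE2; split; ring. Qed.
Lemma mul2Zr c M N : M * (c *: N) = c *: (M * N).
Proof. by apply: mx2_inj; rewrite !mxE2; split; ring. Qed.
Lemma unitmx2 M : (M \in unitmx) = (\det M != 0).
Proof. by rewrite unitmxE unitfE. Qed.

Lemma invmx2 M : \det M != 0 -> invmx M = (\det M)^-1 *: adj2 M.
Proof.
move=> h; have u : M \in unitmx by rewrite unitmx2.
have e : M *m ((\det M)^-1 *: adj2 M) = 1%:M.
  by rewrite -[_ *m _]/(_ * _) mul2Zr mul_adj2 scale_scalar_mx mulVf.
by rewrite -[RHS](mulKmx u) e mulmx1.
Qed.

Lemma is_scalar2E M : is_scalar_mx M = [&& M 0 1 == 0, M 1 0 == 0 & M 0 0 == M 1 1].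
Proof.
apply/is_scalar_mxP/and3P => [[c ->]|[/eqP h1 /eqP h2 /eqP h3]].
  by rewrite !mxE2.
by exists (M 0 0); apply: mx2_inj; rewrite !mxE2 h1 h2 h3.
Qed.

Lemma is_scalarZ2 c M : c != 0 -> is_scalar_mx (c *: M) = is_scalar_mx M.
Proof.
move=> c0; rewrite !is_scalar2E !mxE2 !mulf_eq0 (negbTE c0) /=.
by rewrite (inj_eq (mulfI c0)).
Qed.

End Matrices.

(** * The Bruhat-Tits tree *)

Section Tree.
Variables (p : nat) (R : realType) (K : fieldType) (abs : K -> R).
Hypotheses (hp : prime p) (hK : is_Cp abs p).
Implicit Types M N X Y Z W : 'M[K]_2.

Local Notation Qp := (Qp abs).
Local Notation P := (p%:R : R).

Definition mxnorm M : R :=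
  Num.max (Num.max (abs (M 0 0)) (abs (M 0 1))) (Num.max (abs (M 1 0)) (abs (M 1 1))).

Lemma mxnorm_leP M r : reflect (forall i j, abs (M i j) <= r) (mxnorm M <= r).
Proof.
rewrite /mxnorm !ge_max; apply: (iffP idP) => [/andP[/andP[h1 h2] /andP[h3 h4]]|h].
  by apply: ord2P; apply: ord2P.
by rewrite !h.
Qed.

Lemma le_mxnorm M i j : abs (M i j) <= mxnorm M.
Proof. by have /mxnorm_leP := lexx (mxnorm M). Qed.

Lemma mxnorm_attained M : exists i j, mxnorm M = abs (M i j).
Proof.
rewrite /mxnorm; case: (leP (abs (M 1 0)) (abs (M 1 1))) => _;
case: (leP (abs (M 0 0)) (abs (M 0 1))) => _; case: ltP => _; by do 2!eexists.
Qed.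

Lemma mxnorm_ge0 M : 0 <= mxnorm M.
Proof. by have [i [j ->]] := mxnorm_attained M; exact: (abs_ge0 hK). Qed.

Lemma mxnorm_gt0 M : \det M != 0 -> 0 < mxnorm M.
Proof.
move=> d0; rewrite lt_def mxnorm_ge0 andbT; apply: contraNneq d0 => n0.
have h i j : M i j = 0.
  by apply/eqP; rewrite -(abs_eq0 hK) eq_le (abs_ge0 hK) andbT -n0 le_mxnorm.
by rewrite det2E !h mulr0 subr0.
Qed.

Lemma mxnormZ c M : mxnorm (c *: M) = abs c * mxnorm M.
Proof.
by rewrite /mxnorm !mxE2 !(absM hK) !maxr_pMr ?(abs_ge0 hK).
Qed.

Lemma mxnorm_adj M : mxnorm (adj2 M) = mxnorm M.
Proof.
rewrite /mxnorm /adj2 !mxE2 !(absN hK) (maxC (abs (M 1 1))) (maxC (abs (M 1 0))).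
by rewrite maxACA (maxC (abs (M 0 1))) (maxC (abs (M 1 1))).
Qed.

Lemma mxnormS c : mxnorm c%:M = abs c.
Proof.
rewrite /mxnorm !mxE2 (abs0 hK) (max_l (abs_ge0 hK _)) (max_r (abs_ge0 hK _)).
by rewrite maxxx.
Qed.

Lemma mxnormM M N : mxnorm (M * N) <= mxnorm M * mxnorm N.
Proof.
apply/mxnorm_leP => i j; rewrite mul2E.
apply: (absD_le hK); rewrite (absM hK) ler_pM ?(abs_ge0 hK) ?le_mxnorm //.
Qed.

Lemma tr_le_mxnorm M : abs (\tr M) <= mxnorm M.
Proof. by rewrite tr2E (absD_le hK) ?le_mxnorm. Qed.

(** Up to sign the entries of [adj2 X * Y], written as minors of two columns, the form in which the
    Pluecker relation applies. *)
Definition wedge X i Y j : K := X 0 i * Y 1 j - X 1 i * Y 0 j.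

(* p to the power of the distance between the vertices of X and Y; in particular
   [tdist X Y = 1] means that X and Y represent the same vertex. *)
Definition tdist X Y : R :=
  mxnorm (adj2 X * Y) ^+ 2 / (abs (\det X) * abs (\det Y)).

Local Notation u X Y := (mxnorm (adj2 X * Y)).

Lemma wedge_le X Y i j : abs (wedge X i Y j) <= u X Y.
Proof.
move: i; apply: ord2P.
  have -> : wedge X 0 Y j = (adj2 X * Y) 1 j by rewrite /wedge /adj2 !mxE2; ring.
  exact: le_mxnorm.
rewrite -(absN hK).
have -> : - wedge X 1 Y j = (adj2 X * Y) 0 j by rewrite /wedge /adj2 !mxE2; ring.
exact: le_mxnorm.
Qed.

Lemma wedge_attained X Y : exists i j, u X Y = abs (wedge X i Y j).
Proof.
have [i [j ->]] := mxnorm_attained (adj2 X * Y); move: i; apply: ord2P.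
  exists 1, j; rewrite -(absN hK); congr abs.
  by rewrite /wedge /adj2 !mxE2; ring.
by exists 0, j; congr abs; rewrite /wedge /adj2 !mxE2; ring.
Qed.

(* The Pluecker relation between four columns makes GL(2, Q_p) 0-hyperbolic. *)
Lemma mxnorm_4pt X Y Z W :
  u X Y * u Z W <= Num.max (u X Z * u Y W) (u X W * u Y Z).
Proof.
have [i [j ->]] := wedge_attained X Y; have [k [l ->]] := wedge_attained Z W.
rewrite -(absM hK).
have -> : wedge X i Y j * wedge Z k W l =
    wedge X i Z k * wedge Y j W l - wedge X i W l * wedge Y j Z k.
  by rewrite /wedge; ring.
have h A B C D i1 i2 i3 i4 :
    abs (wedge A i1 B i2 * wedge C i3 D i4) <= u A B * u C D.
  by rewrite (absM hK) ler_pM ?(abs_ge0 hK) ?wedge_le.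
by apply: (absB_le hK); rewrite le_max h ?orbT.
Qed.

Definition vertex X := (forall i j, Qp (X i j)) /\ \det X != 0.

Lemma absdet_gt0 X : \det X != 0 -> 0 < abs (\det X).
Proof. by rewrite (abs_gt0 hK). Qed.

(** The three ways to pair X, Y, Z, W have the same product of determinants as denominator, so this
    is the square of [mxnorm_4pt]: the four-point condition of a tree, with sums of distances
    written as products. *)
Lemma tdist_4pt X Y Z W : \det X != 0 -> \det Y != 0 -> \det Z != 0 -> \det W != 0 ->
  tdist X Y * tdist Z W <= Num.max (tdist X Z * tdist Y W) (tdist X W * tdist Y Z).
Proof.
move=> /absdet_gt0 x0 /absdet_gt0 y0 /absdet_gt0 z0 /absdet_gt0 w0.
have := mxnorm_4pt X Y Z W.
set D := abs (\det X) * abs (\det Y) * abs (\det Z) * abs (\det W).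
have D0 : 0 < D by rewrite !mulr_gt0.
have e A B C E : 0 < abs (\det A) -> 0 < abs (\det B) -> 0 < abs (\det C) ->
    0 < abs (\det E) ->
    abs (\det A) * abs (\det B) * abs (\det C) * abs (\det E) = D ->
    tdist A B * tdist C E = (u A B * u C E) ^+ 2 / D.
  move=> a0 b0 c0 e0 <-; rewrite /tdist exprMn.
  by field; rewrite !gt_eqF.
rewrite !e //; try by rewrite /D; ring.
rewrite !le_max !ler_pM2r ?invr_gt0 //.
by rewrite !ler_sqr ?nnegrE ?mulr_ge0 ?mxnorm_ge0.
Qed.

Lemma tdist_sym X Y : tdist X Y = tdist Y X.
Proof.
by rewrite /tdist -mxnorm_adj adj2M adj2K [X in _ / X]mulrC.
Qed.

Lemma tdist_xx X : \det X != 0 -> tdist X X = 1.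
Proof.
move=> /absdet_gt0 x0; rewrite /tdist adj2_mul mxnormS expr2 mulfV //.
by rewrite mulf_neq0 // gt_eqF.
Qed.

(** The four-point condition with W = Z. *)
Lemma tdist_tri X Y Z : \det X != 0 -> \det Y != 0 -> \det Z != 0 ->
  tdist X Y <= tdist X Z * tdist Z Y.
Proof.
move=> x0 y0 z0; have := tdist_4pt x0 y0 z0 z0.
by rewrite tdist_xx // mulr1 (tdist_sym Z Y) maxxx.
Qed.

Lemma tdist_gt0 X Y : \det X != 0 -> \det Y != 0 -> 0 < tdist X Y.
Proof.
move=> x0 y0; apply: divr_gt0; last by rewrite mulr_gt0 ?absdet_gt0.
by rewrite exprn_gt0 // mxnorm_gt0 // det2M det_adj2 mulf_neq0.
Qed.

(** The triangle inequality from X to X by way of Y. *)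
Lemma tdist_ge1 X Y : \det X != 0 -> \det Y != 0 -> 1 <= tdist X Y.
Proof.
move=> x0 y0; have := tdist_tri x0 x0 y0.
rewrite tdist_xx // (tdist_sym Y X) -expr2 => h.
have t0 := ltW (tdist_gt0 x0 y0).
by rewrite -(@ler_sqr R) ?nnegrE ?ler01 // expr1n.
Qed.

Lemma tdist_mul h X Y : \det h != 0 -> tdist (h * X) (h * Y) = tdist X Y.
Proof.
move=> /absdet_gt0 h0; rewrite /tdist adj2M.
have -> : adj2 X * adj2 h * (h * Y) = \det h *: (adj2 X * Y).
  by rewrite -mulrA (mulrA (adj2 h)) adj2_mul mulSmx mul2Zr.
rewrite mxnormZ !det2M !(absM hK) exprMn.
have [->|x0] := eqVneq (\det X) 0; first by rewrite (abs0 hK) !(mul0r, mulr0, invr0).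
have [->|y0] := eqVneq (\det Y) 0; first by rewrite (abs0 hK) !(mul0r, mulr0, invr0).
have := absdet_gt0 x0; have := absdet_gt0 y0 => ay ax.
by field; rewrite !gt_eqF.
Qed.

Lemma tdistZr c X Y : c != 0 -> \det X != 0 -> \det Y != 0 ->
  tdist X (c *: Y) = tdist X Y.
Proof.
move=> c0 /absdet_gt0 x0 /absdet_gt0 y0.
rewrite /tdist mul2Zr mxnormZ det2Z (absM hK) (absX hK) exprMn.
have ac : 0 < abs c by rewrite (abs_gt0 hK).
by field; rewrite !gt_eqF.
Qed.

Lemma tdist_eq1_l X X' Y : \det X != 0 -> \det X' != 0 -> \det Y != 0 ->
  tdist X X' = 1 -> tdist X Y = tdist X' Y.
Proof.
move=> x0 x'0 y0 e; apply: le_anti; apply/andP; split.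
  by have := tdist_tri x0 y0 x'0; rewrite e mul1r.
by have := tdist_tri x'0 y0 x0; rewrite (tdist_sym X' X) e mul1r.
Qed.

Lemma tdistE X Y : tdist X Y = mxnorm (adj2 X * Y) ^+ 2 / abs (\det (adj2 X * Y)).
Proof. by rewrite /tdist det2M det_adj2 (absM hK). Qed.

Lemma Qp_mul2 M N : (forall i j, Qp (M i j)) -> (forall i j, Qp (N i j)) ->
  forall i j, Qp ((M * N) i j).
Proof. by move=> hM hN i j; rewrite mul2E; apply: (QpD hp hK); apply: (QpM hp hK). Qed.

Lemma Qp_mx2 a b c d : Qp a -> Qp b -> Qp c -> Qp d -> forall i j, Qp (mx2 a b c d i j).
Proof. by move=> ? ? ? ?; apply: ord2P; apply: ord2P; rewrite mx2E. Qed.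

Lemma Qp_adj2 M : (forall i j, Qp (M i j)) -> forall i j, Qp (adj2 M i j).
Proof. by move=> h; apply: Qp_mx2 => //; apply: (QpN hp hK). Qed.

Lemma Qp_det2 M : (forall i j, Qp (M i j)) -> Qp (\det M).
Proof.
by move=> h; rewrite det2E; apply: (QpB hp hK); apply: (QpM hp hK).
Qed.

Lemma Qp_tr2 M : (forall i j, Qp (M i j)) -> Qp (\tr M).
Proof. by move=> h; rewrite tr2E; apply: (QpD hp hK). Qed.

Lemma vertexM M X : vertex M -> vertex X -> vertex (M * X).
Proof.
by move=> [h1 h2] [h3 h4]; split; [apply: Qp_mul2|rewrite det2M mulf_neq0].
Qed.

Lemma vertex_adj M : vertex M -> vertex (adj2 M).
Proof. by move=> [h1 h2]; split; [apply: Qp_adj2|rewrite det_adj2]. Qed.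

Lemma vertexZ c M : Qp c -> c != 0 -> vertex M -> vertex (c *: M).
Proof.
move=> hc c0 [h1 h2]; split; last by rewrite det2Z mulf_neq0 ?expf_neq0.
by move=> i j; rewrite mxE; apply: (QpM hp hK).
Qed.

Lemma tdist_pow X Y : vertex X -> vertex Y -> exists n, tdist X Y = P ^+ n.
Proof.
move=> vX vY; have [h d0] := vertexM (vertex_adj vX) vY.
rewrite tdistE; set M := _ * _ in h d0 *.
have [i [j e]] := mxnorm_attained M.
have m0 : M i j != 0 by rewrite -(abs_gt0 hK) -e mxnorm_gt0.
have [v ev] := Qp_abs hp hK (h i j) m0.
have [w ew] := Qp_abs hp hK (Qp_det2 h) d0.
have ge1 : 1 <= mxnorm M ^+ 2 / abs (\det M).
  by rewrite -tdistE tdist_ge1 ?(proj2 vX) ?(proj2 vY).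
have e2 : mxnorm M ^+ 2 / abs (\det M) = P ^ (v + v - w).
  by rewrite e ev ew expr2 !expfzDr ?(pR_neq0 R hp) // invr_expz.
move: ge1; rewrite e2 -[1](expr0z P) ler_eXz2l ?(pR_gt1 R hp) //.
by case: (v + v - w) => // n _; exists n.
Qed.

Lemma mxnorm_lt_le M x : (forall i j, Qp (M i j)) -> Qp x -> abs x < mxnorm M ->
  P * abs x <= mxnorm M.
Proof.
by move=> h hx; have [i [j ->]] := mxnorm_attained M; apply: (Qp_discrete hp hK).
Qed.

End Tree.

(** * Cartan decomposition, and the edges that leave a convex set *)

Section Edges.
Variables (p : nat) (R : realType) (K : fieldType) (abs : K -> R).
Hypotheses (hp : prime p) (hK : is_Cp abs p).
Implicit Types M N X Y Z W A B F : 'M[K]_2.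

Local Notation Qp := (Qp abs).
Local Notation P := (p%:R : R).
Local Notation vertex := (vertex abs).
Local Notation tdist := (tdist abs).
Local Notation mxnorm := (mxnorm abs).

(** [X * dgp n] lies n steps away from X on the ray towards the end given by the second column of
    X. *)
Definition dgp n : 'M[K]_2 := mx2 (p%:R ^+ n) 0 0 1.
Definition swap : 'M[K]_2 := mx2 0 1 1 0.

Lemma tdist_mulr X U : \det X != 0 -> tdist X (X * U) = mxnorm U ^+ 2 / abs (\det U).
Proof.
move=> x0; rewrite -{1}[X]mulr1 (tdist_mul hK) // (tdistE hK).
by rewrite one2E /adj2 !mx2E oppr0 -one2E mul1r.
Qed.

Lemma abs_pX n : abs (p%:R ^+ n) = P ^- n.
Proof. by rewrite (absX hK) (abs_p_eq hK) exprVn. Qed.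

Lemma PXV_le1 n : P ^- n <= 1.
Proof. by rewrite invf_le1 ?exprn_gt0 ?(pR_gt0 R hp) // exprn_ege1 // ltW ?(pR_gt1 R hp). Qed.

Lemma det_dgp n : \det (dgp n) = p%:R ^+ n.
Proof. by rewrite !mxE2; ring. Qed.

Lemma vertex_dgp n : vertex (dgp n).
Proof.
split; last by rewrite det_dgp expf_neq0 // (pK_neq0 hp hK).
apply: Qp_mx2; try exact: (Qp0 hp hK); last exact: (Qp1 hp hK).
by apply: (QpX hp hK); apply: (Qp_nat hp hK).
Qed.

Lemma vertex_swap : vertex swap.
Proof.
split; last by rewrite !mxE2 mulr0 mul1r sub0r oppr_eq0 oner_eq0.
by apply: Qp_mx2; try exact: (Qp0 hp hK); exact: (Qp1 hp hK).
Qed.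

Lemma mxnorm_dgp n : mxnorm (dgp n) = 1.
Proof.
apply: le_anti; apply/andP; split.
  apply/mxnorm_leP; apply: ord2P; apply: ord2P;
  by rewrite !mxE2 ?abs_pX ?(abs0 hK) ?(abs1 hK) ?ler01 ?PXV_le1.
by have := le_mxnorm abs (dgp n) 1 1; rewrite mx2E (abs1 hK).
Qed.

Lemma mxnorm_swap : mxnorm swap = 1.
Proof.
apply: le_anti; apply/andP; split.
  apply/mxnorm_leP; apply: ord2P; apply: ord2P;
  by rewrite !mxE2 ?(abs0 hK) ?(abs1 hK) ?ler01.
by have := le_mxnorm abs swap 0 1; rewrite mx2E (abs1 hK).
Qed.

Lemma tdist_dgp X n : \det X != 0 -> tdist X (X * dgp n) = P ^+ n.
Proof.
by move=> x0; rewrite tdist_mulr // mxnorm_dgp det_dgp abs_pX expr1n div1r invrK.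
Qed.

Lemma tdist_swap X : \det X != 0 -> tdist X (X * swap) = 1.
Proof.
move=> x0; rewrite tdist_mulr // mxnorm_swap expr1n.
by rewrite /swap !mxE2 mulr0 !mul1r sub0r (absN hK) (abs1 hK) invr1.
Qed.

Let cartan_reduction n M : M 1 1 != 0 ->
  adj2 (dgp n) * adj2 (mx2 1 (M 0 1 / M 1 1) 0 1) * M =
  mx2 (\det M / M 1 1) 0 (p%:R ^+ n * M 1 0) (p%:R ^+ n * M 1 1).
Proof. by move=> d0; apply: mx2_inj; rewrite /adj2 !mxE2; split; field. Qed.

Let cartan_max Y X n : vertex Y -> vertex X -> tdist Y X = P ^+ n ->
  mxnorm (adj2 Y * X) = abs ((adj2 Y * X) 1 1) ->
  exists A, [/\ vertex A, tdist Y A = 1 & tdist (A * dgp n) X = 1].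
Proof.
move=> vY vX; rewrite (tdistE hK) => e; have vM := vertexM hp hK (vertex_adj hp hK vY) vX.
have M0 := mxnorm_gt0 hK (proj2 vM).
set M := adj2 Y * X in e vM M0 * => eM.
have ad : 0 < abs (M 1 1) by rewrite -eM.
have d0 : M 1 1 != 0 by rewrite -(abs_gt0 hK).
have dM0 : 0 < abs (\det M) by rewrite (abs_gt0 hK) (proj2 vM).
have P0 : 0 < P ^+ n by rewrite exprn_gt0 ?(pR_gt0 R hp).
have {}e : abs (\det M) = abs (M 1 1) ^+ 2 / P ^+ n.
  by rewrite -e -eM; field; rewrite !gt_eqF.
(* As [M 1 1] is largest, U is integral with determinant 1, so [Y * U] is the vertex of Y. The
   corresponding row operation clears the upper right entry of M. *)
pose U := mx2 1 (M 0 1 / M 1 1) 0 1.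
have dU : \det U = 1 by rewrite det2E /U !mx2E; ring.
have nU : mxnorm U = 1.
  apply: le_anti; apply/andP; split; last first.
    by have := le_mxnorm abs U 1 1; rewrite /U mx2E11 (abs1 hK).
  apply/mxnorm_leP; apply: ord2P; apply: ord2P;
  rewrite /U mx2E ?(abs0 hK) ?(abs1 hK) ?ler01 //.
  by rewrite (absM hK) (absV hK) ler_pdivrMr // mul1r -eM le_mxnorm.
have vU : vertex U.
  split; last by rewrite dU oner_eq0.
  have [h _] := vM.
  apply: Qp_mx2; [exact: (Qp1 hp hK)| |exact: (Qp0 hp hK)|exact: (Qp1 hp hK)].
  by apply: (QpM hp hK) => //; apply: (QpV hp hK).
exists (Y * U); split; first exact: (vertexM hp hK).
  by rewrite tdist_mulr ?(proj2 vY) // dU nU (abs1 hK) expr1n divr1.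
rewrite (tdistE hK); set T := adj2 _ * X.
have TE : T = mx2 (\det M / M 1 1) 0 (p%:R ^+ n * M 1 0) (p%:R ^+ n * M 1 1).
  have -> : T = adj2 (dgp n) * adj2 U * M by rewrite /T !adj2M !mulrA.
  exact: cartan_reduction.
have aT00 : abs (\det M / M 1 1) = abs (M 1 1) / P ^+ n.
  by rewrite (absM hK) (absV hK) e; field; rewrite !gt_eqF.
have nT : mxnorm T = abs (M 1 1) / P ^+ n.
  apply: le_anti; apply/andP; split; last first.
    by have := le_mxnorm abs T 0 0; rewrite TE mx2E aT00.
  rewrite TE; apply/mxnorm_leP; apply: ord2P; apply: ord2P; rewrite mx2E ?aT00 //.
  - by rewrite (abs0 hK) divr_ge0 ?ltW.
  - rewrite (absM hK) abs_pX mulrC ler_wpM2r ?invr_ge0 ?(ltW P0) //.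
    by rewrite -eM le_mxnorm.
  - by rewrite (absM hK) abs_pX mulrC.
have -> : \det T = p%:R ^+ n * \det M by rewrite TE det2E !mx2E; field.
by rewrite nT (absM hK) abs_pX e; field; rewrite !gt_eqF.
Qed.

(* The Cartan decomposition [GL(2, Z_p) diag(p^n, 1) GL(2, Z_p)] of [Y^-1 X],
   which describes the path from Y to X. *)
Lemma cartan Y X n : vertex Y -> vertex X -> tdist Y X = P ^+ n ->
  exists A, [/\ vertex A, tdist Y A = 1 & tdist (A * dgp n) X = 1].
Proof.
move=> vY vX e; have [i [j eM]] := mxnorm_attained abs (adj2 Y * X).
have vs := vertex_swap.
(* Multiplying by [swap] stays at the same vertex and moves the largest entry of [adj2 Y * X], up to
   sign, to position (1, 1). *)
pose Y' := if i == 0 then Y * swap else Y.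
pose X' := if j == 0 then X * swap else X.
have vY' : vertex Y' by rewrite /Y'; case: (i == 0) => //; apply: (vertexM hp hK).
have vX' : vertex X' by rewrite /X'; case: (j == 0) => //; apply: (vertexM hp hK).
have eY : tdist Y Y' = 1.
  by rewrite /Y'; case: (i == 0); rewrite ?tdist_swap ?(tdist_xx hK) ?(proj2 vY).
have eX : tdist X X' = 1.
  by rewrite /X'; case: (j == 0); rewrite ?tdist_swap ?(tdist_xx hK) ?(proj2 vX).
have [[_ y0] [_ x0]] := (vY, vX); have [[_ y'0] [_ x'0]] := (vY', vX').
have e' : tdist Y' X' = P ^+ n.
  rewrite -(tdist_eq1_l hK y0 y'0 x'0 eY) (tdist_sym hK) -(tdist_eq1_l hK x0 x'0 y0 eX).
  by rewrite (tdist_sym hK).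
have nM : mxnorm (adj2 Y' * X') = abs ((adj2 Y' * X') 1 1).
  apply: le_anti; rewrite le_mxnorm andbT.
  have -> : abs ((adj2 Y' * X') 1 1) = abs ((adj2 Y * X) i j).
    rewrite /Y' /X'; move: i j {eM Y' X' vY' vX' eY eX y'0 x'0 e'}.
    apply: ord2P; apply: ord2P; rewrite ?eqxx /=.
    - by rewrite -(absN hK); congr abs; rewrite /adj2 !mxE2; ring.
    - by rewrite -(absN hK); congr abs; rewrite /adj2 !mxE2; ring.
    - by congr abs; rewrite /adj2 !mxE2; ring.
    - by [].
  rewrite -eM /Y' /X'.
  have nR N : mxnorm (N * swap) <= mxnorm N.
    by apply: le_trans (mxnormM hK _ _) _; rewrite mxnorm_swap mulr1.
  have nL N : mxnorm (adj2 swap * N) <= mxnorm N.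
    apply: le_trans (mxnormM hK _ _) _.
    by rewrite (mxnorm_adj hK) // mxnorm_swap mul1r.
  case: (i == 0); case: (j == 0) => //; rewrite ?adj2M ?mulrA.
  - by apply: le_trans (nR _) _; rewrite -mulrA nL.
  - by rewrite -mulrA nL.
  - exact: nR.
have [A [vA e1 e2]] := cartan_max vY' vX' e' nM.
have [_ a0] := vA; have [_ ad0] := vertexM hp hK vA (vertex_dgp n).
exists A; split=> //; first by rewrite (tdist_eq1_l hK y0 y'0 a0 eY).
by rewrite (tdist_sym hK) (tdist_eq1_l hK x0 x'0 ad0 eX) (tdist_sym hK).
Qed.

Let adj_dgp1_mul M :
  adj2 (dgp 1) * M = mx2 (M 0 0) (M 0 1) (p%:R * M 1 0) (p%:R * M 1 1).
Proof. by apply: mx2_inj; rewrite /adj2 !mxE2; split; ring. Qed.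

Let adj_dgp1_conj M : adj2 (dgp 1) * M * dgp 1 =
  mx2 (p%:R * M 0 0) (M 0 1) (p%:R * (p%:R * M 1 0)) (p%:R * M 1 1).
Proof. by apply: mx2_inj; rewrite /adj2 !mxE2; split; ring. Qed.

(** As [tdist] is multiplicative, the last premise places Z on the path from X to Y. *)
Definition convex (D : set 'M[K]_2) := forall X Y Z, D X -> D Y -> vertex Z ->
  tdist X Z * tdist Z Y <= tdist X Y -> D Z.

Section OutgoingEdges.
Variable D : set 'M[K]_2.
Hypotheses (Dv : D `<=` vertex) (Dc : convex D).

Lemma convex_class X Z : D X -> vertex Z -> tdist X Z = 1 -> D Z.
Proof.
move=> DX vZ e; apply: (Dc DX DX vZ).
by rewrite (tdist_sym hK) (tdist_xx hK) ?(proj2 (Dv DX)) // (tdist_sym hK) e mulr1.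
Qed.

Definition outgoing A := D A /\ ~ D (A * dgp 1).

(** Otherwise, by discreteness, the first row of [adj2 A * Y] is smaller than the norm by a factor
    p. Passing from A to [A * dgp 1] multiplies the second row by p, so the whole norm drops by a
    factor p: this vertex is on the path from A to Y and would belong to D. *)
Lemma outgoing_row A Y : outgoing A -> D Y ->
  exists j, mxnorm (adj2 A * Y) = abs ((adj2 A * Y) 0 j).
Proof.
move=> [DA nDF] DY; have [vA vY] := (Dv DA, Dv DY).
have vM := vertexM hp hK (vertex_adj hp hK vA) vY.
set M := adj2 A * Y in vM *.
have [hM M0] := vM; have N0 := mxnorm_gt0 hK M0.
have P0 := pR_gt0 R hp.
apply: contrapT => /forallNP h; apply: nDF.
have vF : vertex (A * dgp 1) by apply: (vertexM hp hK) => //; apply: vertex_dgp.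
apply: (Dc DA DY) => //.
have small j : abs (M 0 j) <= mxnorm M / P.
  rewrite ler_pdivlMr // mulrC; apply: (mxnorm_lt_le hp hK) => //.
  by rewrite lt_neqAle le_mxnorm andbT; apply/eqP => e; apply: (h j).
rewrite tdist_dgp ?(proj2 vA) // expr1 !(tdistE hK).
have -> : adj2 (A * dgp 1) * Y = adj2 (dgp 1) * M by rewrite adj2M mulrA.
have pV x : abs x <= mxnorm M -> abs (p%:R * x) <= mxnorm M / P.
  by move=> h'; rewrite (absM hK) (abs_p_eq hK) mulrC ler_wpM2r ?invr_ge0 ?(ltW P0).
have nT : mxnorm (adj2 (dgp 1) * M) <= mxnorm M / P.
  rewrite adj_dgp1_mul; apply/mxnorm_leP.
  by apply: ord2P; apply: ord2P; rewrite mx2E ?pV ?le_mxnorm.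
rewrite det2M det_adj2 det_dgp (absM hK) abs_pX -/M.
have dM := absdet_gt0 hK M0.
have -> : mxnorm M ^+ 2 / abs (\det M) =
    P * ((mxnorm M / P) ^+ 2 / (P ^- 1 * abs (\det M))).
  by field; rewrite !gt_eqF.
rewrite ler_pM2l // ler_pM2r ?invr_gt0 ?mulr_gt0 ?invr_gt0 //.
by rewrite ler_sqr ?nnegrE ?divr_ge0 ?(mxnorm_ge0 hK) ?(ltW P0).
Qed.

(* A matrix A also stands for the edge from the vertex of A to that of
   [A * dgp 1]. The edges of A and B point away from each other iff
   [dom (adj2 A * B)]. *)
Definition dom M := mxnorm M <= abs (M 0 1).

(** By [outgoing_row] from both sides, the first row of M = [adj2 A * B] and that of its adjugate,
    (M 1 1, - M 0 1), each contain an entry of maximal absolute value. If [M 0 1] is not maximal,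
    both diagonal entries are, and |det M| is the square of the norm: A and B have the same vertex.
    The gap of a factor p at [M 0 1] then makes the other ends of the two edges coincide as well. *)
Lemma outgoing_dom A B : outgoing A -> outgoing B ->
  ~ (tdist A B = 1 /\ tdist (A * dgp 1) (B * dgp 1) = 1) -> dom (adj2 A * B).
Proof.
move=> oA oB; have [[DA nDA] [DB nDB]] := (oA, oB).
have [vA vB] := (Dv DA, Dv DB).
have vM := vertexM hp hK (vertex_adj hp hK vA) vB.
have [i ei] := outgoing_row oA DB; have [j ej] := outgoing_row oB DA.
have eMt : adj2 B * A = adj2 (adj2 A * B) by rewrite adj2M adj2K.
rewrite /dom eMt (mxnorm_adj hK) // in ej *.
set M := adj2 A * B in vM ei ej *.
have [hM M0] := vM; have N0 := mxnorm_gt0 hK M0; have P0 := pR_gt0 R hp.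
move: i ei; apply: ord2P => ei; last by rewrite ei.
move: j ej; apply: ord2P; rewrite mx2E ?(absN hK) => ej; last by rewrite ej.
have [//|lt01] := leP (mxnorm M) (abs (M 0 1)); case.
have small := mxnorm_lt_le hp hK hM (hM 0 1) lt01.
have dM : abs (\det M) = mxnorm M ^+ 2.
  rewrite det2E (absDl hK) ?(absN hK) !(absM hK) -ei -ej ?expr2 //.
  apply: le_lt_trans (_ : abs (M 0 1) * mxnorm M < _).
    by rewrite ler_wpM2l ?(abs_ge0 hK) ?le_mxnorm.
  by rewrite ltr_pM2r.
split; first by rewrite (tdistE hK) -/M dM divff // expf_neq0 // gt_eqF.
have [[_ a0] [_ b0]] := (vertexM hp hK vA (vertex_dgp 1), vertexM hp hK vB (vertex_dgp 1)).
apply: le_anti; rewrite (tdist_ge1 hK) // andbT (tdistE hK).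
have -> : adj2 (A * dgp 1) * (B * dgp 1) = adj2 (dgp 1) * M * dgp 1.
  by rewrite adj2M !mulrA.
have nT : mxnorm (adj2 (dgp 1) * M * dgp 1) <= mxnorm M / P.
  have pV x : abs x <= mxnorm M -> abs (p%:R * x) <= mxnorm M / P.
    by move=> h; rewrite (absM hK) (abs_p_eq hK) mulrC ler_wpM2r ?invr_ge0 ?(ltW P0).
  rewrite adj_dgp1_conj; apply/mxnorm_leP.
  apply: ord2P; apply: ord2P; rewrite mx2E ?pV ?le_mxnorm //.
    by rewrite ler_pdivlMr // mulrC.
  rewrite (absM hK); apply: le_trans (le_mxnorm abs M 1 0).
  by rewrite ler_piMl ?(abs_ge0 hK) // (abs_nat_le1 hK).
rewrite (det2M _ (dgp 1)) (det2M _ M) (det_adj2 (dgp 1)) det_dgp !(absM hK) dM abs_pX expr1.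
rewrite ler_pdivrMr ?mulr_gt0 ?invr_gt0 ?exprn_gt0 // mul1r.
apply: le_trans (_ : (mxnorm M / P) ^+ 2 <= _).
  by rewrite ler_sqr ?nnegrE ?divr_ge0 ?(mxnorm_ge0 hK) ?(ltW P0).
by rewrite exprMn exprVn le_eqVlt; apply/orP; left; apply/eqP; field; rewrite gt_eqF.
Qed.

End OutgoingEdges.
End Edges.

(** * Words in free groups *)

Section Words.
Variable g : nat.
Implicit Types (l : 'I_g * bool) (w : seq ('I_g * bool)).

Definition inv_letter l : 'I_g * bool := (l.1, ~~ l.2).

Lemma inv_letterK : involutive inv_letter.
Proof. by case=> i b; rewrite /inv_letter /= negbK. Qed.

Lemma eq_inv_letter l m : (m == inv_letter l) = (l.1 == m.1) && (l.2 != m.2).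
Proof.
case: l m => [i b] [j c]; rewrite /inv_letter /= xpair_eqE eq_sym.
by case: b c => [] [].
Qed.

Lemma reducedE w : reduced w = sorted (fun l m => m != inv_letter l) w.
Proof. by apply: eq_sorted => l m; rewrite eq_inv_letter. Qed.

Lemma reduced_cons l w :
  reduced (l :: w) = (if w is m :: _ then m != inv_letter l else true) && reduced w.
Proof. by rewrite !reducedE; case: w. Qed.

Definition reduce_cons l w :=
  if w is m :: w' then if m == inv_letter l then w' else l :: w else [:: l].

Definition reduce := foldr reduce_cons [::].

Lemma reduced_reduce w : reduced (reduce w).
Proof.
elim: w => [//|l w] /=; case: (reduce w) => [//|m w'] h /=.
case: ifP => hm; last by rewrite reduced_cons hm.
by move: h; rewrite reduced_cons => /andP[].
Qed.

(** For an arbitrary monoid, so as to serve words in matrices and words in finite groups alike. *)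
Lemma big_reduce (T : Type) (idx : T) (op : Monoid.law idx) (f : 'I_g * bool -> T) w :
  (forall l, op (f l) (f (inv_letter l)) = idx) ->
  \big[op/idx]_(l <- reduce w) f l = \big[op/idx]_(l <- w) f l.
Proof.
move=> h; elim: w => [//|l w IH] /=; rewrite big_cons -IH.
case: (reduce w) => [|m w'] /=; first by rewrite big_cons.
case: eqP => [->|_]; rewrite !big_cons // Monoid.mulmA.
exact: (etrans (esym (Monoid.mul1m op _)) (congr1 (op^~ _) (esym (h l)))).
Qed.

Definition inv_word w := rev (map inv_letter w).

Lemma inv_word_cons l w : inv_word (l :: w) = rcons (inv_word w) (inv_letter l).
Proof. by rewrite /inv_word /= rev_cons. Qed.

Section GroupEval.
Variable Q : finGroupType.
Definition geval (s : 'I_g -> Q) w : Q :=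
  (\prod_(l <- w) (if l.2 then (s l.1)^-1 else s l.1))%g.

Lemma geval_cons s l w :
  geval s (l :: w) = ((if l.2 then (s l.1)^-1 else s l.1) * geval s w)%g.
Proof. by rewrite /geval big_cons. Qed.

Lemma geval_cat s w w' : geval s (w ++ w') = (geval s w * geval s w')%g.
Proof. by rewrite /geval big_cat. Qed.

Lemma geval_nil s : geval s [::] = 1%g.
Proof. by rewrite /geval big_nil. Qed.

Lemma geval_inv s w : geval s (inv_word w) = (geval s w)^-1%g.
Proof.
elim: w => [|l w IH]; first by rewrite !geval_nil invg1.
rewrite inv_word_cons -cats1 geval_cat IH !geval_cons geval_nil mulg1.
by rewrite invMg; case: l => i [] /=; rewrite ?invgK.
Qed.

Lemma geval_reduce s w : geval s (reduce w) = geval s w.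
Proof.
by apply: big_reduce => -[i []] /=; rewrite ?mulVg ?mulgV.
Qed.
End GroupEval.

Section MatrixEval.
Variables (K : fieldType) (a : 'I_g -> 'M[K]_2).
Hypothesis ua : forall i, a i \in unitmx.

Lemma letter_unit l : letter a l \in unitmx.
Proof. by rewrite /letter; case: l.2; rewrite ?unitmx_inv. Qed.

Lemma letter_inv l : letter a (inv_letter l) = invmx (letter a l).
Proof. by case: l => i []; rewrite /letter /= ?invmxK. Qed.

Lemma word_value_cons l w : word_value a (l :: w) = letter a l * word_value a w.
Proof. by rewrite /word_value big_cons. Qed.

Lemma word_value_nil : word_value a [::] = 1.
Proof. by rewrite /word_value big_nil. Qed.

Lemma word_value_cat w w' : word_value a (w ++ w') = word_value a w * word_value a w'.
Proof. by rewrite /word_value big_cat. Qed.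

Lemma word_value_unit w : word_value a w \in unitmx.
Proof.
elim: w => [|l w IH]; first by rewrite word_value_nil unitmx1.
by rewrite word_value_cons -[_ * _]/(_ *m _) unitmx_mul letter_unit.
Qed.

Lemma mulV2 (M : 'M[K]_2) : M \in unitmx -> M * invmx M = 1.
Proof. exact: mulmxV. Qed.

Lemma word_value_reduce w : word_value a (reduce w) = word_value a w.
Proof. by apply: big_reduce => l; rewrite letter_inv; exact: (mulV2 (letter_unit l)). Qed.

Lemma word_value_inv w : word_value a (inv_word w) = invmx (word_value a w).
Proof.
elim: w => [|l w IH]; first by rewrite /inv_word word_value_nil invmx1.
rewrite inv_word_cons -cats1 word_value_cat IH word_value_cons word_value_nil mulr1.
rewrite word_value_cons letter_inv.
exact: (esym (@invrM _ (letter a l) (word_value a w) (letter_unit l) (word_value_unit w))).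
Qed.

Hypothesis fa : freely_generate a.

Lemma free_geval (Q : finGroupType) (s : 'I_g -> Q) w :
  is_scalar_mx (word_value a w) -> geval s w = 1%g.
Proof.
rewrite -word_value_reduce -geval_reduce => h.
have [->|n0] := eqVneq (reduce w) [::]; first by rewrite /geval big_nil.
by case: (fa (reduced_reduce w) n0).
Qed.
End MatrixEval.
End Words.

(** * Residual finiteness of free groups *)

Section ResidualFiniteness.

Lemma extend_perm (T : finType) (r : rel T) :
  (forall x y y', r x y -> r x y' -> y = y') ->
  (forall x x' y, r x y -> r x' y -> x = x') ->
  exists s : {perm T}, forall x y, r x y -> s x = y.
Proof.
move=> rf ri; suff h (L : seq T) : exists s : {perm T}, forall x y, x \in L -> r x y -> s x = y.
  by have [s hs] := h (enum T); exists s => x y; apply: hs; rewrite mem_enum.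
elim: L => [|x L [s hs]]; first by exists 1%g.
have [/existsP[y rxy]|/existsPn h] := boolP [exists y, r x y]; last first.
  by exists s => x' y'; rewrite inE => /orP[/eqP ->|]; [rewrite (negbTE (h _))|exact: hs].
(* Correcting the image of x by a transposition keeps the other prescribed images: they differ from
   [s x] as s is injective, and from y as r is. *)
exists (s * tperm (s x) y)%g => x' y' hx' rx'; rewrite permM.
have [exx|nxx] := eqVneq x' x.
  by rewrite exx tpermL; rewrite exx in rx'; apply: (rf x).
have x'L : x' \in L by move: hx'; rewrite inE (negbTE nxx).
have e := hs _ _ x'L rx'; rewrite tpermD ?e //.
  by rewrite -e (inj_eq perm_inj) eq_sym.
by apply/eqP => ey; move/eqP: nxx; apply; apply: (ri _ _ y); rewrite // ey.
Qed.

(* The letters of a reduced word of length n are realized as permutations of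
   {0, ..., n} such that the k-th letter sends k to k + 1. *)
Lemma residually_finite g (w : seq ('I_g * bool)) : reduced w -> w != [::] ->
  exists (n : nat) (s : 'I_g -> 'S_n.+1), geval s w <> 1%g.
Proof.
move=> rw; case: w rw => [//|l0 w0]; set w := l0 :: w0 => rw _.
pose n := size w; exists n.
pose lk k := nth l0 w k.
have adj k : (k.+1 < n)%N -> lk k.+1 != inv_letter (lk k).
  by rewrite reducedE in rw; move/(sortedP l0): rw => h; apply: h.
(* What the path 0, ..., n prescribes for generator i: a step up where the letter is the generator,
   a step down where it is its inverse. Two conflicting prescriptions would need adjacent letters
   inverse to each other. *)
pose r i (x y : 'I_n.+1) :=
  ((y == x.+1 :> nat) && (lk x == (i, false)) && (x < n)%N) ||
  ((x == y.+1 :> nat) && (lk y == (i, true)) && (y < n)%N).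
have rf i x y y' : r i x y -> r i x y' -> y = y'.
  move=> h h'; apply: val_inj => /=; move: h h'; rewrite /r.
  case/orP=> /andP[/andP[/eqP e1 /eqP e2] e3];
  case/orP=> /andP[/andP[/eqP e1' /eqP e2'] e3'].
  - by rewrite e1 e1'.
  - by have := adj y'; rewrite -e1' e2 e2' /inv_letter /= eqxx => /(_ e3).
  - by have := adj y; rewrite -e1 e2 e2' /inv_letter /= eqxx => /(_ e3').
  - by move: e1; rewrite e1' => -[].
have ri i x x' y : r i x y -> r i x' y -> x = x'.
  move=> h h'; apply: val_inj => /=; move: h h'; rewrite /r.
  case/orP=> /andP[/andP[/eqP e1 /eqP e2] e3];
  case/orP=> /andP[/andP[/eqP e1' /eqP e2'] e3'].
  - by move: e1; rewrite e1' => -[].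
  - by have := adj x; rewrite -e1 e2 e2' /inv_letter /= eqxx => /(_ e3').
  - by have := adj x'; rewrite -e1' e2 e2' /inv_letter /= eqxx => /(_ e3).
  - by rewrite e1 e1'.
have [s hs] : exists s : 'I_g -> 'S_n.+1, forall i x y, r i x y -> s i x = y.
  have h i := extend_perm (rf i) (ri i).
  by exists (fun i => projT1 (cid (h i))) => i; apply: (projT2 (cid (h i))).
exists s => e.
suff h k : (k <= n)%N -> geval s (take k w) ord0 = inord k.
  have := h n (leqnn n); rewrite take_size e perm1 => /(congr1 val) /=.
  by rewrite inordK.
elim: k => [|k IH] kn.
  by rewrite take0 geval_nil perm1; apply: val_inj; rewrite /= inordK.
rewrite (take_nth l0) // -cats1 geval_cat geval_cons geval_nil mulg1 permM IH 1?ltnW //.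
have e1 : @inord n k = k :> nat by rewrite inordK // ltnS ltnW.
have e2 : @inord n k.+1 = k.+1 :> nat by rewrite inordK.
rewrite -/(lk k); case E: (lk k) => [i []] /=.
  by apply: (canLR (permK _)); apply/esym/hs; rewrite /r e1 e2 E !eqxx kn orbT.
by apply: hs; rewrite /r e1 e2 E !eqxx kn.
Qed.
End ResidualFiniteness.

(** * Invariance of the rank and the Hopf property *)

Section Hopf.
Variables (K : fieldType) (m n : nat) (a : 'I_m -> 'M[K]_2) (b : 'I_n -> 'M[K]_2).
Hypothesis ua : forall i, a i \in unitmx.
Hypotheses (ab : forall i, generated_group b (a i)) (ba : forall j, generated_group a (b j)).
Hypothesis fa : freely_generate a.

Let u j : seq ('I_m * bool) := projT1 (cid (projT2 (cid (ba j)))).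
Let uP j : exists2 c, c != 0 & b j = c *: word_value a (u j).
Proof.
rewrite /u; case: (cid (ba j)) => c hc /=; case: (cid _) => w /= [c0 e].
by exists c.
Qed.

Definition subst_word (v : 'I_n -> seq ('I_m * bool)) (w : seq ('I_n * bool)) :=
  flatten [seq if l.2 then inv_word (v l.1) else v l.1 | l <- w].

Let geval_subst (Q : finGroupType) (s : 'I_m -> Q) w :
  geval s (subst_word u w) = geval (fun j => geval s (u j)) w.
Proof.
elim: w => [|l w IH]; first by rewrite !geval_nil.
rewrite /subst_word /= geval_cat geval_cons -IH; congr (_ * _)%g.
by case: (l.2) => //; rewrite geval_inv.
Qed.

Let word_value_subst w :
  exists2 c, c != 0 & word_value b w = c *: word_value a (subst_word u w).
Proof.
elim: w => [|l w [c c0 IH]].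
  by exists 1; rewrite ?oner_eq0 // !word_value_nil scale1r.
have [d d0 e] : exists2 d, d != 0 & letter b l =
    d *: word_value a (if l.2 then inv_word (u l.1) else u l.1).
  rewrite /letter; case: (l.2) => //; have [d d0 ->] := uP l.1.
  exists d^-1; rewrite ?invr_eq0 // word_value_inv // invmxZ //.
  by rewrite unitmx2 det2Z mulf_neq0 ?expf_neq0 // -unitmx2 word_value_unit.
exists (d * c); first by rewrite mulf_neq0.
by rewrite word_value_cons /subst_word /= word_value_cat e IH mul2Zl mul2Zr scalerA.
Qed.

(** A homomorphism s from the free group on the a_i to Q is recovered from its values on the b_j.
    Indeed a_i is, up to a scalar, a word v in the b_j; substituting the [u j] gives a word in the
    a_i with the value of a_i up to a scalar, and by freeness s agrees on both. *)
Let geval_inj (Q : finGroupType) :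
  injective (fun s : {ffun 'I_m -> Q} => [ffun j => geval s (u j)]).
Proof.
move=> s t /ffunP e; apply/ffunP => i.
have [d [v [d0 ea]]] := ab i.
have key (x : {ffun 'I_m -> Q}) : geval x (subst_word u v) = x i.
  have [c c0 ec] := word_value_subst v.
  have : is_scalar_mx (word_value a (subst_word u v ++ [:: (i, true)])).
    rewrite word_value_cat word_value_cons word_value_nil mulr1 /letter /=.
    rewrite -(is_scalarZ2 _ c0) -mul2Zl -ec -(is_scalarZ2 _ d0) -mul2Zl -ea.
    by rewrite mulV2 // -[1]/(1%:M) scalar_mx_is_scalar.
  move=> /(free_geval ua fa x); rewrite geval_cat geval_cons geval_nil mulg1.
  by move/eqP; rewrite -eq_mulgV1 => /eqP.
rewrite -(key s) -(key t) !geval_subst; congr geval; apply: funext => j.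
by have := e j; rewrite !ffunE.
Qed.

(** Homomorphisms to a group of order 2: there are 2^m families of values on the a_i and 2^n on the
    b_j. *)
Lemma free_rank_le : (m <= n)%N.
Proof.
have := leq_card _ (@geval_inj 'S_2).
by rewrite !card_ffun !card_ord card_Sn leq_exp2l.
Qed.

(** For m = n the injection [geval_inj] is onto. So permutations on which the reduced word w is
    nontrivial come from a homomorphism s' given on the a_i, and this kills w if the value of w is
    scalar. *)
Lemma free_hopf : m = n -> freely_generate b.
Proof.
move=> emn w rw w0 sw.
have [N [s hs]] := residually_finite rw w0.
have [|t _ ht] := inj_card_bij (@geval_inj 'S_N.+1).
  by rewrite !card_ffun !card_ord emn.
apply: hs; have := ht [ffun j => s j]; move: (t _) => s' es.
have [c c0 ec] := word_value_subst w.
have := sw; rewrite ec is_scalarZ2 // => /(free_geval ua fa s').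
rewrite geval_subst => <-; congr geval; apply: funext => j.
by have /ffunP/(_ j) := es; rewrite !ffunE.
Qed.
End Hopf.

(** * Convex transversals of the orbits *)

Section Span.
Variable K : fieldType.
Implicit Types (S T : set 'M[K]_2) (x y M : 'M[K]_2).

(* Inverses are replaced by adjugates, which differ from them by scalars, to avoid
   divisions. *)
Inductive span S : 'M[K]_2 -> Prop :=
| span1 : span S 1
| span_mull x y : S x -> span S y -> span S (x * y)
| span_adjl x y : S x -> span S y -> span S (adj2 x * y).

Lemma span_mul S x y : span S x -> span S y -> span S (x * y).
Proof.
move=> + hy; elim=> [|a b Sa _ IH|a b Sa _ IH]; rewrite ?mul1r // -mulrA.
  exact: span_mull.
exact: span_adjl.
Qed.

Lemma span_gen S x : S x -> span S x.
Proof. by move=> Sx; rewrite -[x]mulr1; apply: span_mull => //; apply: span1. Qed.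

Lemma adj2_1 : adj2 1 = 1 :> 'M[K]_2.
Proof. exact: (adj2S 1). Qed.

Lemma span_adj S x : span S x -> span S (adj2 x).
Proof.
elim=> [|a b Sa _ IH|a b Sa _ IH]; first by rewrite adj2_1; apply: span1.
  rewrite adj2M; apply: span_mul => //.
  by rewrite -[adj2 a]mulr1; apply: span_adjl => //; apply: span1.
by rewrite adj2M adj2K; apply: span_mul => //; apply: span_gen.
Qed.

Lemma span_trans S T : S `<=` span T -> span S `<=` span T.
Proof.
move=> h x; elim=> [|a b Sa _ IH|a b Sa _ IH]; first exact: span1.
  by apply: span_mul => //; apply: h.
by apply: span_mul => //; apply: span_adj; apply: h.
Qed.

Lemma span_mono S T : S `<=` T -> span S `<=` span T.
Proof. by move=> h; apply: span_trans => x /h; apply: span_gen. Qed.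

Lemma span_det S x : (forall y, S y -> \det y != 0) -> span S x -> \det x != 0.
Proof.
move=> h; elim=> [|a b Sa _ IH|a b Sa _ IH].
- by rewrite det1 oner_eq0.
- by rewrite det2M mulf_neq0 // h.
- by rewrite det2M det_adj2 mulf_neq0 // h.
Qed.

(** The subgroup of PGL(2, K) generated by S, as a set of representatives. *)
Definition spanZ S M := exists c x, [/\ c != 0, span S x & M = c *: x].

Lemma spanZ_span S x : span S x -> spanZ S x.
Proof. by exists 1, x; rewrite oner_eq0 scale1r. Qed.

Lemma spanZ_scale S c x : c != 0 -> spanZ S x -> spanZ S (c *: x).
Proof.
move=> c0 [d [y [d0 hy ->]]]; exists (c * d), y; split=> //.
  by rewrite mulf_neq0.
by rewrite scalerA.
Qed.

Lemma spanZ_mul S x y : spanZ S x -> spanZ S y -> spanZ S (x * y).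
Proof.
move=> [c [x' [c0 hx ->]]] [d [y' [d0 hy ->]]].
rewrite mul2Zl; apply: spanZ_scale => //.
by rewrite mul2Zr; apply: spanZ_scale => //; apply: spanZ_span; apply: span_mul.
Qed.

Lemma spanZ_adj S x : spanZ S x -> spanZ S (adj2 x).
Proof.
move=> [c [x' [c0 hx ->]]]; rewrite adj2Z; apply: spanZ_scale => //.
by apply: spanZ_span; apply: span_adj.
Qed.

Lemma spanZ_trans S T : S `<=` spanZ T -> spanZ S `<=` spanZ T.
Proof.
move=> h M [c [x [c0 hx ->]]]; apply: spanZ_scale => //.
elim: hx => [|a b Sa _ IH|a b Sa _ IH]; first by apply: spanZ_span; apply: span1.
  by apply: spanZ_mul => //; apply: h.
by apply: spanZ_mul => //; apply: spanZ_adj; apply: h.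
Qed.

Lemma span_finite S x : span S x ->
  exists n (a : 'I_n -> 'M[K]_2), (forall i, S (a i)) /\ span (range a) x.
Proof.
elim=> [|s y Ss _ [n [a [ha hy]]]|s y Ss _ [n [a [ha hy]]]].
- exists 0%N, (fun=> 0); split; first by case.
  exact: span1.
- exists n.+1, (fun i => if unlift ord0 i is Some j then a j else s); split.
    by move=> i; case: unliftP.
  apply: span_mull; first by exists ord0 => //; rewrite unlift_none.
  by apply: span_mono hy => _ [i _ <-]; exists (lift ord0 i) => //; rewrite liftK.
- exists n.+1, (fun i => if unlift ord0 i is Some j then a j else s); split.
    by move=> i; case: unliftP.
  apply: span_adjl; first by exists ord0 => //; rewrite unlift_none.
  by apply: span_mono hy => _ [i _ <-]; exists (lift ord0 i) => //; rewrite liftK.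
Qed.

(** S need not be finite, but each [c j] involves only finitely many of its elements. *)
Lemma spanZ_finite S g (c : 'I_g -> 'M[K]_2) : (forall j, spanZ S (c j)) ->
  exists n (a : 'I_n -> 'M[K]_2), (forall i, S (a i)) /\ forall j, spanZ (range a) (c j).
Proof.
elim: g c => [|g IH] c h; first by exists 0%N, (fun=> 0); split; case.
have [n [a [Sa ha]]] := IH (fun j => c (lift ord0 j)) (fun j => h _).
have [d [x [d0 hx e]]] := h ord0.
have [m [b [Sb hb]]] := span_finite hx.
exists (n + m)%N, (fun i : 'I_(n + m) => match fintype.split i with inl j => a j | inr j => b j end).
split; first by move=> i; case: (fintype.split i).
move=> j; case: (unliftP ord0 j) => [k ->|->].
  apply: spanZ_trans (ha k) => _ [i _ <-]; apply: spanZ_span; apply: span_gen.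
  by exists (lshift m i) => //; rewrite (unsplitK (inl _)).
rewrite e; apply: spanZ_scale => //; apply: spanZ_span.
apply: span_mono hb => _ [i _ <-].
by exists (rshift n i) => //; rewrite (unsplitK (inr _)).
Qed.

Lemma spanZ_generated g (c : 'I_g -> 'M[K]_2) : (forall i, c i \in unitmx) ->
  generated_group c = spanZ (range c).
Proof.
move=> uc; apply/seteqP; split=> M.
  move=> [d [w [d0 ->]]]; apply: spanZ_scale => //.
  elim: w => [|[i b] w IH]; first by rewrite word_value_nil; apply: spanZ_span; apply: span1.
  rewrite word_value_cons; apply: spanZ_mul => //.
  have hi : spanZ (range c) (c i) by apply: spanZ_span; apply: span_gen; exists i.
  rewrite /letter; case: b => //=; have ui : \det (c i) != 0 by rewrite -unitmx2.
  by rewrite invmx2 //; apply: spanZ_scale; rewrite ?invr_eq0 //; apply: spanZ_adj.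
move=> [d [x [d0 hx ->]]].
suff [e [w [e0 ->]]] : exists e w, e != 0 /\ x = e *: word_value c w.
  by exists (d * e), w; rewrite mulf_neq0 // scalerA.
elim: hx => [|_ y [i _ <-] _ [e [w [e0 ->]]]|_ y [i _ <-] _ [e [w [e0 ->]]]].
- by exists 1, [::]; rewrite oner_eq0 word_value_nil scale1r.
- by exists e, ((i, false) :: w); rewrite word_value_cons /letter mul2Zr.
- have ui : \det (c i) != 0 by rewrite -unitmx2.
  exists (\det (c i) * e), ((i, true) :: w); rewrite mulf_neq0 //; split=> //.
  rewrite word_value_cons /letter /= invmx2 // mul2Zl mul2Zr scalerA.
  by rewrite mulrAC mulfV // mul1r.
Qed.

End Span.

(** * A maximal convex transversal and the elements that move it to a neighbour *)

Section Existence.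
Variables (p : nat) (R : realType) (K : fieldType) (abs : K -> R).
Hypotheses (hp : prime p) (hK : is_Cp abs p).
Implicit Types M N X Y Z W A B F h : 'M[K]_2.

Local Notation Qp := (Qp abs).
Local Notation P := (p%:R : R).
Local Notation vertex := (vertex abs).
Local Notation tdist := (tdist abs).
Local Notation mxnorm := (mxnorm abs).
Local Notation dgp := (dgp p K).
Local Notation swap := (swap K).
Local Notation dom := (dom abs).

(* Right multiplication by J reverses the direction of an edge. *)
Definition Jmx : 'M[K]_2 := mx2 0 p%:R 1 0.

(** The index (i, false) belongs to the ball B_i, and (i, true) to B'_i. *)
Definition edge n (s A : 'I_n -> 'M[K]_2) (u : 'I_n * bool) : 'M[K]_2 :=
  if u.2 then adj2 (s u.1) * A u.1 * Jmx else A u.1.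

Variable G : set 'M[K]_2.
Hypotheses (Gv : G `<=` vertex) (G1 : G 1).
Hypotheses (GM : forall x y, G x -> G y -> G (x * y)) (GA : forall x, G x -> G (adj2 x)).
Hypothesis Ghyp : forall x, G x -> ~ is_scalar_mx x -> abs (\det x) < abs (\tr x) ^+ 2.

Let det0 X : vertex X -> \det X != 0. Proof. by case. Qed.

(** If h fixes the vertex of X, the squared norm of [adj2 X * (h * X)] is |det X|^2 |det h|, and
    this norm bounds the trace of that matrix, det X tr h. So |tr h|^2 <= |det h|, which [Ghyp]
    allows for scalars only. *)
Lemma free_action h X : G h -> vertex X -> tdist X (h * X) = 1 -> is_scalar_mx h.
Proof.
move=> Gh vX e; apply/negPn/negP => /negP/(Ghyp Gh); apply/negP; rewrite -leNgt.
have x0 := absdet_gt0 hK (det0 vX); have h0 := absdet_gt0 hK (det0 (Gv Gh)).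
rewrite -(ler_pM2l (exprn_gt0 2 x0)) -exprMn -(absM hK).
have -> : \det X * \tr h = \tr (adj2 X * (h * X)).
  by rewrite tr2MC -mulrA mul_adj2 mulmxS tr2Z.
have -> : abs (\det X) ^+ 2 * abs (\det h) = mxnorm (adj2 X * (h * X)) ^+ 2.
  move: e; rewrite (tdistE hK) !det2M det_adj2 !(absM hK) => e.
  have nz : abs (\det X) * (abs (\det h) * abs (\det X)) != 0.
    by rewrite !mulf_neq0 // gt_eqF.
  by rewrite -[RHS](divfK nz) e; ring.
by rewrite ler_sqr ?nnegrE ?(abs_ge0 hK) ?(mxnorm_ge0 hK) ?(tr_le_mxnorm hK).
Qed.

(** As the action is free, the last condition says that D meets each orbit in at most one vertex. *)
Definition separated (D : set 'M[K]_2) := [/\ D `<=` vertex, convex abs D &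
  forall h X, G h -> D X -> D (h * X) -> is_scalar_mx h].

Lemma separated_max : exists D, separated D /\ forall D', D `<` D' -> ~ separated D'.
Proof.
apply: Zorn_bigcup => F hF tot; split.
- by move=> X [C FC CX]; have [h _ _] := hF _ FC; apply: h.
- move=> X Y Z [C FC CX] [C' FC' C'Y] vZ e.
  have [le|le] := tot _ _ FC FC'.
    by exists C' => //; have [_ h _] := hF _ FC'; apply: h e => //; apply: le.
  by exists C => //; have [_ h _] := hF _ FC; apply: h e => //; apply: le.
- move=> h X Gh [C FC CX] [C' FC' C'Y].
  have [le|le] := tot _ _ FC FC'.
    by have [_ _ H] := hF _ FC'; apply: (H h X) => //; apply: le.
  by have [_ _ H] := hF _ FC; apply: (H h X) => //; apply: le.
Qed.

Let cls X : set 'M[K]_2 := [set Y | vertex Y /\ tdist X Y = 1].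

Let cls_convex X : vertex X -> convex abs (cls X).
Proof.
move=> vX Y Z W [vY eY] [vZ eZ] vW e; split=> //.
rewrite (tdist_eq1_l hK _ _ _ eY) ?det0 //; apply: le_anti.
rewrite (tdist_ge1 hK) ?det0 // andbT; apply: le_trans (_ : tdist Y Z <= 1).
  apply: le_trans e; rewrite ler_peMr ?(tdist_ge1 hK) ?det0 //.
  by rewrite ltW ?(tdist_gt0 hK) ?det0.
by rewrite -(tdist_eq1_l hK _ _ _ eY) ?det0 // eZ.
Qed.

Let cls_free X h Y : vertex X -> G h -> cls X Y -> cls X (h * Y) -> is_scalar_mx h.
Proof.
move=> vX Gh [vY eY] [vhY ehY]; apply: (free_action Gh vY).
by rewrite -(tdist_eq1_l hK _ _ _ eY) ?det0.
Qed.

Variable D : set 'M[K]_2.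
Hypotheses (sD : separated D) (mD : forall D', D `<` D' -> ~ separated D').

Let Dv : D `<=` vertex. Proof. by case: sD. Qed.
Let Dc : convex abs D. Proof. by case: sD. Qed.
Let Dfree h X : G h -> D X -> D (h * X) -> is_scalar_mx h.
Proof. by case: sD => _ _ H; apply: H. Qed.
Let Dcls X Z : D X -> vertex Z -> tdist X Z = 1 -> D Z.
Proof. exact: (convex_class hK Dv Dc). Qed.

(** The class of a single vertex is separated, so the empty set is not maximal. *)
Let D_nonempty : exists X, D X.
Proof.
apply: contrapT => /forallNP nD.
have v1 : vertex 1 by apply: Gv.
have : D `<` cls 1.
  split; first by move=> X /nD.
  move=> h; apply: (nD 1); apply: h; split=> //.
  by rewrite (tdist_xx hK) ?det0.
move/mD; apply; split; [by move=> X []|exact: cls_convex|].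
by move=> h X Gh; apply: cls_free.
Qed.

(** If no translate of X were in D, adding the class of X to D would keep it separated, against
    maximality. *)
Lemma translate_adjacent W X : D W -> vertex X -> tdist X W = P ->
  exists h, G h /\ D (h * X).
Proof.
move=> DW vX e; apply: contrapT => /forallNP nh.
have vW := Dv DW.
have nD h : G h -> ~ D (h * X) by move=> Gh hX; apply: (nh h).
have : D `<` D `|` cls X.
  split; first by move=> Y; left.
  move=> h; apply: (nD 1 G1); rewrite mul1r; apply: h; right; split=> //.
  by rewrite (tdist_xx hK) ?det0.
have P0 := pR_gt0 R hp.
(* The four-point condition for X, Y, Z, W, with W the neighbour of X in D: either Z is on the path
   from Y to W, or it is on the edge from X to W and hence one of its two ends. *)
have key Q Y Z : cls X Q -> D Y -> vertex Z -> tdist Q Z * tdist Z Y <= tdist Q Y ->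
    (D `|` cls X) Z.
  move=> [vQ eQ] DY vZ; have vY := Dv DY.
  rewrite -!(tdist_eq1_l hK _ _ _ eQ) ?det0 // => le.
  have := tdist_4pt hK (det0 vX) (det0 vY) (det0 vZ) (det0 vW).
  have [g1 g2] : 0 < tdist X Z /\ 0 < tdist Z W by rewrite !(tdist_gt0 hK) ?det0.
  rewrite le_max => /orP[c|c].
    left; apply: (Dc DY DW vZ).
    rewrite -(ler_pM2l g1) mulrA; apply: le_trans c.
    by rewrite (tdist_sym hK Y Z) ler_pM2r.
  have {c le} : tdist X Z * tdist Z W <= P.
    have g3 : 0 < tdist Z Y by rewrite (tdist_gt0 hK) ?det0.
    rewrite -(ler_pM2r g3) mulrAC.
    apply: le_trans (_ : tdist X Y * tdist Z W <= _); first by rewrite ler_pM2r.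
    by rewrite -e (tdist_sym hK Z Y).
  have [n en] := tdist_pow hp hK vX vZ; have [m em] := tdist_pow hp hK vZ vW.
  rewrite en em -exprD -[P in _ <= P]expr1 ler_eXn2l ?(pR_gt1 R hp) //.
  case: n en => [|n] en; first by move=> _; right; split.
  case: m em => [|m] em; last by rewrite addSn addnS.
  by move=> _; left; apply: (Dcls DW) => //; rewrite (tdist_sym hK).
move/mD; apply; split.
- by move=> Y [/Dv|[]].
- move=> Y Z Q [DY|cY] [DZ|cZ] vQ le.
  + by left; apply: (Dc DY DZ).
  + apply: (key Z Y) => //.
    by rewrite mulrC !(tdist_sym hK Z) (tdist_sym hK Q) .
  + exact: (key Y Z).
  + by right; apply: (cls_convex vX cY cZ).
- move=> h Y Gh [DY|cY] [DhY|chY].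
  + exact: (Dfree Gh DY).
  + case: chY => vhY ehY; case: (nD (adj2 h) (GA Gh)).
    have vh := Gv Gh.
    have dY : D (\det h *: Y).
      apply: (Dcls DY); last by rewrite (tdistZr hK) ?(tdist_xx hK) ?det0 //; apply: Dv.
      by apply: (vertexZ hp hK) => //; [apply: (Qp_det2 hp hK); case: vh|rewrite det0|apply: Dv].
    apply: (Dcls dY).
      by apply: (vertexM hp hK) => //; apply: (vertex_adj hp hK).
    have -> : \det h *: Y = adj2 h * (h * Y) by rewrite mulrA adj2_mul mulSmx.
    by rewrite (tdist_mul hK) ?det_adj2 ?det0 // (tdist_sym hK).
  + case: cY => vY eY; case: (nD h Gh); apply: (Dcls DhY).
      by apply: (vertexM hp hK) => //; apply: Gv.
    by rewrite (tdist_mul hK) ?det0 ?(tdist_sym hK Y) //; apply: Gv.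
  + exact: (cls_free vX Gh cY chY).
Qed.

(* The edge A leads from D to its translate by s. *)
Definition crossing A (s : 'M[K]_2) := [/\ G s, ~ is_scalar_mx s, D A & D (adj2 s * (A * dgp 1))].

Let Dscale c X : Qp c -> c != 0 -> D X -> D (c *: X).
Proof.
move=> hc c0 DX; apply: (Dcls DX); first exact: (vertexZ hp hK hc c0 (Dv DX)).
by rewrite (tdistZr hK) ?(tdist_xx hK) ?det0 //; apply: Dv.
Qed.

Let Qp_det h : vertex h -> Qp (\det h).
Proof. by case=> hh _; apply: (Qp_det2 hp hK). Qed.

Let Dswap X : D X -> D (X * swap).
Proof.
move=> DX; apply: (Dcls DX); last by rewrite (tdist_swap hK) ?det0 //; apply: Dv.
by apply: (vertexM hp hK); [apply: Dv|apply: (vertex_swap hp hK)].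
Qed.

Let scalar_adj (s : 'M[K]_2) : is_scalar_mx (adj2 s) -> is_scalar_mx s.
Proof.
by rewrite !is_scalar2E /adj2 !mx2E !oppr_eq0 => /and3P[-> -> /eqP ->]; rewrite eqxx.
Qed.

Let vtx_dgp X n : vertex X -> vertex (X * dgp n).
Proof. by move=> vX; apply: (vertexM hp hK) => //; apply: (vertex_dgp hp hK). Qed.

(** The far end of the edge lies in the translate of D by s, which is disjoint from D as s is not
    scalar. *)
Lemma crossing_outgoing A s : crossing A s -> outgoing p D A.
Proof.
move=> [Gs ns DA DF]; split=> // DAd; apply: ns; apply: scalar_adj.
exact: (Dfree (GA Gs) DAd DF).
Qed.

Let JmxE : Jmx = dgp 1 * swap.
Proof. by apply: mx2_inj; rewrite !mxE2; split; ring. Qed.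

Let Jdgp : Jmx * dgp 1 = p%:R *: swap.
Proof. by apply: mx2_inj; rewrite !mxE2; split; ring. Qed.

Lemma crossing_adj A s : crossing A s -> crossing (adj2 s * A * Jmx) (adj2 s).
Proof.
move=> [Gs ns DA DF]; have vs := Gv Gs; split.
- exact: GA.
- by move=> /scalar_adj.
- by rewrite JmxE -mulrA (mulrA A) mulrA; apply: Dswap.
- have -> : adj2 (adj2 s) * (adj2 s * A * Jmx * dgp 1) =
      (\det s * p%:R) *: (A * swap).
    rewrite adj2K -(mulrA (_ * A)) Jdgp mul2Zr mul2Zr -(mulrA (adj2 s)) mulrA.
    by rewrite mul_adj2 mulSmx scalerA mulrC.
  apply: Dscale; last exact: Dswap.
    by apply: (QpM hp hK); [exact: Qp_det|exact: (Qp_nat hp hK)].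
  by rewrite mulf_neq0 ?det0 // (pK_neq0 hp hK).
Qed.

(** If A and B were the same edge, its far end would lie in the translates of D by s and by t, and
    t^-1 s would be scalar. Different edges that leave D are treated by [outgoing_dom]. *)
Lemma crossing_dom A s B t : crossing A s -> crossing B t ->
  (forall c, c != 0 -> s <> c *: t) -> dom (adj2 A * B).
Proof.
move=> cA cB nst; apply: (outgoing_dom hp hK Dv Dc).
- exact: crossing_outgoing cA.
- exact: crossing_outgoing cB.
move=> [eAB eF]; have [[Gs ns DA DsA] [Gt nt DB DtB]] := (cA, cB).
have [vs vt] := (Gv Gs, Gv Gt); have [vA vB] := (Dv DA, Dv DB).
have [vAd vBd] := (vtx_dgp 1 vA, vtx_dgp 1 vB).
have DtA : D (adj2 t * (A * dgp 1)).
  apply: (Dcls DtB); first by apply: (vertexM hp hK) => //; apply: (vertex_adj hp hK).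
  by rewrite (tdist_mul hK) ?det_adj2 ?det0 // (tdist_sym hK).
have : is_scalar_mx (adj2 t * s).
  apply: (Dfree (GM (GA Gt) Gs) DsA).
  have -> : adj2 t * s * (adj2 s * (A * dgp 1)) = \det s *: (adj2 t * (A * dgp 1)).
    by rewrite !mulrA -(mulrA _ s) mul_adj2 mulmxS !mul2Zl.
  by apply: Dscale; rewrite ?det0 //; apply: Qp_det.
move/is_scalar_mxP => [c ec].
have est : \det t *: s = c *: t by rewrite -[LHS]mulSmx -mul_adj2 -mulrA ec mulmxS.
have c0 : c != 0.
  apply: contraTneq (det0 (vertexM hp hK (vertex_adj hp hK vt) vs)) => c0.
  by rewrite ec c0 scal2E !mxE2 mul0r subr0 eqxx.
apply: (nst (c / \det t)); first by rewrite mulf_neq0 ?invr_eq0 ?det0.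
by rewrite mulrC -scalerA -est scalerA mulVf ?det0 // scale1r.
Qed.

Let S : set 'M[K]_2 := [set s | exists A, crossing A s].

Let SG : S `<=` G. Proof. by move=> s [A []]. Qed.

Let spanG x : span S x -> G x.
Proof.
by elim=> [//|a b /SG Sa _ IH|a b /SG Sa _ IH]; apply: GM => //; apply: GA.
Qed.

(** Induction on the distance. The vertex Z' that follows Z on the path to Y is brought into D by
    the inverse of some h; this takes Z into D or to a neighbour X of D. In the latter case
    [translate_adjacent] brings X into D by some k, and k^-1 belongs to S. *)
Let reach n : forall Y Z, D Y -> vertex Z -> tdist Z Y = P ^+ n ->
  exists2 h, span S h & D (adj2 h * Z).
Proof.
elim: n => [|n IH] Y Z DY vZ e.
  exists 1; first exact: span1.
  by rewrite adj2_1 mul1r; apply: (Dcls DY) => //; rewrite (tdist_sym hK).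
have vY := Dv DY.
have [A [vA eA eAY]] := cartan hp hK vZ vY e.
pose Z' := A * dgp 1; have vZ' : vertex Z' by apply: vtx_dgp.
have eZ'Y : tdist Z' Y = P ^+ n.
  have eAn : A * dgp n.+1 = Z' * dgp n.
    rewrite /Z' -mulrA; congr (_ * _).
    by apply: mx2_inj; rewrite !mxE2 exprS; split; ring.
  rewrite (tdist_sym hK) -(tdist_eq1_l hK (X := A * dgp n.+1)) ?det0 //; last exact: vtx_dgp.
  by rewrite eAn (tdist_sym hK) (tdist_dgp hp hK) ?det0.
have [h hh DhZ'] := IH Y Z' DY vZ' eZ'Y.
have Gh := spanG hh; have vh := Gv Gh; have vah := vertex_adj hp hK vh.
pose X := adj2 h * Z; pose W := adj2 h * Z'.
have vX : vertex X by apply: (vertexM hp hK).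
have eXW : tdist X W = P.
  rewrite (tdist_mul hK) ?det0 // (tdist_eq1_l hK _ _ _ eA) ?det0 //.
  by rewrite (tdist_dgp hp hK) ?det0 // expr1.
have [DX|nDX] := pselect (D X); first by exists h.
have [k [Gk DkX]] := translate_adjacent DhZ' vX eXW.
have vk := Gv Gk.
have [B [vB eB eBX]] := cartan hp hK (Dv DhZ') vX (etrans (tdist_sym hK _ _) (etrans eXW (esym (expr1 _)))).
have ct : crossing B (adj2 k).
  split.
  - exact: GA.
  - move/scalar_adj/is_scalar_mxP => [c ec]; apply: nDX; apply: (Dcls DkX) => //.
    have c0 : c != 0.
      by apply: contraTneq (det0 vk) => c0; rewrite ec c0 scal2E !mxE2 mul0r subr0 eqxx.
    by rewrite ec mulSmx (tdist_sym hK) (tdistZr hK) ?det0 // (tdist_xx hK) ?det0.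
  - exact: (Dcls DhZ').
  - rewrite adj2K; apply: (Dcls DkX).
      by apply: (vertexM hp hK) => //; apply: vtx_dgp.
    by rewrite (tdist_mul hK) ?det0 // (tdist_sym hK).
exists (h * adj2 k).
  by apply: span_mul => //; apply: span_gen; exists B.
by rewrite adj2M adj2K -mulrA.
Qed.

(** By [reach], h^-1 takes [x * Y] back into D for some h in the span of S. Then h^-1 x takes a
    vertex of D into D, so it is scalar. *)
Lemma crossings_generate x : G x -> spanZ S x.
Proof.
move=> Gx; have [Y DY] := D_nonempty; have vx := Gv Gx.
have vxY := vertexM hp hK vx (Dv DY).
have [n en] := tdist_pow hp hK vxY (Dv DY).
have [h hh Dh] := reach DY vxY en; have Gh := spanG hh.
have /is_scalar_mxP[c ec] : is_scalar_mx (adj2 h * x).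
  by apply: (Dfree (GM (GA Gh) Gx) DY); rewrite -mulrA.
have vh := Gv Gh.
have exh : \det h *: x = c *: h by rewrite -[LHS]mulSmx -mul_adj2 -mulrA ec mulmxS.
have c0 : c != 0.
  apply: contraTneq (det0 (vertexM hp hK (vertex_adj hp hK vh) vx)) => c0.
  by rewrite ec c0 scal2E !mxE2 mul0r subr0 eqxx.
exists (c / \det h), h; split=> //; first by rewrite mulf_neq0 ?invr_eq0 ?det0.
by rewrite mulrC -scalerA -exh scalerA mulVf ?det0 // scale1r.
Qed.

Variables (g : nat) (gamma : 'I_g -> 'M[K]_2).
Hypothesis Gg : forall j, G (gamma j).

Let generating n := exists a : 'I_n -> 'M[K]_2,
  (forall i, S (a i)) /\ forall j, spanZ (range a) (gamma j).

(** As n is minimal, no [s i] is a multiple of another [s k] or of its inverse; nor is it a multiple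
    of its own inverse. So the 2n elements of the family t below are pairwise different in PGL(2,
    K), as [crossing_dom] requires. *)
Let crossings_basis_aux : exists n (s A : 'I_n -> 'M[K]_2),
  [/\ forall i, crossing (A i) (s i), forall j, spanZ (range s) (gamma j) &
      forall u v, u != v -> dom (adj2 (edge s A u) * edge s A v)].
Proof.
have ex : exists n, `[< generating n >].
  have [n [a [Sa ha]]] := spanZ_finite (fun j => crossings_generate (Gg j)).
  by exists n; apply/asboolP; exists a.
case: (ex_minnP ex) => n /asboolP[s [Ss hs]] nmin.
have [A hA] : exists A : 'I_n -> 'M[K]_2, forall i, crossing (A i) (s i).
  by exists (fun i => projT1 (cid (Ss i))) => i; apply: (projT2 (cid (Ss i))).
exists n, s, A; split=> // u v nuv.
pose t (u : 'I_n * bool) := if u.2 then adj2 (s u.1) else s u.1.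
have cu (w : 'I_n * bool) : crossing (edge s A w) (t w).
  by rewrite /edge /t; case: w.2 => //; apply: crossing_adj.
apply: (crossing_dom (cu u) (cu v)) => c c0 e.
have drop i k : i != k -> ~ spanZ [set s k] (s i).
  move=> nik hik; case: n s Ss hs nmin A hA t cu u v nuv e i k nik hik.
    by move=> ? ? ? ? ? ? ? ? [[]].
  move=> n s Ss hs nmin A hA t cu u v nuv e i k nik hik.
  suff /nmin : `[< generating n >] by rewrite ltnn.
  apply/asboolP; exists (fun j => s (lift i j)); split=> [j|j]; first exact: Ss.
  apply: spanZ_trans (hs j) => _ [l _ <-].
  case: (unliftP i l) => [l' ->|->].
    by apply: spanZ_span; apply: span_gen; exists l'.
  apply: spanZ_trans hik => _ ->.
  have [k' -> _] := unlift_some nik.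
  by apply: spanZ_span; apply: span_gen; exists k'.
move: u v nuv e => [i b] [k b'] nuv; rewrite /t /=.
have [eik|nik] := eqVneq i k; last first.
  have gk : spanZ [set s k] (s k) by apply: spanZ_span; apply: span_gen.
  have si : (if b then adj2 (s i) else s i) = c *: (if b' then adj2 (s k) else s k) ->
      spanZ [set s k] (s i).
    case: b {nuv} => e.
      rewrite -[s i]adj2K e; apply: spanZ_adj; apply: spanZ_scale => //.
      by case: b' {e} => //; apply: spanZ_adj.
    by rewrite e; apply: spanZ_scale => //; case: b' {e} => //; apply: spanZ_adj.
  by move/si/(drop _ _ nik).
rewrite -eik in nuv *; have [Gs ns _ _] := hA i.
have vs := Gv Gs.
have nbb : b' = ~~ b by case: b b' nuv => [] [] //; rewrite eqxx.
(* There are no involutions: by comparison of entries, d = -1 gives trace 0, which [Ghyp] excludes,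
   and any other d makes [s i] scalar. *)
have main d : d != 0 -> adj2 (s i) <> d *: s i.
  move=> d0 e; have := congr1 (fun M : 'M[K]_2 => M 0 1) e.
  have := congr1 (fun M : 'M[K]_2 => M 1 0) e.
  have := congr1 (fun M : 'M[K]_2 => M 0 0) e.
  have := congr1 (fun M : 'M[K]_2 => M 1 1) e.
  rewrite /adj2 !mxE2 => e11 e00 e10 e01.
  have [d1|d1] := eqVneq d (-1).
    have tr0 : \tr (s i) = 0 by rewrite tr2E e11 d1 mulN1r addNr.
    have := Ghyp Gs ns; rewrite tr0 (abs0 hK) expr0n /= ltNge (abs_ge0 hK) //.
  apply: ns; rewrite is_scalar2E.
  have d10 : d + 1 != 0 by rewrite addr_eq0.
  have off x : - x = d * x -> x == 0.
    move=> ex'; have : (d + 1) * x = 0 by rewrite mulrDl mul1r -ex' addNr.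
    by move/eqP; rewrite mulf_eq0 (negbTE d10).
  rewrite (off _ e01) (off _ e10) /= -subr_eq0.
  have : (d + 1) * (s i 0 0 - s i 1 1) = 0.
    have -> : (d + 1) * (s i 0 0 - s i 1 1) =
      (d * s i 0 0 - s i 1 1) + (s i 0 0 - d * s i 1 1) by ring.
    by rewrite -e11 -e00; ring.
  by move/eqP; rewrite mulf_eq0 (negbTE d10).
rewrite nbb; case: b {nuv nbb} => /= e; first exact: (main c).
apply: (main c^-1); first by rewrite invr_eq0.
by rewrite {2}e scalerA mulVf // scale1r.
Qed.

Lemma crossings_basis : exists n (s A : 'I_n -> 'M[K]_2),
  [/\ forall i, G (s i) /\ vertex (A i), forall j, spanZ (range s) (gamma j) &
      forall u v, u != v -> dom (adj2 (edge s A u) * edge s A v)].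
Proof.
have [n [s [A [h1 h2 h3]]]] := crossings_basis_aux.
by exists n, s, A; split=> // i; have [Gs _ DA _] := h1 i; split=> //; apply: Dv.
Qed.

End Existence.

(** * Ping-pong *)

Section Hyperbolic.
Variables (p : nat) (R : realType) (K : fieldType) (abs : K -> R).
Hypotheses (hp : prime p) (hK : is_Cp abs p).
Implicit Types M N X : 'M[K]_2.

Lemma eigenvalue2 M x : eigenvalue M x = (\det (M - x%:M) == 0).
Proof.
rewrite /eigenvalue /eigenspace kermx_eq0 row_free_unit unitmx2 negbK.
by [].
Qed.

Lemma charpoly2 M x : \det (M - x%:M) = x ^+ 2 - \tr M * x + \det M.
Proof. by rewrite !mxE2; ring. Qed.

(** For eigenvalues l, m with |m| < |l|, the trace l + m has absolute value |l|, and |l m| <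
    |l|^2. *)
Lemma hyperbolic_tr M : hyperbolic abs M -> abs (\det M) < abs (\tr M) ^+ 2.
Proof.
suff h l m : eigenvalue M l -> eigenvalue M m -> abs m < abs l ->
    abs (\det M) < abs (\tr M) ^+ 2.
  move=> [l [m [hl hm nlm]]]; case: (ltgtP (abs l) (abs m)) => // c.
    exact: (h m l).
  exact: (h l m).
rewrite !eigenvalue2 !charpoly2 => /eqP el /eqP em lt.
have nlm : l - m != 0.
  by rewrite subr_eq0; apply: contraTneq lt => ->; rewrite ltxx.
have et : \tr M = l + m.
  apply: (mulfI nlm); apply/eqP; rewrite -subr_eq0; apply/eqP.
  by rewrite -[RHS](subrr 0) -{1}em -el; ring.
have ed : \det M = l * m.
  by move/eqP: el; rewrite et addr_eq0 => /eqP el; rewrite -[LHS]opprK -el; ring.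
rewrite et ed (absDl hK) // (absM hK) expr2 ltr_pM2l //.
exact: le_lt_trans (abs_ge0 hK _) lt.
Qed.

Lemma hyperbolicZ c M : c != 0 -> hyperbolic abs M -> hyperbolic abs (c *: M).
Proof.
move=> c0 [l [m [hl hm nlm]]]; exists (c * l), (c * m).
have e x : eigenvalue M x -> eigenvalue (c *: M) (c * x).
  rewrite !eigenvalue2 !charpoly2 det2Z tr2Z => /eqP h.
  have -> : (c * x) ^+ 2 - c * \tr M * (c * x) + c ^+ 2 * \det M =
    c ^+ 2 * (x ^+ 2 - \tr M * x + \det M) by ring.
  by rewrite h mulr0.
split; try exact: e.
by rewrite !(absM hK) => /mulfI h; apply: nlm; apply: h; rewrite (abs_eq0 hK).
Qed.

Lemma Qp_algebraic x : Qp abs x -> algebraic_over_Qp abs x.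
Proof.
move=> hx; exists ('X - x%:P); split.
- by rewrite polyXsubC_eq0.
- move=> i; rewrite coefB coefX coefC.
  apply: (QpB hp hK); first by case: (i == 1)%N; [exact: (Qp1 hp hK)|exact: (Qp0 hp hK)].
  by case: i => [|i] //=; apply: (Qp0 hp hK).
- by rewrite root_XsubC.
Qed.

(** The eigenvalues are x and tr M - x. If they had the same absolute value, then |tr M|^2 <= |x|^2
    = |det M|. Entries in [Qp] give the characteristic polynomial algebraic coefficients, the case
    in which [is_Cp] provides a root. *)
Lemma tr_hyperbolic M : (forall i j, Qp abs (M i j)) ->
  abs (\det M) < abs (\tr M) ^+ 2 -> hyperbolic abs M.
Proof.
move=> hM lt; pose q : {poly K} := 'X^2 - (\tr M)%:P * 'X + (\det M)%:P.
have sq : size q = 3%N.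
  have h1 : (size ((\tr M)%:P * 'X : {poly K})%R <= 2)%N.
    by rewrite mul_polyC (leq_trans (size_scale_leq _ _)) // size_polyX.
  have h2 := size_polyC_leq1 (\det M).
  rewrite /q -addrA size_polyDl size_polyXn //.
  apply: leq_ltn_trans (size_polyD _ _) _; rewrite gtn_max size_polyN.
  by rewrite !ltnS h1 (leq_trans h2).
have [x /rootP] : exists x, root q x.
  apply: (algebraic_closed hK); first by rewrite sq.
  move=> i; apply: Qp_algebraic; rewrite /q !coefE.
  apply: (QpD hp hK).
    apply: (QpB hp hK).
      by case: (i == 2)%N; [exact: (Qp1 hp hK)|exact: (Qp0 hp hK)].
    apply: (QpM hp hK); first exact: (Qp_tr2 hp hK).
    by case: (i == 1)%N; [exact: (Qp1 hp hK)|exact: (Qp0 hp hK)].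
  by case: (i == 0)%N; [exact: (Qp_det2 hp hK)|exact: (Qp0 hp hK)].
rewrite /q !hornerE => ex.
exists x, (\tr M - x); split.
- by rewrite eigenvalue2 charpoly2 -ex; apply/eqP; ring.
- by rewrite eigenvalue2 charpoly2 -ex; apply/eqP; ring.
move=> e; move: lt; apply/negP; rewrite -leNgt.
have -> : \det M = x * (\tr M - x).
  by rewrite -[LHS]subr0 -ex; ring.
rewrite (absM hK) -e -expr2 ler_sqr ?nnegrE ?(abs_ge0 hK) //.
by rewrite -{1}[\tr M](subrK x) (absD_le hK) // -e.
Qed.

Lemma scalar_not_hyperbolic M : is_scalar_mx M -> abs (\tr M) ^+ 2 <= abs (\det M).
Proof.
move=> /is_scalar_mxP[c ->].
have -> : \tr (c%:M : 'M[K]_2) = 2%:R * c by rewrite !mxE2; ring.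
have -> : \det (c%:M : 'M[K]_2) = c * c by rewrite !mxE2; ring.
rewrite !(absM hK) exprMn -expr2 ler_piMl ?exprn_ge0 ?(abs_ge0 hK) //.
by rewrite expr_le1 ?(abs_ge0 hK) ?(abs_nat_le1 hK).
Qed.

Lemma tr_ltZ c M : c != 0 -> abs (\det M) < abs (\tr M) ^+ 2 ->
  abs (\det (c *: M)) < abs (\tr (c *: M)) ^+ 2.
Proof.
move=> c0 h; rewrite det2Z tr2Z (absM hK (c ^+ 2)) (absX hK) (absM hK c) exprMn ltr_pM2l //.
by rewrite exprn_gt0 // (abs_gt0 hK).
Qed.

(** Such M map the open unit disc around 0 into itself. The condition is stable under products, and
    it lets the entry [M 1 1] dominate the trace. *)
Definition contracting M :=
  [/\ abs (M 1 0) <= abs (M 1 1), abs (M 0 0) < abs (M 1 1) & abs (M 0 1) < abs (M 1 1)].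

Let contracting_gt0 M : contracting M -> 0 < abs (M 1 1).
Proof. by move=> [_ h _]; apply: le_lt_trans h; apply: (abs_ge0 hK). Qed.

Lemma contracting_mul M N : contracting M -> contracting N -> contracting (M * N).
Proof.
move=> cM cN; have [m0 n0] := (contracting_gt0 cM, contracting_gt0 cN).
case: cM cN => [m1 m2 m3] [n1 n2 n3].
have lt x y x' y' : abs x < y -> abs x' <= y' -> 0 < y' -> abs (x * x') < y * y'.
  move=> h h' y0; rewrite (absM hK); apply: le_lt_trans (_ : abs x * y' < _).
    by rewrite ler_wpM2l ?(abs_ge0 hK).
  by rewrite ltr_pM2r.
have le x y x' y' : abs x <= y -> abs x' <= y' -> abs (x * x') <= y * y'.
  by move=> h h'; rewrite (absM hK) ler_pM ?(abs_ge0 hK).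
have e11 : abs ((M * N) 1 1) = abs (M 1 1) * abs (N 1 1).
  rewrite mul2E (absDr hK) ?(absM hK) // -?(absM hK).
  by rewrite mulrC [X in _ < abs X]mulrC [X in _ < X](absM hK) lt.
split; rewrite e11 mul2E.
- by apply: (absD_le hK); apply: le => //; apply: ltW.
- by apply: (absD_lt hK); apply: lt => //; apply: ltW.
- by apply: (absD_lt hK); apply: lt => //; apply: ltW.
Qed.

Lemma contractingZ c M : c != 0 -> contracting (c *: M) <-> contracting M.
Proof.
move=> c0; have ac : 0 < abs c by rewrite (abs_gt0 hK).
rewrite /contracting !mxE2 !(absM hK) ler_pM2l // !ltr_pM2l //.
Qed.

Lemma contracting_tr M : contracting M -> abs (\det M) < abs (\tr M) ^+ 2.
Proof.
move=> cM; have m0 := contracting_gt0 cM; case: cM => m1 m2 m3.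
rewrite tr2E (absDr hK) // det2E expr2.
have lt x x' : abs x < abs (M 1 1) -> abs x' <= abs (M 1 1) ->
    abs (x * x') < abs (M 1 1) * abs (M 1 1).
  move=> h h'; rewrite (absM hK); apply: le_lt_trans (_ : abs x * abs (M 1 1) < _).
    by rewrite ler_wpM2l ?(abs_ge0 hK).
  by rewrite ltr_pM2r.
by apply: (absB_lt hK); apply: lt.
Qed.

End Hyperbolic.

(** * Freeness and hyperbolicity from edges that point away from each other *)

Section PingPong.
Variables (p : nat) (R : realType) (K : fieldType) (abs : K -> R).
Hypotheses (hp : prime p) (hK : is_Cp abs p).
Variables (n : nat) (s A : 'I_n -> 'M[K]_2).
Hypotheses (us : forall i, s i \in unitmx) (A0 : forall i, \det (A i) != 0).
Implicit Types (l m : 'I_n * bool) (w : seq ('I_n * bool)).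

Local Notation Jmx := (Jmx p K).
Local Notation edge := (edge p s A).

Hypothesis domA : forall u v, u != v -> dom abs (adj2 (edge u) * edge v).

Let s0 i : \det (s i) != 0. Proof. by rewrite -unitmx2. Qed.

Lemma JmxJ : Jmx * Jmx = p%:R *: 1.
Proof. by apply: mx2_inj; rewrite !mxE2; split; ring. Qed.

Lemma det_Jmx : \det Jmx = - p%:R.
Proof. by rewrite !mxE2; ring. Qed.

Let pK0 : p%:R != 0 :> K. Proof. exact: (pK_neq0 hp hK). Qed.

Lemma det_edge u : \det (edge u) != 0.
Proof.
rewrite /edge; case: (u.2) => //.
by rewrite !det2M det_adj2 det_Jmx !mulf_neq0 ?oppr_eq0.
Qed.

(** The letter l carries the reversed edge of l^-1 onto the edge of l; reversing twice costs the
    factor p of [JmxJ]. *)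
Lemma edge_inv l : exists2 c, c != 0 &
  c *: edge l = letter s l * edge (inv_letter l) * Jmx.
Proof.
case: l => i [] /=; rewrite /letter /edge /inv_letter /=.
  exists (\det (s i))^-1; first by rewrite invr_eq0.
  by rewrite invmx2 // !mul2Zl.
exists (\det (s i) * p%:R); first by rewrite mulf_neq0.
rewrite !mulrA mul_adj2 -!mulrA JmxJ mul2Zr mulr1 mulSmx.
by rewrite scalerA.
Qed.

(** By [edge_inv] this is, up to a scalar, [adj2 Jmx] times the matrix comparing the edges of l^-1
    and m, to which [domA] applies. The factor [adj2 Jmx] moves the dominant entry (0, 1) to (1, 1)
    and puts a factor p on the new first row. *)
Let contracting_step l m : m != inv_letter l ->
  contracting abs (adj2 (edge l) * letter s l * edge m).
Proof.
move=> nml; have [c c0 ec] := edge_inv l.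
apply/(contractingZ hK _ c0); rewrite -!mul2Zl -adj2Z ec !adj2M.
set L := letter s l; set E := edge (inv_letter l).
have -> : adj2 Jmx * (adj2 E * adj2 L) * L * edge m =
    \det L *: (adj2 Jmx * (adj2 E * edge m)).
  rewrite -!mulrA (mulrA (adj2 L)) adj2_mul -[(_ %:M * _)]/(_ * _).
  by rewrite mulSmx !mul2Zr.
have L0 : \det L != 0 by rewrite -unitmx2 letter_unit.
apply/(contractingZ hK _ L0).
have dM : dom abs (adj2 E * edge m) by apply: domA; rewrite eq_sym.
set M := adj2 E * edge m in dM *.
have M0 : \det M != 0 by rewrite det2M det_adj2 mulf_neq0 ?det_edge.
have b0 : 0 < abs (M 0 1) by apply: lt_le_trans dM; apply: (mxnorm_gt0 hK).
have -> : adj2 Jmx * M = mx2 (- (p%:R * M 1 0)) (- (p%:R * M 1 1)) (- M 0 0) (- M 0 1).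
  by move: M {dM M0 b0} => M; apply: mx2_inj; rewrite /adj2 !mxE2; split; ring.
have le i j : abs (M i j) <= abs (M 0 1) by apply: le_trans dM; apply: le_mxnorm.
rewrite /contracting !mx2E !(absN hK) !(absM hK).
have lt i j : abs p%:R * abs (M i j) < abs (M 0 1).
  apply: le_lt_trans (_ : abs p%:R * abs (M 0 1) < _).
    by rewrite ler_wpM2l ?(abs_ge0 hK).
  by rewrite gtr_pMl // (abs_p_lt1 hp hK).
by split.
Qed.

(** Between consecutive letters a scalar [E * adj2 E] is inserted, E being the edge of the second
    one; this splits the product into factors of the kind of [contracting_step]. *)
Let contracting_word l w m : reduced (l :: w) -> m != inv_letter (last l w) ->
  contracting abs (adj2 (edge l) * word_value s (l :: w) * edge m).
Proof.
elim: w l => [|l2 w IH] l.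
  by move=> _ /= h; rewrite word_value_cons word_value_nil mulr1; apply: contracting_step.
rewrite reduced_cons => /andP[n2 r2] /= hm.
have e0 := det_edge l2.
apply/(contractingZ hK _ e0); rewrite word_value_cons.
set V := word_value s (l2 :: w).
have -> : \det (edge l2) *: (adj2 (edge l) * (letter s l * V) * edge m) =
  (adj2 (edge l) * letter s l * edge l2) * (adj2 (edge l2) * V * edge m).
  rewrite -!mulrA (mulrA (edge l2)) mul_adj2 mulSmx !mul2Zr.
  by rewrite !mulrA.
by apply: (contracting_mul hK); [apply: contracting_step|apply: IH].
Qed.

Let tr_conj X M : \det X != 0 -> abs (\det (adj2 X * M * X)) < abs (\tr (adj2 X * M * X)) ^+ 2 ->
  abs (\det M) < abs (\tr M) ^+ 2.
Proof.
move=> x0; rewrite tr2MC mulrA mul_adj2 mulSmx tr2Z !det2M det_adj2 !(absM hK).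
rewrite [X in X < _](_ : _ = abs (\det X) ^+ 2 * abs (\det M)); last by ring.
by rewrite exprMn ltr_pM2l // exprn_gt0 // (abs_gt0 hK).
Qed.

Lemma pingpong_word w : reduced w -> w != [::] ->
  abs (\det (word_value s w)) < abs (\tr (word_value s w)) ^+ 2.
Proof.
have [k] := ubnP (size w); elim: k w => // k IH [//|l w]; rewrite [size (l :: w)]/= ltnS => sw rw _.
(* A cyclically reduced word becomes contracting when conjugated by the edge of its first letter.
   Otherwise the first and last letters are inverse to each other, and cancelling them is a
   conjugation. *)
have [e|ne] := eqVneq l (inv_letter (last l w)); last first.
  apply: (tr_conj (det_edge l)); apply: (contracting_tr hK).
  exact: contracting_word.
case/lastP: w sw rw e => [|w m] sw rw; rewrite ?last_rcons.
  by case: l {sw rw} => i []; rewrite /inv_letter /= => -[].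
move=> e; have rw' : reduced w.
  move: rw; rewrite reduced_cons => /andP[_]; rewrite !reducedE -cats1.
  by case/cat_sorted2.
have w0 : w != [::].
  case: w rw {sw rw'} => //; rewrite reduced_cons => /andP[].
  by rewrite e inv_letterK eqxx.
have lt : (size w < k)%N by move: sw; rewrite size_rcons; apply: leq_trans.
have em : m = inv_letter l by rewrite e inv_letterK.
have := IH w lt rw' w0.
rewrite -cats1 word_value_cons word_value_cat word_value_cons word_value_nil mulr1.
rewrite em letter_inv //; set L := letter s l; set V := word_value s w.
have uL : L \in unitmx by rewrite letter_unit.
have L0 : \det L != 0 by rewrite -unitmx2.
have eLL : invmx L * L = 1 by exact: mulVmx.
rewrite tr2MC -mulrA eLL mulr1 !det2M mulrCA.
have -> : \det L * \det (invmx L) = 1 by rewrite mulrC -det2M eLL det1.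
by rewrite mulr1.
Qed.

Lemma pingpong_free : freely_generate s.
Proof.
move=> w rw w0 sw; have := pingpong_word rw w0.
by rewrite ltNge (scalar_not_hyperbolic hK).
Qed.

Lemma pingpong_hyperbolic M : generated_group s M -> ~ is_scalar_mx M ->
  abs (\det M) < abs (\tr M) ^+ 2.
Proof.
move=> [c [w [c0 ->]]]; rewrite -word_value_reduce // => ns.
apply: (tr_ltZ hK c0); apply: pingpong_word; first exact: reduced_reduce.
apply/eqP => e; apply: ns.
by rewrite e word_value_nil is_scalarZ2 // -[1]/(1%:M) scalar_mx_is_scalar.
Qed.

End PingPong.

(** * Discs and balls *)

Section Balls.
Variables (p : nat) (R : realType) (K : fieldType) (abs : K -> R).
Hypotheses (hp : prime p) (hK : is_Cp abs p).
Implicit Types (M X Y A h : 'M[K]_2) (z : P1 K).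

Local Notation P := (p%:R : R).
Local Notation vertex := (vertex abs).
Local Notation Jmx := (Jmx p K).

(** [Jmx] acts as z -> p / z, so this is the radius for which J exchanges the two sides of the
    circle |z| = rho. *)
Definition rho : R := P `^ (- 2^-1).

Lemma rho_gt0 : 0 < rho. Proof. by rewrite powR_gt0 // (pR_gt0 R hp). Qed.

Lemma rho_sqr : rho * rho = P^-1.
Proof.
rewrite /rho -powRD; last by rewrite (pR_neq0 R hp) implybT.
have -> : - 2^-1 + - 2^-1 = -1 :> R by lra.
by rewrite powR_inv1 // ltW ?(pR_gt0 R hp).
Qed.

Lemma rho_lt1 : rho < 1.
Proof.
rewrite ltNge; apply/negP => h.
have : 1 <= rho * rho by rewrite -[1]mulr1 ler_pM.
by rewrite rho_sqr leNgt invf_lt1 ?(pR_gt0 R hp) // (pR_gt1 R hp).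
Qed.

Lemma rhoV_ltP : rho^-1 < P.
Proof.
have -> : P = rho^-1 * rho^-1 by rewrite -invfM rho_sqr invrK.
have r0 := rho_gt0.
by rewrite ltr_pMl ?invr_gt0 // invf_gt1 // rho_lt1.
Qed.

Definition homog z : K * K := if z is Some x then (x, 1) else (1, 0).

(* The homogeneous coordinates of [A^-1 z], up to a common factor. *)
Definition pull1 A z : K := A 1 1 * (homog z).1 - A 0 1 * (homog z).2.
Definition pull2 A z : K := A 0 0 * (homog z).2 - A 1 0 * (homog z).1.

(* The image under A of the disc of radius p^(-1/2) around 0, whose boundary
   point is the midpoint of an edge of the Bruhat-Tits tree. *)
Definition cdisc A : set (P1 K) := [set z | abs (pull1 A z) <= rho * abs (pull2 A z)].
Definition odisc A : set (P1 K) := [set z | abs (pull1 A z) < rho * abs (pull2 A z)].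

Lemma discZ c A : c != 0 -> cdisc (c *: A) = cdisc A.
Proof.
move=> c0; have ac : 0 < abs c by rewrite (abs_gt0 hK).
apply/seteqP; split=> z; rewrite /cdisc /= /pull1 /pull2 !scale2E -!mulrA -!mulrBr;
  by rewrite !(absM hK) mulrCA ler_pM2l.
Qed.

Lemma odiscC A : ~` odisc A = cdisc (A * Jmx).
Proof.
have r0 := rho_gt0.
suff e z : (abs (pull1 (A * Jmx) z) <= rho * abs (pull2 (A * Jmx) z)) =
    ~~ (abs (pull1 A z) < rho * abs (pull2 A z)).
  by apply/seteqP; split=> z; rewrite /cdisc /odisc /= e => /negP.
have -> : pull1 (A * Jmx) z = - (p%:R * pull2 A z).
  by rewrite /pull1 /pull2 /Jmx !mxE2; ring.
have -> : pull2 (A * Jmx) z = - pull1 A z.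
  by rewrite /pull1 /pull2 /Jmx !mxE2; ring.
by rewrite !(absN hK) (absM hK) (abs_p_eq hK) -rho_sqr -mulrA ler_pM2l // leNgt.
Qed.

Lemma hom_inj z z' (c : K) : c != 0 -> c * (homog z).1 = (homog z').1 ->
  c * (homog z).2 = (homog z').2 -> z = z'.
Proof.
move=> c0; case: z z' => [x|] [x'|] //=; rewrite ?mulr1 ?mulr0.
- by move=> + c1; rewrite c1 mul1r => ->.
- by move=> _ e; move: c0; rewrite e eqxx.
- by move=> _ /esym/eqP; rewrite oner_eq0.
Qed.

Lemma hom_neq0 z : (homog z).1 != 0 \/ (homog z).2 != 0.
Proof. by case: z => [x|] /=; [right|left]; rewrite oner_eq0. Qed.

(** Turns the case distinctions of [fractional_linear] into the linear action on homogeneous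
    coordinates, up to the factor c. *)
Lemma hom_fl h z : \det h != 0 -> exists2 c, c != 0 &
  c * (homog (fractional_linear h z)).1 = h 0 0 * (homog z).1 + h 0 1 * (homog z).2 /\
  c * (homog (fractional_linear h z)).2 = h 1 0 * (homog z).1 + h 1 1 * (homog z).2.
Proof.
rewrite det2E => d0; case: z => [x|] /=; rewrite ?mulr1 ?mulr0 ?addr0.
  have [e|ne] := eqVneq (h 1 0 * x + h 1 1) 0; last first.
    by exists (h 1 0 * x + h 1 1) => //=; rewrite mulr1 mulrC divfK.
  exists (h 0 0 * x + h 0 1) => /=; last by rewrite mulr1 mulr0.
  apply: contra_neq d0 => e'.
  have [c0|c0] := eqVneq (h 1 0) 0.
    by move: e; rewrite c0 mul0r add0r => ->; rewrite !mulr0 subrr.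
  apply: (mulfI c0); rewrite mulr0.
  have -> : h 1 1 = - (h 1 0 * x) by apply/eqP; rewrite -addr_eq0 addrC e.
  have -> : h 0 1 = - (h 0 0 * x) by apply/eqP; rewrite -addr_eq0 addrC e'.
  by ring.
have [e|ne] := eqVneq (h 1 0) 0; last first.
  by exists (h 1 0) => //=; rewrite mulr1 mulrC divfK.
exists (h 0 0) => /=; last by rewrite mulr1 mulr0 e.
by apply: contra_neq d0 => ->; rewrite e mul0r mulr0 subrr.
Qed.

Lemma fl_adjK h z : \det h != 0 -> fractional_linear h (fractional_linear (adj2 h) z) = z.
Proof.
move=> d0; have d0' : \det (adj2 h) != 0 by rewrite det_adj2.
have [c c0 []] := hom_fl (fractional_linear (adj2 h) z) d0.
have [c' c'0 []] := hom_fl z d0'.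
rewrite /adj2 !mx2E; set w := homog (fractional_linear _ z); set v := homog (fractional_linear _ _).
move=> e1 e2 f1 f2.
apply: (@hom_inj _ _ (c' * c / \det h)); first by rewrite !mulf_neq0 ?invr_eq0.
  apply: (mulfI d0); rewrite -/v.
  have -> : \det h * (c' * c / \det h * v.1) = c' * (c * v.1) by field.
  rewrite f1 mulrDr mulrCA [c' * (_ * _)]mulrCA.
  rewrite [c' * w.1]e1 [c' * w.2]e2 det2E; ring.
apply: (mulfI d0); rewrite -/v.
have -> : \det h * (c' * c / \det h * v.2) = c' * (c * v.2) by field.
rewrite f2 mulrDr mulrCA [c' * (_ * _)]mulrCA.
rewrite [c' * w.1]e1 [c' * w.2]e2 det2E; ring.
Qed.

Lemma mem_cdisc_fl h A z : \det h != 0 ->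
  cdisc (h * A) (fractional_linear h z) <-> cdisc A z.
Proof.
move=> d0; have [c c0 [e1 e2]] := hom_fl z d0.
have f1 : c * pull1 (h * A) (fractional_linear h z) = \det h * pull1 A z.
  rewrite /pull1; set w := homog (fractional_linear h z) in e1 e2 *.
  rewrite mulrBr mulrCA e1 mulrCA e2 !mxE2; ring.
have f2 : c * pull2 (h * A) (fractional_linear h z) = \det h * pull2 A z.
  rewrite /pull2; set w := homog (fractional_linear h z) in e1 e2 *.
  rewrite mulrBr mulrCA e2 mulrCA e1 !mxE2; ring.
have ac : 0 < abs c by rewrite (abs_gt0 hK).
have ad : 0 < abs (\det h) by rewrite (abs_gt0 hK).
rewrite /cdisc /= -(ler_pM2l ac) mulrCA -!(absM hK) f1 f2 !(absM hK) mulrCA.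
by rewrite ler_pM2l.
Qed.

Lemma fl_cdisc h A : \det h != 0 -> fractional_linear h @` cdisc A = cdisc (h * A).
Proof.
move=> d0; apply/seteqP; split=> [_ [z hz <-]|z hz]; first exact/mem_cdisc_fl.
exists (fractional_linear (adj2 h) z); last exact: fl_adjK.
by apply/(mem_cdisc_fl _ _ d0); rewrite fl_adjK.
Qed.

(** The coordinates x, y of a point z of the disc of B satisfy |x| < |y|, so [M 0 1 * y] dominates
    the coordinates of z with respect to A: |pull1 A z| >= |pull2 A z|, and z is not in the disc of
    A as rho < 1. *)
Lemma cdisc_disjoint A B : \det A != 0 -> \det B != 0 ->
  dom abs (adj2 A * B) -> cdisc A `&` cdisc B = set0.
Proof.
move=> a0 b0 dM; rewrite -subset0 => z [hA hB].
set M := adj2 A * B in dM; have r0 := rho_gt0.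
have M0 : \det M != 0 by rewrite det2M det_adj2 mulf_neq0.
have m0 : 0 < abs (M 0 1) by apply: lt_le_trans dM; apply: (mxnorm_gt0 hK).
have le i j : abs (M i j) <= abs (M 0 1) by apply: le_trans dM; apply: le_mxnorm.
pose x := pull1 B z; pose y := pull2 B z.
have e1 : \det B * pull1 A z = M 0 0 * x + M 0 1 * y.
  by rewrite /x /y /M /pull1 /pull2 /adj2 !mxE2; ring.
have e2 : \det B * pull2 A z = M 1 0 * x + M 1 1 * y.
  by rewrite /x /y /M /pull1 /pull2 /adj2 !mxE2; ring.
have hB' : abs x <= rho * abs y by [].
have y0 : y != 0.
  apply/eqP => y0; move: hB'; rewrite y0 (abs0 hK) mulr0 => hx.
  have x0 : x = 0 by apply/eqP; rewrite -(abs_eq0 hK) eq_le hx (abs_ge0 hK).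
  have t1 : \det B * (homog z).1 = 0.
    have -> : \det B * (homog z).1 = B 0 0 * x + B 0 1 * y.
      by rewrite /x /y /pull1 /pull2 det2E; ring.
    by rewrite x0 y0 !mulr0 addr0.
  have t2 : \det B * (homog z).2 = 0.
    have -> : \det B * (homog z).2 = B 1 0 * x + B 1 1 * y.
      by rewrite /x /y /pull1 /pull2 det2E; ring.
    by rewrite x0 y0 !mulr0 addr0.
  move: t1 t2 => /eqP; rewrite mulf_eq0 (negbTE b0) => /eqP t1 /eqP.
  rewrite mulf_eq0 (negbTE b0) => /eqP t2.
  by case: (hom_neq0 z); rewrite ?t1 ?t2 eqxx.
have ay : 0 < abs y by rewrite (abs_gt0 hK).
have xy : abs x < abs y by apply: le_lt_trans hB' _; rewrite gtr_pMl // rho_lt1.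
have ab : 0 < abs (\det B) by rewrite (abs_gt0 hK).
have n1 : abs (\det B * pull1 A z) = abs (M 0 1) * abs y.
  rewrite e1 (absDr hK) ?(absM hK) //.
  apply: le_lt_trans (_ : abs (M 0 1) * abs x < _); last by rewrite ltr_pM2l.
  by rewrite ler_wpM2r ?(abs_ge0 hK).
have n2 : abs (\det B * pull2 A z) <= abs (M 0 1) * abs y.
  rewrite e2; apply: (absD_le hK); rewrite (absM hK) ler_pM ?(abs_ge0 hK) //.
  exact: ltW.
have : abs (\det B * pull1 A z) <= rho * abs (\det B * pull2 A z).
  by rewrite !(absM hK) mulrCA ler_pM2l.
rewrite n1 leNgt => /negP; apply.
apply: le_lt_trans (_ : rho * (abs (M 0 1) * abs y) < _); first by rewrite ler_pM2l.
by rewrite gtr_pMl ?mulr_gt0 // rho_lt1.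
Qed.

Definition vl (x : K) : int := odflt 0 (some_such (valuation_is p abs x)).

Lemma vlP x : Qp abs x -> x != 0 ->
  some_such (valuation_is p abs x) = Some (vl x) /\ abs x = P ^ (- vl x).
Proof.
move=> hx x0; rewrite /vl /some_such; case: pselect => [h|[]] /=.
  by split=> //; case: (cid h) => v [].
by have [v ev] := Qp_abs hp hK hx x0; exists (- v); split=> //; rewrite opprK.
Qed.

(** The disc of A contains infinity iff - A 1 1 / A 1 0, the preimage of infinity, has absolute
    value at most rho; for entries in [Qp] this means |A 1 1| < |A 1 0|. The centers are A(0) and
    A(infinity), and the radii |det A| / |A 1 1|^2 times rho and |det A| / |A 1 0|^2 times 1 / rho,
    as half-integral powers of p. *)
Definition ball_code A : den K BallTy :=
  if abs (A 1 0) <= abs (A 1 1)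
  then ((false, A 0 1 / A 1 1), (4 * vl (A 1 1) - 2 * vl (\det A) - 1, 2))
  else ((true, A 0 0 / A 1 0), (4 * vl (A 1 0) - 2 * vl (\det A) + 1, 2)).

Let radiusE x y (e : int) : Qp abs x -> x != 0 -> Qp abs y -> y != 0 ->
  P `^ ((4 * vl x - 2 * vl y + e)%:~R / (2 : int)%:~R) =
  abs y / abs x ^+ 2 * P `^ (e%:~R / 2).
Proof.
move=> hx x0 hy y0; have [_ ->] := vlP hx x0; have [_ ->] := vlP hy y0.
have -> : (4 * vl x - 2 * vl y + e)%:~R / (2 : int)%:~R =
   (vl x + vl x - vl y)%:~R + e%:~R / 2 :> R.
  by rewrite !(rmorphD, rmorphM, rmorphN) /= rmorph1; field.
rewrite powRD; last by rewrite (pR_neq0 R hp) implybT.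
rewrite powR_intmul ?ltW ?(pR_gt0 R hp) //; congr (_ * _).
rewrite !expfzDr ?(pR_neq0 R hp) // expr2 invfM !invr_expz !opprK.
by rewrite mulrC.
Qed.

(** Here y is the displacement from the center. As long as |c y| < |D / d|, the right-hand side has
    the constant absolute value |D / d|; beyond that all inequalities fail, by r |c| < |d|. *)
Let disc_eq (c d D y : K) (r : R) : 0 < r -> r * abs c < abs d -> D != 0 ->
  ((abs (d * y) <= r * abs (D / d - c * y)) = (abs y <= abs D / abs d ^+ 2 * r)) *
  ((abs (d * y) < r * abs (D / d - c * y)) = (abs y < abs D / abs d ^+ 2 * r)).
Proof.
move=> r0 rcd D0.
have d0 : 0 < abs d by apply: le_lt_trans rcd; rewrite mulr_ge0 ?(abs_ge0 hK) // ltW.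
have [lt|le] := ltP (abs (c * y)) (abs (D / d)).
  rewrite (absDl hK) ?(absN hK) // !(absM hK) (absV hK).
  have -> : r * (abs D / abs d) = abs d * (abs D / abs d ^+ 2 * r).
    by field; rewrite gt_eqF.
  by rewrite ler_pM2l // ltr_pM2l.
have y0 : 0 < abs y.
  rewrite lt_def (abs_ge0 hK) andbT; apply: contraTneq le => y0.
  rewrite (absM hK c) y0 mulr0 -ltNge (abs_gt0 hK) mulf_neq0 // invr_eq0.
  by rewrite -(abs_gt0 hK).
have l1 : r * abs (D / d - c * y) < abs (d * y).
  apply: le_lt_trans (_ : r * abs (c * y) < _).
    by rewrite ler_pM2l //; apply: (absB_le hK).
  by rewrite !(absM hK) mulrA ltr_pM2r.
have l2 : abs D / abs d ^+ 2 * r < abs y.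
  apply: le_lt_trans (_ : r * abs c / abs d * abs y < _); last first.
    by rewrite gtr_pMl // ltr_pdivrMr // mul1r.
  have -> : abs D / abs d ^+ 2 * r = (r / abs d) * (abs D / abs d).
    by field; rewrite gt_eqF.
  have -> : r * abs c / abs d * abs y = (r / abs d) * (abs c * abs y) by field; rewrite gt_eqF.
  by rewrite ler_pM2l ?divr_gt0 // -(absM hK) -(absV hK) -(absM hK).
by rewrite !leNgt l1 l2 !ltNge (ltW l1) (ltW l2).
Qed.

Let radius_inner A : vertex A -> A 1 1 != 0 ->
  radius (ball_of_code p R ((false, A 0 1 / A 1 1),
    (4 * vl (A 1 1) - 2 * vl (\det A) - 1, 2)))
  = abs (\det A) / abs (A 1 1) ^+ 2 * rho.
Proof.
move=> [hA d0] c0; rewrite /ball_of_code [radius _]/= radiusE //; last exact: (Qp_det2 hp hK).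
by rewrite mulrNz mulN1r.
Qed.

Let radius_outer A : vertex A -> A 1 0 != 0 ->
  radius (ball_of_code p R ((true, A 0 0 / A 1 0),
    (4 * vl (A 1 0) - 2 * vl (\det A) + 1, 2)))
  = abs (\det A) / abs (A 1 0) ^+ 2 * rho^-1.
Proof.
move=> [hA d0] c0; rewrite /ball_of_code [radius _]/= radiusE //; last exact: (Qp_det2 hp hK).
by rewrite /rho -powRN opprK mulr1z mul1r.
Qed.

Lemma ball_codeP A : vertex A ->
  [/\ closed_ball abs (ball_of_code p R (ball_code A)) = cdisc A,
      open_ball abs (ball_of_code p R (ball_code A)) = odisc A &
      0 < radius (ball_of_code p R (ball_code A))].
Proof.
move=> vA; have [hA d0] := vA; have r0 := rho_gt0; have P0 := pR_gt0 R hp.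
have ad : 0 < abs (\det A) by rewrite (abs_gt0 hK).
rewrite /ball_code; case: ifPn => [le|].
  have c0 : A 1 1 != 0.
    rewrite -(abs_gt0 hK) lt_def (abs_ge0 hK) andbT; apply: contraNneq d0 => c0.
    move: le; rewrite c0 => le; rewrite -(abs_eq0 hK) eq_le (abs_ge0 hK) andbT.
    have e1 : A 1 1 = 0 by apply/eqP; rewrite -(abs_eq0 hK) c0.
    have e2 : A 1 0 = 0 by apply/eqP; rewrite -(abs_eq0 hK) eq_le le (abs_ge0 hK).
    by rewrite det2E e1 e2 !mulr0 subrr (abs0 hK).
  have ac : 0 < abs (A 1 1) by rewrite (abs_gt0 hK).
  have rcd : rho * abs (A 1 0) < abs (A 1 1).
    apply: le_lt_trans (_ : rho * abs (A 1 1) < _); first by rewrite ler_pM2l.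
    by rewrite gtr_pMl // rho_lt1.
  have eR := radius_inner vA c0.
  have e1 x : pull1 A (Some x) = A 1 1 * (x - A 0 1 / A 1 1).
    by rewrite /pull1 /=; field.
  have e2 x : pull2 A (Some x) = \det A / A 1 1 - A 1 0 * (x - A 0 1 / A 1 1).
    by rewrite /pull2 det2E /=; field.
  have nN : ~ cdisc A None.
    by rewrite /cdisc /= /pull1 /pull2 /= !mulr0 !mulr1 subr0 sub0r (absN hK) leNgt rcd.
  rewrite /closed_ball /open_ball eR [outer _]/= [center _]/=; split.
  - apply/seteqP; split=> [_ [x /= hx <-]|[x|] hx].
    + by rewrite /cdisc /= e1 e2 (disc_eq _ r0 rcd d0).1.
    + by exists x => //; move: hx; rewrite /cdisc /= e1 e2 (disc_eq _ r0 rcd d0).1.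
    + by [].
  - apply/seteqP; split=> [_ [x /= hx <-]|[x|] hx].
    + by rewrite /odisc /= e1 e2 (disc_eq _ r0 rcd d0).2.
    + by exists x => //; move: hx; rewrite /odisc /= e1 e2 (disc_eq _ r0 rcd d0).2.
    + by case: nN; apply: ltW.
  - by rewrite mulr_gt0 // divr_gt0 // exprn_gt0.
rewrite -ltNge => lt.
have c0 : A 1 0 != 0.
  by rewrite -(abs_gt0 hK); apply: le_lt_trans lt; apply: (abs_ge0 hK).
have ac : 0 < abs (A 1 0) by rewrite (abs_gt0 hK).
have rcd : rho^-1 * abs (A 1 1) < abs (A 1 0).
  have := Qp_discrete hp hK (hA 1 1) (hA 1 0) lt.
  have [->|nz] := eqVneq (A 1 1) 0; first by rewrite (abs0 hK) !mulr0.
  apply: lt_le_trans; rewrite ltr_pM2r ?rhoV_ltP //.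
  by rewrite (abs_gt0 hK).
have rcd' : rho^-1 * abs (- A 1 1) < abs (A 1 0) by rewrite (absN hK).
have eR := radius_outer vA c0.
have rV0 : 0 < rho^-1 by rewrite invr_gt0.
have e2 x : pull2 A (Some x) = - (A 1 0 * (x - A 0 0 / A 1 0)).
  by rewrite /pull2 /=; field.
have e1 x : pull1 A (Some x) = \det A / A 1 0 - - A 1 1 * (x - A 0 0 / A 1 0).
  by rewrite /pull1 det2E /=; field.
have N : odisc A None.
  rewrite /odisc /= /pull1 /pull2 /= !mulr0 !mulr1 subr0 sub0r (absN hK).
  by rewrite -(ltr_pM2l rV0) mulKf ?gt_eqF.
have c1 x : cdisc A (Some x) <-> ~~ (abs (x - A 0 0 / A 1 0) < abs (\det A) / abs (A 1 0) ^+ 2 * rho^-1).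
  rewrite -(disc_eq _ rV0 rcd' d0).2 -e1 -(absN hK (A 1 0 * _)) -e2 -leNgt.
  by rewrite -(ler_pM2l r0 (rho^-1 * _)) mulVKf ?gt_eqF.
have o1 x : odisc A (Some x) <-> ~~ (abs (x - A 0 0 / A 1 0) <= abs (\det A) / abs (A 1 0) ^+ 2 * rho^-1).
  rewrite -(disc_eq _ rV0 rcd' d0).1 -e1 -(absN hK (A 1 0 * _)) -e2 -ltNge.
  by rewrite -(ltr_pM2l r0 (rho^-1 * _)) mulVKf ?gt_eqF.
rewrite /closed_ball /open_ball eR [outer _]/= [center _]/=; split.
- apply/seteqP; split=> [[x|] hx|[x|] hx].
  + by apply/c1/negP => h; apply: hx; exists x.
  + exact: ltW.
  + by move=> [y hy [e]]; move/c1/negP: hx; apply; rewrite -e.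
  + by case.
- apply/seteqP; split=> [[x|] hx|[x|] hx].
  + by apply/o1/negP => h; apply: hx; exists x.
  + by [].
  + by move=> [y hy [e]]; move/o1/negP: hx; apply; rewrite -e.
  + by case.
- by rewrite mulr_gt0 // divr_gt0 // exprn_gt0.
Qed.

End Balls.

(** * The good fundamental domain given by the edges *)

Section GoodDomain.
Variables (p : nat) (R : realType) (K : fieldType) (abs : K -> R).
Hypotheses (hp : prime p) (hK : is_Cp abs p).
Variables (n : nat) (s A : 'I_n -> 'M[K]_2).
Hypotheses (vs : forall i, vertex abs (s i)) (vA : forall i, vertex abs (A i)).

Local Notation edge := (edge p s A).

Hypothesis domA : forall u v, u != v -> dom abs (adj2 (edge u) * edge v).

Let us i : s i \in unitmx. Proof. by rewrite unitmx2; case: (vs i). Qed.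
Let A0 i : \det (A i) != 0. Proof. by case: (vA i). Qed.

Lemma vertex_edge u : vertex abs (edge u).
Proof.
rewrite /edge; case: (u.2) => //; apply: (vertexM hp hK).
  by apply: (vertexM hp hK) => //; apply: (vertex_adj hp hK).
split; last by rewrite det_Jmx oppr_eq0 (pK_neq0 hp hK).
by apply: Qp_mx2; try exact: (Qp0 hp hK); [exact: (Qp_nat hp hK)|exact: (Qp1 hp hK)].
Qed.

Lemma edge_good_domain : good_fundamental_domain abs s
  (fun i => ball_of_code p R (ball_code p abs (edge (i, false))))
  (fun i => ball_of_code p R (ball_code p abs (edge (i, true))))
  (~` (\bigcup_(i in [set: 'I_n])
     (open_ball abs (ball_of_code p R (ball_code p abs (edge (i, false)))) `|`
      open_ball abs (ball_of_code p R (ball_code p abs (edge (i, true))))))).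
Proof.
have B u := ball_codeP hp hK (vertex_edge u).
(* Both mapping conditions at once: the complement of an open disc is the closed disc of the
   reversed edge, so this is [edge_inv]. *)
have step u : fractional_linear (letter s u) @`
    (~` open_ball abs (ball_of_code p R (ball_code p abs (edge (inv_letter u)))))
    = closed_ball abs (ball_of_code p R (ball_code p abs (edge u))).
  have [-> _ _] := B u; have [_ -> _] := B (inv_letter u).
  have [c c0 e] := edge_inv hp hK A us u.
  rewrite (odiscC hp hK) (fl_cdisc hK); last by rewrite -unitmx2 letter_unit.
  by rewrite mulrA -e (discZ hK).
split=> //.
- by move=> i; split; [have [] := B (i, false)|have [] := B (i, true)].
- move=> [i b] [j c] _ _.
  have -> : (if (i, b).2 then ball_of_code p R (ball_code p abs (edge ((i, b).1, true)))
      else ball_of_code p R (ball_code p abs (edge ((i, b).1, false)))) =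
      ball_of_code p R (ball_code p abs (edge (i, b))) by case: b.
  have -> : (if (j, c).2 then ball_of_code p R (ball_code p abs (edge ((j, c).1, true)))
      else ball_of_code p R (ball_code p abs (edge ((j, c).1, false)))) =
      ball_of_code p R (ball_code p abs (edge (j, c))) by case: c.
  have [-> _ _] := B (i, b); have [-> _ _] := B (j, c).
  move=> h; apply/eqP; apply: contraPT h => nij.
  rewrite (cdisc_disjoint hp hK) ?domA //; first by move=> [].
    by case: (vertex_edge (i, b)).
  by case: (vertex_edge (j, c)).
- by move=> i; have := step (i, false).
- by move=> i; have := step (i, true).
Qed.

End GoodDomain.

(** * Integral approximation *)

Section Approximation.
Variables (p : nat) (R : realType) (K : fieldType) (abs : K -> R).
Hypotheses (hp : prime p) (hK : is_Cp abs p).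
Implicit Types M X Y : 'M[K]_2.
Local Notation mxnorm := (mxnorm abs).

Definition zmx (z : int * int * int * int) : 'M[K]_2 :=
  mx2 z.1.1.1%:~R z.1.1.2%:~R z.1.2%:~R z.2%:~R.

Lemma finite_lower_bound (T : finType) (f : T -> R) : (forall t, 0 < f t) ->
  exists2 e, 0 < e & forall t, e <= f t.
Proof.
move=> f0; suff [e e0 he] : exists2 e, 0 < e & forall t, t \in enum T -> e <= f t.
  by exists e => // t; apply: he; rewrite mem_enum.
elim: (enum T) => [|t s [e e0 he]]; first by exists 1; rewrite ?ltr01.
exists (Num.min (f t) e); first by rewrite lt_min f0.
move=> u; rewrite inE ge_min => /orP[/eqP ->|/he ->]; first by rewrite lexx.
by rewrite orbT.
Qed.

(** A change of [adj2 X * Y] by less than its largest entry [M 0 1] keeps that entry largest. *)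
Lemma dom_open X Y : \det X != 0 -> \det Y != 0 -> dom abs (adj2 X * Y) ->
  exists2 e, 0 < e & forall X' Y', mxnorm (X' - X) <= e -> mxnorm (Y' - Y) <= e ->
    dom abs (adj2 X' * Y').
Proof.
move=> x0 y0 dM; set M := adj2 X * Y in dM.
have M0 : \det M != 0 by rewrite det2M det_adj2 mulf_neq0.
have b0 : 0 < abs (M 0 1) by apply: lt_le_trans dM; apply: (mxnorm_gt0 hK).
have [NX NY] := (mxnorm_ge0 hK X, mxnorm_ge0 hK Y).
(* C bounds the norm of X and, for changes of size at most 1, that of Y'. The factor 2 below makes
   the final estimate strict. *)
pose C := mxnorm X + mxnorm Y + 1.
have C0 : 0 < C by rewrite /C; lra.
have e0 : 0 < Num.min 1 (abs (M 0 1) / (2 * C)).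
  by rewrite lt_min ltr01 divr_gt0 // mulr_gt0.
exists (Num.min 1 (abs (M 0 1) / (2 * C))) => // X' Y'.
rewrite !le_min => /andP[_ hX] /andP[hY1 hY].
have hC : abs (M 0 1) / (2 * C) * C < abs (M 0 1).
  have -> : abs (M 0 1) / (2 * C) * C = abs (M 0 1) / 2 by field; rewrite gt_eqF.
  by rewrite ltr_pdivrMr // ltr_pMr // ltr1n.
have NY' : mxnorm Y' <= C.
  apply/mxnorm_leP => i j; rewrite -[Y' i j](subrK (Y i j)).
  apply: (absD_le hK).
    have := le_mxnorm abs (Y' - Y) i j; rewrite !add2E opp2E => h.
    by apply: le_trans h _; apply: le_trans hY1 _; rewrite /C; lra.
  by apply: le_trans (le_mxnorm abs Y i j) _; rewrite /C; lra.
have small i j : abs ((adj2 X' * Y') i j - M i j) < abs (M 0 1).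
  have -> : (adj2 X' * Y') i j - M i j =
      (adj2 (X' - X) * Y') i j + (adj2 X * (Y' - Y)) i j.
    rewrite -opp2E -!add2E /M; congr (fun_of_matrix _ i j).
    by apply: mx2_inj; rewrite /adj2 !mxE2; split; ring.
  apply: le_lt_trans hC; apply: (absD_le hK).
    apply: le_trans (le_mxnorm abs _ _ _) _; apply: le_trans (mxnormM hK _ _) _.
    by rewrite (mxnorm_adj hK) ler_pM ?(mxnorm_ge0 hK).
  apply: le_trans (le_mxnorm abs _ _ _) _; apply: le_trans (mxnormM hK _ _) _.
  rewrite (mxnorm_adj hK) mulrC ler_pM ?(mxnorm_ge0 hK) //.
  by rewrite /C; lra.
have e01 : abs ((adj2 X' * Y') 0 1) = abs (M 0 1).
  by rewrite -[(adj2 X' * Y') 0 1](subrK (M 0 1)) (absDr hK).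
rewrite /dom e01; apply/mxnorm_leP => i j.
rewrite -[(adj2 X' * Y') i j](subrK (M i j)); apply: (absD_le hK).
  exact: ltW.
by apply: le_trans dM; apply: le_mxnorm.
Qed.

Lemma det_open X : \det X != 0 ->
  exists2 e, 0 < e & forall X', mxnorm (X' - X) <= e -> \det X' != 0.
Proof.
move=> x0; have d0 : 0 < abs (\det X) by rewrite (abs_gt0 hK).
have NX := mxnorm_ge0 hK X.
pose C := mxnorm X + 1; have C0 : 0 < C by rewrite /C; lra.
exists (Num.min 1 (abs (\det X) / (2 * C))).
  by rewrite lt_min ltr01 divr_gt0 // mulr_gt0.
move=> X'; rewrite le_min => /andP[h1 h2].
have hC : abs (\det X) / (2 * C) * C < abs (\det X).
  have -> : abs (\det X) / (2 * C) * C = abs (\det X) / 2 by field; rewrite gt_eqF.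
  by rewrite ltr_pdivrMr // ltr_pMr // ltr1n.
have de i j : abs (X' i j - X i j) <= abs (\det X) / (2 * C).
  by apply: le_trans h2; have := le_mxnorm abs (X' - X) i j; rewrite !add2E opp2E.
have bX i j : abs (X i j) <= C.
  by apply: le_trans (le_mxnorm abs X i j) _; rewrite /C; lra.
have bX' i j : abs (X' i j) <= C.
  rewrite -[X' i j](subrK (X i j)); apply: (absD_le hK) => //.
  have := le_mxnorm abs (X' - X) i j; rewrite !add2E opp2E => h.
  by apply: le_trans h _; apply: le_trans h1 _; rewrite /C; lra.
have small x y : abs x <= abs (\det X) / (2 * C) -> abs y <= C ->
    abs (x * y) < abs (\det X).
  move=> hx hy; apply: le_lt_trans hC; rewrite (absM hK) ler_pM ?(abs_ge0 hK) //.
rewrite -(abs_gt0 hK) -[\det X'](subrK (\det X)) (absDr hK) //.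
have -> : \det X' - \det X = ((X' 0 0 - X 0 0) * X' 1 1 + (X' 1 1 - X 1 1) * X 0 0)
    - ((X' 0 1 - X 0 1) * X' 1 0 + (X' 1 0 - X 1 0) * X 0 1).
  by rewrite !det2E; ring.
by apply: (absB_lt hK); apply: (absD_lt hK); apply: small.
Qed.

Lemma rational_approx X e : (forall i j, Qp abs (X i j)) -> 0 < e ->
  exists c z, c != 0 /\ mxnorm (c *: zmx z - X) <= e.
Proof.
move=> hX e0.
have h i j := (iffLR (QpP hp hK (X i j)) (hX i j)) e e0.
have [a [a' [a0 ha]]] := h 0 0; have [b [b' [b0 hb]]] := h 0 1.
have [c [c' [c0 hc]]] := h 1 0; have [d [d' [d0 hd]]] := h 1 1.
pose m := a' * b' * c' * d'.
have m0 : m != 0 by rewrite !mulf_neq0.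
exists (m%:~R)^-1, (a * b' * c' * d', a' * b * c' * d', a' * b' * c * d', a' * b' * c' * d).
split; first by rewrite invr_eq0 (intK_eq0 hp hK).
have nz x : x != 0 -> x%:~R != 0 :> K by rewrite (intK_eq0 hp hK).
have := nz _ a0; have := nz _ b0; have := nz _ c0; have := nz _ d0 => nd nc nb na.
apply/mxnorm_leP; apply: ord2P; apply: ord2P; rewrite !mxE2 /m !rmorphM /=; apply: ltW.
- by move: ha; rewrite (absC hK); congr (abs (_ - _) < _); field; rewrite na nb nc nd.
- by move: hb; rewrite (absC hK); congr (abs (_ - _) < _); field; rewrite na nb nc nd.
- by move: hc; rewrite (absC hK); congr (abs (_ - _) < _); field; rewrite na nb nc nd.
- by move: hd; rewrite (absC hK); congr (abs (_ - _) < _); field; rewrite na nb nc nd.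
Qed.

Lemma domZ c d X Y : c != 0 -> d != 0 ->
  dom abs (adj2 (c *: X) * (d *: Y)) = dom abs (adj2 X * Y).
Proof.
move=> c0 d0; rewrite /dom adj2Z mul2Zl mul2Zr scalerA (mxnormZ hK) scale2E (absM hK (c * d)).
by rewrite ler_pM2l // (abs_gt0 hK) mulf_neq0.
Qed.

Lemma edge_approx n (s A : 'I_n -> 'M[K]_2) :
  (forall i, vertex abs (s i)) -> (forall i, vertex abs (A i)) ->
  (forall u v, u != v -> dom abs (adj2 (edge p s A u) * edge p s A v)) ->
  exists z : 'I_n -> int * int * int * int, (forall i, \det (zmx (z i)) != 0) /\
    forall u v, u != v ->
      dom abs (adj2 (edge p s (fun i => zmx (z i)) u) * edge p s (fun i => zmx (z i)) v).
Proof.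
move=> vs vA hd.
have us i : s i \in unitmx by rewrite unitmx2; case: (vs i).
have vE := vertex_edge hp hK vs vA.
have [e e0 he] : exists2 e, 0 < e & forall u v X' Y', u != v ->
    mxnorm (X' - edge p s A u) <= e -> mxnorm (Y' - edge p s A v) <= e ->
    dom abs (adj2 X' * Y').
  have h (uv : ('I_n * bool) * ('I_n * bool)) : exists e, 0 < e /\ forall X' Y', uv.1 != uv.2 ->
      mxnorm (X' - edge p s A uv.1) <= e -> mxnorm (Y' - edge p s A uv.2) <= e ->
      dom abs (adj2 X' * Y').
    case: uv => u v /=; have [<-|nuv] := eqVneq u v; first by exists 1; split.
    have [e e0 he] := dom_open (proj2 (vE u)) (proj2 (vE v)) (hd u v nuv).
    by exists e; split=> // X' Y' _; apply: he.
  have [e e0 he] := finite_lower_bound (fun uv => proj1 (projT2 (cid (h uv)))).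
  exists e => // u v X' Y' nuv h1 h2.
  have := proj2 (projT2 (cid (h (u, v)))) X' Y' nuv.
  by apply; apply: le_trans (he _).
(* In the edge (i, true) the error at [A i] is multiplied by [adj2 (s i)], so it must also be small
   relative to the norm of [s i]; J does not increase it. *)
have h i : exists e', 0 < e' /\ e' <= e /\ mxnorm (s i) * e' <= e /\
    forall X', mxnorm (X' - A i) <= e' -> \det X' != 0.
  have [f f0 hf] := det_open (proj2 (vA i)); have Ns := mxnorm_gt0 hK (proj2 (vs i)).
  exists (Num.min e (Num.min (e / mxnorm (s i)) f)); split.
    by rewrite !lt_min e0 f0 divr_gt0.
  split; first by rewrite ge_min lexx.
  split.
    rewrite mulrC -ler_pdivlMr // !ge_min lexx orbT //.
  by move=> X'; rewrite !le_min => /andP[_ /andP[_]]; apply: hf.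
have h' i : exists z, exists c, c != 0 /\ [/\ mxnorm (c *: zmx z - A i) <= e,
    mxnorm (s i) * mxnorm (c *: zmx z - A i) <= e & \det (zmx z) != 0].
  have [e' [e'0 [le1 [le2 hdet]]]] := h i.
  have [c [z [c0 hz]]] := rational_approx (proj1 (vA i)) e'0.
  exists z, c; split=> //; split.
  - exact: le_trans le1.
  - by apply: le_trans le2; rewrite ler_wpM2l ?(mxnorm_ge0 hK).
  - by have := hdet _ hz; rewrite det2Z mulf_eq0 negb_or => /andP[].
pose z i := projT1 (cid (h' i)); have hz i := projT2 (cid (h' i)).
pose c i := projT1 (cid (hz i)); have hc i := projT2 (cid (hz i)).
exists z; split=> [i|u v nuv]; first by have [_ []] := hc i.
have c0 i : c i != 0 by have [] := hc i.
have eE w : edge p s (fun i => c i *: zmx (z i)) w = c w.1 *: edge p s (fun i => zmx (z i)) w.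
  by rewrite /edge; case: (w.2) => //; rewrite mul2Zr mul2Zl.
rewrite -(domZ _ _ (c0 u.1) (c0 v.1)) -!eE.
have near w : mxnorm (edge p s (fun i => c i *: zmx (z i)) w - edge p s A w) <= e.
  have [_ [n1 n2 _]] := hc w.1.
  rewrite /edge; case: (w.2) => //.
  rewrite -mulrBl -mulrBr; apply: le_trans (mxnormM hK _ _) _.
  have NJ : mxnorm (Jmx p K) <= 1.
    apply/mxnorm_leP; apply: ord2P; apply: ord2P;
      by rewrite mx2E ?(abs0 hK) ?(abs1 hK) ?(abs_nat_le1 hK) ?ler01.
  apply: le_trans (_ : mxnorm (adj2 (s w.1) * (c w.1 *: zmx (z w.1) - A w.1)) * 1 <= _).
    by rewrite ler_wpM2l ?(mxnorm_ge0 hK).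
  by rewrite mulr1; apply: le_trans (mxnormM hK _ _) _; rewrite (mxnorm_adj hK).
exact: (he u v).
Qed.

End Approximation.

(** * Certificates *)

Section Certificates.
Variables (p : nat) (R : realType) (K : fieldType) (abs : K -> R).
Hypotheses (hp : prime p) (hK : is_Cp abs p).
Variables (g : nat) (gamma : 'I_g -> 'M[K]_2).
Hypotheses (ug : forall i, gamma i \in unitmx) (hg : forall i j k, Qp abs (gamma i j k)).
Implicit Types (l : 'I_g * bool) (w : seq ('I_g * bool)).

Let vg i : vertex abs (gamma i). Proof. by split; rewrite -?unitmx2. Qed.

Definition lmx l : 'M[K]_2 := if l.2 then adj2 (gamma l.1) else gamma l.1.

Definition lword w : 'M[K]_2 := foldr (fun l M => lmx l * M) 1 w.

Lemma lword_value w : exists2 c, c != 0 & lword w = c *: word_value gamma w.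
Proof.
elim: w => [|[i b] w [c c0 IH]].
  by exists 1; rewrite ?oner_eq0 // word_value_nil scale1r.
have d0 : \det (gamma i) != 0 by rewrite -unitmx2.
rewrite /= IH word_value_cons /lmx /letter /=; case: b.
  exists (c * \det (gamma i)); first by rewrite mulf_neq0.
  by rewrite invmx2 // mul2Zl scalerA -mulrA mulfV // mulr1 mul2Zr.
by exists c => //; rewrite mul2Zr.
Qed.

Lemma span_lword w : span (range gamma) (lword w).
Proof.
elim: w => [|[i []] w IH]; first exact: span1.
  by apply: span_adjl => //; exists i.
by apply: span_mull => //; exists i.
Qed.

Lemma span_vertex x : span (range gamma) x -> vertex abs x.
Proof.
have v1 : vertex abs 1.
  split; last by rewrite det1 oner_eq0.
  by rewrite one2E; apply: Qp_mx2; (exact: (Qp0 hp hK)) || exact: (Qp1 hp hK).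
elim=> [//|_ y [i _ <-] _ IH|_ y [i _ <-] _ IH]; apply: (vertexM hp hK) => //.
exact: (vertex_adj hp hK).
Qed.

Lemma vertex_lword w : vertex abs (lword w).
Proof. by apply: span_vertex; apply: span_lword. Qed.

Lemma lword_generated w : generated_group gamma (lword w).
Proof. by rewrite spanZ_generated //; apply: spanZ_span; apply: span_lword. Qed.

Lemma reduced_lword x : span (range gamma) x -> exists w c,
  [/\ reduced w, c != 0 & lword w = c *: x].
Proof.
move=> hx; have : generated_group gamma x by rewrite spanZ_generated //; apply: spanZ_span.
move=> [c [w [c0 ->]]]; have [d d0 e] := lword_value (reduce w).
exists (reduce w), (d * c^-1); split; first exact: reduced_reduce.
  by rewrite mulf_neq0 ?invr_eq0.
by rewrite e word_value_reduce // scalerA divfK.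
Qed.

Lemma lword_scalar w : is_scalar_mx (lword w) = is_scalar_mx (word_value gamma w).
Proof. by have [c c0 ->] := lword_value w; rewrite is_scalarZ2. Qed.

Lemma good_certificate_exists :
  Schottky_group abs (generated_group gamma) -> freely_generate gamma ->
  exists (w : 'I_g -> seq ('I_g * bool)) (z : 'I_g -> int * int * int * int),
    [/\ forall i, reduced (w i), forall j, spanZ (range (lword \o w)) (gamma j),
        forall i, \det (zmx K (z i)) != 0 &
        forall u v, u != v -> dom abs (adj2 (edge p (lword \o w) (fun i => zmx K (z i)) u) *
                                       edge p (lword \o w) (fun i => zmx K (z i)) v)].
Proof.
move=> [_ hS] hfree.
have Gh x : span (range gamma) x -> ~ is_scalar_mx x -> abs (\det x) < abs (\tr x) ^+ 2.
  move=> hx nx; apply: (hyperbolic_tr hK); apply: hS => //.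
  by rewrite spanZ_generated //; apply: spanZ_span.
have [D [sD mD]] := separated_max abs (span (range gamma)).
have [n [s [A [hs gen hd]]]] := crossings_basis hp hK span_vertex (@span1 _ _)
  (@span_mul _ _) (@span_adj _ _) Gh sD mD (fun j => span_gen (imageP gamma (I : setT j))).
have us i : s i \in unitmx by rewrite unitmx2; have [/span_vertex []] := hs i.
have A0 i : \det (A i) != 0 by have [_ []] := hs i.
have sfree := pingpong_free hp hK us A0 hd.
have g1 i : generated_group gamma (s i).
  by rewrite spanZ_generated //; apply: spanZ_span; have [] := hs i.
have g2 j : generated_group s (gamma j) by rewrite spanZ_generated.
have eng : n = g.
  by apply/eqP; rewrite eqn_leq (free_rank_le us g1 g2 sfree) (free_rank_le ug g2 g1 hfree).
subst n.
have hw i : exists w, exists c, [/\ reduced w, c != 0 & lword w = c *: s i].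
  by apply: reduced_lword; have [] := hs i.
pose w i := projT1 (cid (hw i)); have hc i := projT2 (cid (hw i)).
pose c i := projT1 (cid (hc i)).
have cP i : [/\ reduced (w i), c i != 0 & lword (w i) = c i *: s i] := projT2 (cid (hc i)).
have c0 i : c i != 0 by have [] := cP i.
have sgen j : spanZ (range (lword \o w)) (gamma j).
  apply: spanZ_trans (gen j) => _ [i _ <-].
  have -> : s i = (c i)^-1 *: lword (w i).
    by have [_ _ ->] := cP i; rewrite scalerA mulVf // scale1r.
  apply: spanZ_scale; first by rewrite invr_eq0.
  by apply: spanZ_span; apply: span_gen; exists i.
have eE A' u : edge p (lword \o w) A' u = (if u.2 then c u.1 else 1) *: edge p s A' u.
  rewrite /edge /=; case: (u.2); last by rewrite scale1r.
  by have [_ _ ->] := cP u.1; rewrite adj2Z !mul2Zl.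
have e0 (u : 'I_g * bool) : (if u.2 then c u.1 else 1) != 0.
  by case: (u.2); rewrite ?oner_eq0.
have hd' u v : u != v -> dom abs (adj2 (edge p (lword \o w) A u) * edge p (lword \o w) A v).
  by move=> nuv; rewrite !eE (domZ hK) // hd.
have [|i|z [z0 hz]] := edge_approx hp hK _ _ hd'.
- by move=> i; apply: vertex_lword.
- by have [] := hs i.
by exists w, z; split=> // i; have [] := cP i.
Qed.

Variables (s A : 'I_g -> 'M[K]_2).
Hypotheses (hs : forall i, span (range gamma) (s i)) (vA : forall i, vertex abs (A i)).
Hypothesis gen : forall j, spanZ (range s) (gamma j).
Hypothesis hd : forall u v, u != v -> dom abs (adj2 (edge p s A u) * edge p s A v).

Let vs i : vertex abs (s i). Proof. exact: span_vertex. Qed.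
Let us i : s i \in unitmx. Proof. by rewrite unitmx2; case: (vs i). Qed.
Let A0 i : \det (A i) != 0. Proof. by case: (vA i). Qed.

Let same_group : generated_group s = generated_group gamma.
Proof.
rewrite !spanZ_generated //; apply/seteqP; split; apply: spanZ_trans => _ [i _ <-] //.
exact: spanZ_span.
Qed.

Lemma good_certificate_free : freely_generate gamma.
Proof.
have g1 i : generated_group gamma (s i).
  by rewrite spanZ_generated //; apply: spanZ_span.
have g2 j : generated_group s (gamma j) by rewrite spanZ_generated.
have fs : freely_generate s := pingpong_free hp hK us A0 hd.
exact: (free_hopf us g1 g2 fs erefl).
Qed.

Lemma good_certificate_sound : outcome_good p abs gamma
  (inl [seq (mx_code (s i), (ball_code p abs (edge p s A (i, false)),
                             ball_code p abs (edge p s A (i, true)))) | i <- enum 'I_g]).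
Proof.
have hdom := edge_good_domain hp hK vs vA hd.
exists s, (fun i => ball_code p abs (edge p s A (i, false))),
  (fun i => ball_code p abs (edge p s A (i, true))).
eexists; split; [by []|exact: us| |exact: hdom|].
  split; [exact: same_group|exact: (pingpong_free hp hK us A0 hd)|].
  by eexists _, _, _; exact: hdom.
split; first by exists g, gamma.
move=> M gM nM.
have hyp : abs (\det M) < abs (\tr M) ^+ 2.
  by apply: (pingpong_hyperbolic hp hK us A0 hd); rewrite ?same_group.
move: gM nM hyp; rewrite spanZ_generated // => -[c [x [c0 hx ->]]] nM hyp.
apply: (hyperbolicZ hK) => //; have [Qx _] := span_vertex hx.
apply: (tr_hyperbolic hp hK) => //.
have ci : c^-1 != 0 by rewrite invr_eq0.
by have := tr_ltZ hK ci hyp; rewrite scalerA mulVf // scale1r.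
Qed.

End Certificates.

(** * Straight-line programs *)

Section Combinators.

Definition ItemTy := Prod Mat (Prod BallTy BallTy).

Definition ite a b (c : prog a Bool) (f h : prog a b) : prog a b :=
  Comp (Fork c (Id a)) (If f h).
Definition on_sum a b c d (e : prog a (Sum b c)) (f : prog (Prod b a) d)
  (h : prog (Prod c a) d) : prog a d := Comp (Fork e (Id a)) (Case f h).
Definition cbool a b : prog a Bool := Comp (ToUnit a) (BoolConst b).
Definition cint a z : prog a Int := Comp (ToUnit a) (IntConst z).
Definition cnil a b : prog a (List b) := Comp (ToUnit a) (Nil b).
Definition cnum a z : prog a Num := Comp (cint a z) NumOfInt.
Definition p1 a b c (e : prog a (Prod b c)) : prog a b := Comp e (Fst b c).
Definition p2 a b c (e : prog a (Prod b c)) : prog a c := Comp e (Snd b c).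
Definition band a (e f : prog a Bool) : prog a Bool := ite e f (cbool a false).
Definition bneg a (e : prog a Bool) : prog a Bool := ite e (cbool a false) (cbool a true).
Definition nadd a (e f : prog a Num) : prog a Num := Comp (Fork e f) NumAdd.
Definition nmul a (e f : prog a Num) : prog a Num := Comp (Fork e f) NumMul.
Definition nopp a (e : prog a Num) : prog a Num := Comp e NumOpp.
Definition ninv a (e : prog a Num) : prog a Num := Comp e NumInv.
Definition neqn a (e f : prog a Num) : prog a Bool := Comp (Fork e f) NumEq.
Definition nval a (e : prog a Num) : prog a Int := Comp e Valuation.
Definition iadd a (e f : prog a Int) : prog a Int := Comp (Fork e f) IntAdd.
Definition imul a (e f : prog a Int) : prog a Int := Comp (Fork e f) IntMul.
Definition ile a (e f : prog a Int) : prog a Bool := Comp (Fork e f) IntLe.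
Definition lcons a b (e : prog a b) (f : prog a (List b)) : prog a (List b) :=
  Comp (Fork e f) (Cons b).

(** [Valuation] fails at 0, so zeros are treated first. Larger valuations mean smaller absolute
    values, whence the order of the last comparison. *)
Definition nabsle a (e f : prog a Num) : prog a Bool :=
  ite (neqn e (cnum a 0)) (cbool a true)
    (ite (neqn f (cnum a 0)) (cbool a false) (ile (nval f) (nval e))).

Fixpoint onthP a (k : nat) : prog (List a) (Sum Unit a) :=
  on_sum (Uncons a) (Comp (ToUnit _) (Inl Unit a))
    (if k is k'.+1 then Comp (p2 (p1 (Id _))) (onthP a k')
     else Comp (p1 (p1 (Id _))) (Inr Unit a)).

Fixpoint allP2 a b (fuel : nat) (c : prog (Prod a b) Bool) : prog (Prod a (List b)) Bool :=
  on_sum (Comp (p2 (Id _)) (Uncons b)) (cbool _ true)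
    (if fuel is f.+1 then
       band (Comp (Fork (p1 (p2 (Id _))) (p1 (p1 (Id _)))) c)
            (Comp (Fork (p1 (p2 (Id _))) (p2 (p1 (Id _)))) (allP2 f c))
     else cbool _ false).

Definition m00 a (e : prog a Mat) : prog a Num := p1 (p1 e).
Definition m01 a (e : prog a Mat) : prog a Num := p2 (p1 e).
Definition m10 a (e : prog a Mat) : prog a Num := p1 (p2 e).
Definition m11 a (e : prog a Mat) : prog a Num := p2 (p2 e).
Definition mk4 a (e00 e01 e10 e11 : prog a Num) : prog a Mat :=
  Fork (Fork e00 e01) (Fork e10 e11).

Definition mulP : prog (Prod Mat Mat) Mat :=
  let X := p1 (Id _) in let Y := p2 (Id _) in
  mk4 (nadd (nmul (m00 X) (m00 Y)) (nmul (m01 X) (m10 Y)))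
      (nadd (nmul (m00 X) (m01 Y)) (nmul (m01 X) (m11 Y)))
      (nadd (nmul (m10 X) (m00 Y)) (nmul (m11 X) (m10 Y)))
      (nadd (nmul (m10 X) (m01 Y)) (nmul (m11 X) (m11 Y))).
Definition addP : prog (Prod Mat Mat) Mat :=
  let X := p1 (Id _) in let Y := p2 (Id _) in
  mk4 (nadd (m00 X) (m00 Y)) (nadd (m01 X) (m01 Y))
      (nadd (m10 X) (m10 Y)) (nadd (m11 X) (m11 Y)).
Definition adjP : prog Mat Mat :=
  let X := Id Mat in mk4 (m11 X) (nopp (m01 X)) (nopp (m10 X)) (m00 X).
Definition detP : prog Mat Num :=
  let X := Id Mat in
  nadd (nmul (m00 X) (m11 X)) (nopp (nmul (m01 X) (m10 X))).
Definition trP : prog Mat Num := let X := Id Mat in nadd (m00 X) (m11 X).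
Definition scalP : prog Mat Bool :=
  let X := Id Mat in
  band (neqn (m01 X) (cnum _ 0)) (band (neqn (m10 X) (cnum _ 0)) (neqn (m00 X) (m11 X))).
Definition domP : prog Mat Bool :=
  let X := Id Mat in
  band (nabsle (m00 X) (m01 X)) (band (nabsle (m10 X) (m01 X)) (nabsle (m11 X) (m01 X))).
Definition cmat a (z : int * int * int * int) : prog a Mat :=
  mk4 (cnum a z.1.1.1) (cnum a z.1.1.2) (cnum a z.1.2) (cnum a z.2).
Definition mmul a (e f : prog a Mat) : prog a Mat := Comp (Fork e f) mulP.
Definition madj a (e : prog a Mat) : prog a Mat := Comp e adjP.
Definition adjmul a (e f : prog a Mat) : prog a Mat := mmul (madj e) f.

Definition ballP : prog Mat BallTy :=
  let X := Id Mat in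
  let rad e z := Fork (iadd (iadd (imul (cint _ 4) (nval e))
      (Comp (imul (cint _ 2) (nval detP)) IntOpp)) (cint _ z)) (cint _ 2) in
  ite (nabsle (m10 X) (m11 X))
    (Fork (Fork (cbool _ false) (nmul (m01 X) (ninv (m11 X)))) (rad (m11 X) (- 1)))
    (Fork (Fork (cbool _ true) (nmul (m00 X) (ninv (m10 X)))) (rad (m10 X) 1)).

End Combinators.

(** * Results of programs without loops *)

Section Yields.
Variables (p : nat) (R : realType) (K : fieldType) (abs : K -> R).
Hypotheses (hp : prime p) (hK : is_Cp abs p).
Implicit Types M N : 'M[K]_2.
Local Notation D := (den K).
Local Notation Qmx M := (forall i j, Qp abs (M i j)).

(* For programs without loops the bound on the number of rounds is irrelevant. *)
Definition yields a b (P : prog a b) (x : D a) (y : D b) :=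
  forall n, run p abs n P x = Some y.

Lemma y_id a x : yields (Id a) x x. Proof. by []. Qed.
Lemma y_comp a b c (f : prog a b) (h : prog b c) x y z :
  yields f x y -> yields h y z -> yields (Comp f h) x z.
Proof. by move=> e1 e2 n /=; rewrite e1 /= e2. Qed.
Lemma y_fork a b c (f : prog a b) (h : prog a c) x y z :
  yields f x y -> yields h x z -> yields (Fork f h) x (y, z).
Proof. by move=> e1 e2 n /=; rewrite e1 /= e2. Qed.
Lemma y_p1 a b c (e : prog a (Prod b c)) x (y : D (Prod b c)) :
  yields e x y -> yields (p1 e) x y.1.
Proof. by move=> h; apply: y_comp h _. Qed.
Lemma y_p2 a b c (e : prog a (Prod b c)) x (y : D (Prod b c)) :
  yields e x y -> yields (p2 e) x y.2.
Proof. by move=> h; apply: y_comp h _. Qed.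
Lemma y_ite a b (c : prog a Bool) (f h : prog a b) x (v : bool) y :
  yields c x v -> (v -> yields f x y) -> (~~ v -> yields h x y) -> yields (ite c f h) x y.
Proof.
move=> hc hf hh; apply: y_comp (y_fork hc (y_id x)) _ => n /=.
by case: v {hc} hf hh => hf hh; [apply: hf|apply: hh].
Qed.
Lemma y_num a z x : yields (cnum a z) x (z%:~R : K). Proof. by []. Qed.
Lemma y_band a (e f : prog a Bool) x (u v : bool) :
  yields e x u -> yields f x v -> yields (band e f) x (u && v).
Proof. by move=> he hf; apply: (y_ite he) => [->|/negbTE ->]. Qed.
Lemma y_bneg a (e : prog a Bool) x (u : bool) :
  yields e x u -> yields (bneg e) x (~~ u).
Proof. by move=> he; apply: (y_ite he) => [->|->]. Qed.
Lemma y_nmul a (e f : prog a Num) x (u v : K) :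
  yields e x u -> yields f x v -> yields (nmul e f) x (u * v).
Proof. by move=> he hf; apply: y_comp (y_fork he hf) _. Qed.
Lemma y_ninv a (e : prog a Num) x (u : K) : yields e x u -> u != 0 -> yields (ninv e) x u^-1.
Proof. by move=> he u0; apply: y_comp he _ => n /=; rewrite (negbTE u0). Qed.
Lemma y_neqn a (e f : prog a Num) x (u v : K) :
  yields e x u -> yields f x v -> yields (neqn e f) x (u == v).
Proof. by move=> he hf; apply: y_comp (y_fork he hf) _. Qed.
Lemma y_nval a (e : prog a Num) x (u : K) :
  yields e x u -> Qp abs u -> u != 0 -> yields (nval e) x (vl p abs u).
Proof. by move=> he hu u0; apply: y_comp he _ => n /=; have [-> _] := vlP hp hK hu u0. Qed.
Lemma y_iadd a (e f : prog a Int) x (u v : int) :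
  yields e x u -> yields f x v -> yields (iadd e f) x (u + v).
Proof. by move=> he hf; apply: y_comp (y_fork he hf) _. Qed.
Lemma y_imul a (e f : prog a Int) x (u v : int) :
  yields e x u -> yields f x v -> yields (imul e f) x (u * v).
Proof. by move=> he hf; apply: y_comp (y_fork he hf) _. Qed.
Lemma y_iopp a (e : prog a Int) x (u : int) :
  yields e x u -> yields (Comp e IntOpp) x (- u).
Proof. by move=> he; apply: y_comp he _. Qed.
Lemma y_ile a (e f : prog a Int) x (u v : int) :
  yields e x u -> yields f x v -> yields (ile e f) x (u <= v).
Proof. by move=> he hf; apply: y_comp (y_fork he hf) _. Qed.
Lemma y_lcons a b (e : prog a b) (f : prog a (List b)) x u v :
  yields e x u -> yields f x v -> yields (lcons e f) x (u :: v : D (List b)).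
Proof. by move=> he hf; apply: y_comp (y_fork he hf) _. Qed.
Lemma y_inl a b c (e : prog a b) x u : yields e x u ->
  yields (Comp e (Inl b c)) x (inl u : D (Sum b c)).
Proof. by move=> he; apply: y_comp he _. Qed.
Lemma y_inr a b c (e : prog a c) x u : yields e x u ->
  yields (Comp e (Inr b c)) x (inr u : D (Sum b c)).
Proof. by move=> he; apply: y_comp he _. Qed.

Lemma y_on_inl a b c d (e : prog a (Sum b c)) (f : prog (Prod b a) d)
    (h : prog (Prod c a) d) x y z :
  yields e x (inl y) -> yields f (y, x) z -> yields (on_sum e f h) x z.
Proof. by move=> he hf; apply: y_comp (y_fork he (y_id x)) _ => n /=; rewrite hf. Qed.
Lemma y_on_inr a b c d (e : prog a (Sum b c)) (f : prog (Prod b a) d)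
    (h : prog (Prod c a) d) x y z :
  yields e x (inr y) -> yields h (y, x) z -> yields (on_sum e f h) x z.
Proof. by move=> he hf; apply: y_comp (y_fork he (y_id x)) _ => n /=; rewrite hf. Qed.

Lemma y_uncons_nil a b (e : prog a (List b)) x :
  yields e x [::] -> yields (Comp e (Uncons b)) x (inl tt : D (Sum Unit (Prod b (List b)))).
Proof. by move=> he; apply: y_comp he _. Qed.
Lemma y_uncons_cons a b (e : prog a (List b)) x u v :
  yields e x (u :: v) ->
  yields (Comp e (Uncons b)) x (inr (u, v) : D (Sum Unit (Prod b (List b)))).
Proof. by move=> he; apply: y_comp he _. Qed.

Lemma y_nabsle a (e f : prog a Num) x (u v : K) :
  yields e x u -> yields f x v -> Qp abs u -> Qp abs v ->
  yields (nabsle e f) x (abs u <= abs v).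
Proof.
move=> he hf hu hv.
have z := y_num 0 x; rewrite mulr0z in z.
apply: (y_ite (y_neqn he z)) => [/eqP ->|u0].
  by rewrite (abs0 hK) (abs_ge0 hK).
apply: (y_ite (y_neqn hf z)) => [/eqP ->|v0].
  by rewrite (abs0 hK) leNgt (abs_gt0 hK) u0.
have -> : (abs u <= abs v) = (vl p abs v <= vl p abs u).
  have [_ ->] := vlP hp hK hu u0; have [_ ->] := vlP hp hK hv v0.
  by rewrite ler_eXz2l ?(pR_gt1 R hp) // lerN2.
by apply: y_ile; apply: y_nval.
Qed.

Lemma y_onth a k (l : D (List a)) : yields (onthP a k) l
  (if onth l k is Some y then inr y else inl tt : D (Sum Unit a)).
Proof.
have e y' l' : yields (Uncons a) (y' :: l' : D (List a))
    (inr (y', l') : D (Sum Unit (Prod a (List a)))) by [].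
have e0 : yields (Uncons a) ([::] : D (List a)) (inl tt : D (Sum Unit (Prod a (List a)))) by [].
elim: k l => [|k IH] [|y l] /=; try by apply: (y_on_inl _ e0) => n.
  by apply: (y_on_inr _ (e y l)) => n.
apply: (y_on_inr _ (e y l)); apply: y_comp (IH l).
exact: (y_p2 (y_p1 (y_id _))).
Qed.

Lemma y_all a b (T : eqType) (cd : T -> D b) fuel (c : prog (Prod a b) Bool)
    (t : T -> bool) x (l : seq T) :
  {in l, forall y, yields c (x, cd y) (t y)} ->
  yields (allP2 fuel c) (x, map cd l) ((size l <= fuel)%N && all t l).
Proof.
have e y' l' : yields (Comp (p2 (Id _)) (Uncons b)) ((x, y' :: l') : D (Prod a (List b)))
    (inr (y', l') : D (Sum Unit (Prod b (List b)))) by [].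
have e0 : yields (Comp (p2 (Id _)) (Uncons b)) ((x, [::]) : D (Prod a (List b)))
    (inl tt : D (Sum Unit (Prod b (List b)))) by [].
elim: fuel l => [|fuel IH] [|y l] h /=; try by apply: (y_on_inl _ e0) => n.
  by apply: (y_on_inr _ (e (cd y) (map cd l))) => n.
apply: (y_on_inr _ (e (cd y) (map cd l))); rewrite ltnS andbCA.
apply: y_band; first by apply: y_comp (h y (mem_head _ _)).
by apply: y_comp (IH l _) => // z zl; apply: h; rewrite inE zl orbT.
Qed.

Lemma y_m00 a (e : prog a Mat) x M : yields e x (mx_code M) -> yields (m00 e) x (M 0 0).
Proof. by move=> h; apply: y_p1 (y_p1 h). Qed.
Lemma y_m01 a (e : prog a Mat) x M : yields e x (mx_code M) -> yields (m01 e) x (M 0 1).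
Proof. by move=> h; apply: y_p2 (y_p1 h). Qed.
Lemma y_m10 a (e : prog a Mat) x M : yields e x (mx_code M) -> yields (m10 e) x (M 1 0).
Proof. by move=> h; apply: y_p1 (y_p2 h). Qed.
Lemma y_m11 a (e : prog a Mat) x M : yields e x (mx_code M) -> yields (m11 e) x (M 1 1).
Proof. by move=> h; apply: y_p2 (y_p2 h). Qed.

Lemma y_mk4 a (e1 e2 e3 e4 : prog a Num) x (b c d e : K) : yields e1 x b -> yields e2 x c ->
  yields e3 x d -> yields e4 x e -> yields (mk4 e1 e2 e3 e4) x (mx_code (mx2 b c d e)).
Proof.
by move=> h1 h2 h3 h4; rewrite /mx_code !mx2E; apply: (y_fork (y_fork h1 h2) (y_fork h3 h4)).
Qed.

Lemma y_cmat a z x : yields (cmat a z) x (mx_code (zmx K z)).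
Proof. by apply: y_mk4; apply: y_num. Qed.

Lemma y_mmul a (e f : prog a Mat) x M N :
  yields e x (mx_code M) -> yields f x (mx_code N) -> yields (mmul e f) x (mx_code (M * N)).
Proof.
move=> he hf; apply: y_comp (y_fork he hf) _ => n /=.
by rewrite /mx_code !mul2E.
Qed.

Lemma y_addP M N : yields addP (mx_code M, mx_code N) (mx_code (M + N)).
Proof. by move=> n /=; rewrite /mx_code !add2E. Qed.

Lemma y_madj a (e : prog a Mat) x M :
  yields e x (mx_code M) -> yields (madj e) x (mx_code (adj2 M)).
Proof. by move=> he; apply: y_comp he _ => n /=; rewrite /mx_code /adj2 !mx2E. Qed.

Lemma y_adjmul a (e f : prog a Mat) x M N :
  yields e x (mx_code M) -> yields f x (mx_code N) ->
  yields (adjmul e f) x (mx_code (adj2 M * N)).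
Proof. by move=> he hf; apply: y_mmul => //; apply: y_madj. Qed.

Lemma y_det M : yields detP (mx_code M) (\det M).
Proof. by move=> n /=; rewrite det2E. Qed.

Lemma y_tr M : yields trP (mx_code M) (\tr M).
Proof. by move=> n /=; rewrite tr2E. Qed.

Lemma y_scal M : yields scalP (mx_code M) (is_scalar_mx M : bool).
Proof.
rewrite is_scalar2E; have h := y_id (mx_code M : D Mat).
have z := y_num 0 (mx_code M : D Mat).
apply: y_band; first exact: (y_neqn (y_m01 h) z).
apply: y_band; first exact: (y_neqn (y_m10 h) z).
exact: (y_neqn (y_m00 h) (y_m11 h)).
Qed.

Lemma y_dom M : Qmx M -> yields domP (mx_code M) (dom abs M : bool).
Proof.
move=> hM; have h := y_id (mx_code M : D Mat).
have -> : dom abs M = [&& abs (M 0 0) <= abs (M 0 1), abs (M 1 0) <= abs (M 0 1) &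
    abs (M 1 1) <= abs (M 0 1)].
  by rewrite /dom /mxnorm !ge_max lexx andbT.
apply: y_band; first by apply: y_nabsle.
apply: y_band; first by apply: y_nabsle.
by apply: y_nabsle.
Qed.

Lemma y_ball M : vertex abs M -> yields ballP (mx_code M) (ball_code p abs M).
Proof.
move=> [hM d0]; have h := y_id (mx_code M : D Mat).
rewrite /ball_code; case E: (abs (M 1 0) <= abs (M 1 1)).
  have c0 : M 1 1 != 0.
    apply: contraTneq E => c0; rewrite c0 (abs0 hK) -ltNge (abs_gt0 hK).
    by apply: contraNneq d0 => e; rewrite det2E c0 e !mulr0 subrr.
  apply: (y_ite (y_nabsle (y_m10 h) (y_m11 h) (hM _ _) (hM _ _))); rewrite E => // _.
  apply: y_fork.
    by apply: y_fork => //; apply: y_nmul; [exact: y_m01|apply: y_ninv => //; exact: y_m11].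
  apply: y_fork => //; apply: y_iadd => //; apply: y_iadd.
    by apply: y_imul => //; apply: y_nval => //; exact: y_m11.
  apply: y_iopp; apply: y_imul => //; apply: y_nval => //; first exact: y_det.
  exact: (Qp_det2 hp hK).
have c0 : M 1 0 != 0.
  by apply: contraFneq E => c0; rewrite c0 (abs0 hK) (abs_ge0 hK).
apply: (y_ite (y_nabsle (y_m10 h) (y_m11 h) (hM _ _) (hM _ _))); rewrite E => // _.
apply: y_fork.
  by apply: y_fork => //; apply: y_nmul; [exact: y_m00|apply: y_ninv => //; exact: y_m10].
apply: y_fork => //; apply: y_iadd => //; apply: y_iadd.
  by apply: y_imul => //; apply: y_nval => //; exact: y_m10.
apply: y_iopp; apply: y_imul => //; apply: y_nval => //; first exact: y_det.
exact: (Qp_det2 hp hK).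
Qed.

End Yields.

(** * The search *)

Section Machine.
Variables (p g : nat).

(** The machine form of the record [state]. The input, the matrix of the current word and the edges
    of the items are carried along so as not to be recomputed. *)
Definition StTy : ty :=
  Prod (List Mat) (Prod (Prod (List LetterTy) Mat)
    (Prod Mat (Prod (Prod (List ItemTy) (List (Prod Mat Mat))) (Prod Mat (List Mat))))).

Section Accessors.
Variables (a : ty) (e : prog a StTy).
Definition sgl := p1 e.
Definition swd := p1 (p1 (p2 e)).
Definition smx := p2 (p1 (p2 e)).
Definition szz := p1 (p2 (p2 e)).
Definition sit := p1 (p1 (p2 (p2 (p2 e)))).
Definition sed := p2 (p1 (p2 (p2 (p2 e)))).
Definition shh := p1 (p2 (p2 (p2 (p2 e)))).
Definition srm := p2 (p2 (p2 (p2 (p2 e)))).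
End Accessors.

Definition mkst a (gl : prog a (List Mat)) wd mx zz it ed hh (rm : prog a (List Mat)) :
    prog a StTy :=
  Fork gl (Fork (Fork wd mx) (Fork zz (Fork (Fork it ed) (Fork hh rm)))).

(** The finitely many moves of the search: prepend a letter, change the integral matrix, turn word
    and matrix into an item, multiply the current product, strike off a recognized generator. A move
    that is not possible leaves the state as it is. *)
Inductive op :=
| OLetter of 'I_g & bool
| OAdd of int * int * int * int
| OPush
| OMul of 'I_g & bool
| OVerify.

Definition prepend_letter a (i : 'I_g) (b : bool) (e : prog a StTy) : prog a StTy :=
  on_sum (Comp (sgl e) (onthP Mat i)) (Comp (Snd _ _) e)
    (let st := Comp (Snd _ _) e in let y := Fst _ _ in
     mkst (sgl st) (lcons (Fork (cint _ i) (cbool _ b)) (swd st))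
       (mmul (if b then madj y else y) (smx st)) (szz st) (sit st) (sed st) (shh st) (srm st)).

(** A letter that would cancel is refused, so that words stay reduced. Equality of indices is tested
    by two comparisons. *)
Definition letterP (i : 'I_g) (b : bool) : prog StTy StTy :=
  on_sum (Comp (swd (Id _)) (Uncons _)) (prepend_letter i b (Snd _ _))
    (let hd := p1 (Fst _ _) in
     ite (band (ile (p1 hd) (cint _ i)) (band (ile (cint _ i) (p1 hd))
            (if b then bneg (p2 hd) else p2 hd)))
       (Snd _ _) (prepend_letter i b (Snd _ _))).

Definition oaddP z : prog StTy StTy :=
  let st := Id StTy in
  mkst (sgl st) (swd st) (smx st) (Comp (Fork (szz st) (cmat _ z)) addP)
    (sit st) (sed st) (shh st) (srm st).

Definition compatP : prog (Prod (Prod Mat Mat) (Prod Mat Mat)) Bool :=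
  let X := p1 (p1 (Id _)) in let X' := p2 (p1 (Id _)) in
  let Y := p1 (p2 (Id _)) in let Y' := p2 (p2 (Id _)) in
  band (Comp (adjmul X Y) domP) (band (Comp (adjmul X Y') domP)
    (band (Comp (adjmul X' Y) domP) (Comp (adjmul X' Y') domP))).

Definition revP : prog StTy Mat :=
  mmul (adjmul (smx (Id _)) (szz (Id _))) (cmat _ (0, p%:Z, 1, 0)).

Definition pushP : prog StTy StTy :=
  let st := Id StTy in
  ite (band (bneg (neqn (Comp (szz st) detP) (cnum _ 0)))
        (band (Comp (adjmul (szz st) revP) domP)
           (Comp (Fork (Fork (szz st) revP) (sed st)) (allP2 g.-1 compatP))))
    (mkst (sgl st) (cnil _ _) (cmat _ (1, 0, 0, 1)) (cmat _ (0, 0, 0, 0))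
       (lcons (Fork (smx st) (Fork (Comp (szz st) ballP) (Comp revP ballP))) (sit st))
       (lcons (Fork (szz st) revP) (sed st)) (shh st) (srm st))
    st.

Definition omulP (i : 'I_g) (b : bool) : prog StTy StTy :=
  on_sum (Comp (sit (Id _)) (onthP _ i)) (Snd _ _)
    (let st := Snd _ _ in let y := p1 (Fst _ _) in
     mkst (sgl st) (swd st) (smx st) (szz st) (sit st) (sed st)
       (mmul (if b then madj y else y) (shh st)) (srm st)).

Definition verifyP : prog StTy StTy :=
  on_sum (Comp (srm (Id _)) (Uncons _)) (Snd _ _)
    (let st := Snd _ _ in
     ite (Comp (adjmul (shh st) (p1 (Fst _ _))) scalP)
       (mkst (sgl st) (swd st) (smx st) (szz st) (sit st) (sed st)
         (cmat _ (1, 0, 0, 1)) (p2 (Fst _ _)))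
       st).

Definition opP (o : op) : prog StTy StTy :=
  match o with
  | OLetter i b => letterP i b
  | OAdd z => oaddP z
  | OPush => pushP
  | OMul i b => omulP i b
  | OVerify => verifyP
  end.

Definition pass a : prog a (Sum Unit OutputTy) := Comp (ToUnit a) (Inl Unit OutputTy).

(** There are never more than g items, so an item at position g - 1 shows that there are exactly
    g. *)
Definition goodP : prog StTy (Sum Unit OutputTy) :=
  on_sum (Comp (srm (Id _)) (Uncons _))
    (on_sum (Comp (sit (Snd _ _)) (onthP _ g.-1)) (pass _)
       (Comp (Comp (sit (p2 (Snd _ _))) (Inl _ _)) (Inr Unit OutputTy)))
    (pass _).

Definition checkP : prog StTy (Sum Unit OutputTy) :=
  on_sum (Comp (swd (Id _)) (Uncons _)) (Comp (Snd _ _) goodP)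
    (let st := Snd _ _ in
     ite (Comp (smx st) scalP)
       (Comp (Comp (Comp (swd st) (Inl _ Mat)) (Inr _ _)) (Inr Unit OutputTy))
       (ite (nabsle (nmul (Comp (smx st) trP) (Comp (smx st) trP)) (Comp (smx st) detP))
          (Comp (Comp (Comp (smx st) (Inr _ _)) (Inr _ _)) (Inr Unit OutputTy))
          (Comp st goodP))).

Fixpoint childrenP (os : seq op) : prog (Prod StTy (List StTy)) (List StTy) :=
  if os is o :: os' then lcons (Comp (Fst _ _) (opP o)) (childrenP os') else Snd _ _.

(** Breadth-first search: the first list is the rest of the current level, the second collects the
    next level and takes over when the first is exhausted. *)
Definition stepP (os : seq op) :
    prog (Prod (List StTy) (List StTy)) (Sum (Prod (List StTy) (List StTy)) OutputTy) :=
  on_sum (Comp (Fst _ _) (Uncons _))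
    (Comp (Fork (p2 (Snd _ _)) (cnil _ _)) (Inl _ _))
    (on_sum (Comp (p1 (Fst _ _)) checkP)
       (Comp (Fork (p2 (p1 (Snd _ _)))
                (Comp (Fork (p1 (p1 (Snd _ _))) (p2 (p2 (Snd _ _)))) (childrenP os)))
          (Inl _ _))
       (Comp (Fst _ _) (Inr _ _))).

Definition initP : prog InputTy (Prod (List StTy) (List StTy)) :=
  Fork (lcons (mkst (Id _) (cnil _ _) (cmat _ (1, 0, 0, 1)) (cmat _ (0, 0, 0, 0))
         (cnil _ _) (cnil _ _) (cmat _ (1, 0, 0, 1)) (Id _)) (cnil _ _)) (cnil _ _).

Definition searchP (os : seq op) : prog InputTy OutputTy := Comp initP (Loop (stepP os)).

End Machine.

(** * The states behind the machine data, their invariant and the effect of the moves *)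

Section Semantics.
Variables (p : nat) (R : realType) (K : fieldType) (abs : K -> R).
Hypotheses (hp : prime p) (hK : is_Cp abs p).
Variables (g : nat) (gamma : 'I_g -> 'M[K]_2).
Hypotheses (hg0 : (0 < g)%N) (ug : forall i, gamma i \in unitmx).
Hypothesis hgQ : forall i j k, Qp abs (gamma i j k).

Local Notation D := (den K).
Local Notation yields := (yields p abs).
Local Notation lword := (lword gamma).
Local Notation lmx := (lmx gamma).
Local Notation St := (D StTy).
Local Notation letter_code := (letter_code K).

(* The current word, the current integral matrix, the pairs (a_i, A_i) collected
   so far, a current product of the a_i and their inverses, and the gamma_j that
   have not yet been recognized as such a product. *)
Record state := State {
  wd : seq ('I_g * bool);
  zz : int * int * int * int;
  items : seq ('M[K]_2 * 'M[K]_2);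
  hh : 'M[K]_2;
  rem : seq 'M[K]_2 }.

Definition rev_edge (it : 'M[K]_2 * 'M[K]_2) : 'M[K]_2 := adj2 it.1 * it.2 * Jmx p K.

Definition item_code it : D ItemTy :=
  (mx_code it.1, (ball_code p abs it.2, ball_code p abs (rev_edge it))).
Definition pair_code it : D (Prod Mat Mat) := (mx_code it.2, mx_code (rev_edge it)).

Definition code (s : state) : St :=
  (input_code gamma,
   (([seq letter_code l | l <- wd s], mx_code (lword (wd s))),
    (mx_code (zmx K (zz s)),
     (([seq item_code it | it <- items s], [seq pair_code it | it <- items s]),
      (mx_code (hh s), [seq mx_code x | x <- rem s]))))).

Definition compat (it it' : 'M[K]_2 * 'M[K]_2) : bool :=
  [&& dom abs (adj2 it.2 * it'.2), dom abs (adj2 it.2 * rev_edge it'),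
      dom abs (adj2 (rev_edge it) * it'.2) & dom abs (adj2 (rev_edge it) * rev_edge it')].

Definition cur_item s := (lword (wd s), zmx K (zz s)).

Definition pushable s : bool :=
  [&& \det (zmx K (zz s)) != 0, dom abs (adj2 (zmx K (zz s)) * rev_edge (cur_item s)),
      (size (items s) <= g.-1)%N & all (compat (cur_item s)) (items s)].

Definition zadd (z z' : int * int * int * int) : int * int * int * int :=
  (z.1.1.1 + z'.1.1.1, z.1.1.2 + z'.1.1.2, z.1.2 + z'.1.2, z.2 + z'.2).

Definition opf (o : op g) (s : state) : state :=
  match o with
  | OLetter i b =>
      if (if wd s is m :: _ then m == inv_letter (i, b) else false) then s
      else State ((i, b) :: wd s) (zz s) (items s) (hh s) (rem s)
  | OAdd z => State (wd s) (zadd (zz s) z) (items s) (hh s) (rem s)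
  | OPush => if pushable s
             then State [::] (0, 0, 0, 0) (cur_item s :: items s) (hh s) (rem s) else s
  | OMul i b =>
      if onth (items s) i is Some it
      then State (wd s) (zz s) (items s) ((if b then adj2 it.1 else it.1) * hh s) (rem s)
      else s
  | OVerify =>
      if rem s is y :: rem'
      then if is_scalar_mx (adj2 (hh s) * y)
           then State (wd s) (zz s) (items s) 1 rem' else s
      else s
  end.

Definition firsts (l : seq ('M[K]_2 * 'M[K]_2)) : set 'M[K]_2 :=
  [set x | exists2 it, it \in l & x = it.1].

(** The invariant behind soundness. The two edges of one item are compared in [valid_items], those
    of different items in [valid_compat]; by [valid_done], a generator struck off the list lies in
    the group generated by the items. *)
Record valid (s : state) : Prop := {
  valid_wd : reduced (wd s);
  valid_items : forall it, it \in items s ->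
    [/\ span (range gamma) it.1, exists z, it.2 = zmx K z, \det it.2 != 0 &
        dom abs (adj2 it.2 * rev_edge it)];
  valid_compat : pairwise compat (items s);
  valid_size : (size (items s) <= g)%N;
  valid_hh : span (firsts (items s)) (hh s);
  valid_rem : forall y, y \in rem s -> range gamma y;
  valid_done : forall j, gamma j \in rem s \/ spanZ (firsts (items s)) (gamma j) }.

Let Qzmx z : forall i j, Qp abs (zmx K z i j).
Proof. by apply: Qp_mx2; apply: (Qp_int hp hK). Qed.

Let QJ : forall i j, Qp abs (Jmx p K i j).
Proof.
by apply: Qp_mx2; try exact: (Qp0 hp hK); [exact: (Qp_nat hp hK)|exact: (Qp1 hp hK)].
Qed.

Let Qrev (it : 'M[K]_2 * 'M[K]_2) : (forall i j, Qp abs (it.1 i j)) -> (forall i j, Qp abs (it.2 i j)) ->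
  forall i j, Qp abs (rev_edge it i j).
Proof.
move=> h1 h2; apply: (Qp_mul2 hp hK) => //; apply: (Qp_mul2 hp hK) => //.
exact: (Qp_adj2 hp hK).
Qed.

Let Qadjmul (M N : 'M[K]_2) : (forall i j, Qp abs (M i j)) -> (forall i j, Qp abs (N i j)) ->
  forall i j, Qp abs ((adj2 M * N) i j).
Proof. by move=> h1 h2; apply: (Qp_mul2 hp hK) => //; apply: (Qp_adj2 hp hK). Qed.

Let Qlword w : forall i j, Qp abs (lword w i j).
Proof. by case: (vertex_lword hp hK ug hgQ w). Qed.

Let Qcur s : (forall i j, Qp abs ((cur_item s).2 i j)) /\
  (forall i j, Qp abs (rev_edge (cur_item s) i j)).
Proof. by split; [exact: Qzmx|apply: Qrev; [exact: Qlword|exact: Qzmx]]. Qed.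

Let Qitem s it : valid s -> it \in items s ->
  (forall i j, Qp abs (it.2 i j)) /\ (forall i j, Qp abs (rev_edge it i j)).
Proof.
move=> vs /(valid_items vs)[h1 [z ez] _ _].
have q2 : forall i j, Qp abs (it.2 i j) by rewrite ez; exact: Qzmx.
by split=> //; apply: Qrev => //; case: (span_vertex hp hK ug hgQ h1).
Qed.

Section Accessors.
Variables (a : ty) (e : prog a StTy) (x : D a) (s : state).
Hypothesis he : yields e x (code s).
Lemma y_sgl : yields (sgl e) x (input_code gamma). Proof. exact: y_p1 he. Qed.
Lemma y_swd : yields (swd e) x [seq letter_code l | l <- wd s].
Proof. exact: y_p1 (y_p1 (y_p2 he)). Qed.
Lemma y_smx : yields (smx e) x (mx_code (lword (wd s))).
Proof. exact: y_p2 (y_p1 (y_p2 he)). Qed.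
Lemma y_szz : yields (szz e) x (mx_code (zmx K (zz s))).
Proof. exact: y_p1 (y_p2 (y_p2 he)). Qed.
Lemma y_sit : yields (sit e) x [seq item_code it | it <- items s].
Proof. exact: y_p1 (y_p1 (y_p2 (y_p2 (y_p2 he)))). Qed.
Lemma y_sed : yields (sed e) x [seq pair_code it | it <- items s].
Proof. exact: y_p2 (y_p1 (y_p2 (y_p2 (y_p2 he)))). Qed.
Lemma y_shh : yields (shh e) x (mx_code (hh s)).
Proof. exact: y_p1 (y_p2 (y_p2 (y_p2 (y_p2 he)))). Qed.
Lemma y_srm : yields (srm e) x [seq mx_code y | y <- rem s].
Proof. exact: y_p2 (y_p2 (y_p2 (y_p2 (y_p2 he)))). Qed.
End Accessors.

Lemma y_mkst a (e1 e8 : prog a (List Mat)) (e2 : prog a (List LetterTy))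
    (e3 e4 e7 : prog a Mat) (e5 : prog a (List ItemTy)) (e6 : prog a (List (Prod Mat Mat)))
    x s :
  yields e1 x (input_code gamma) -> yields e2 x [seq letter_code l | l <- wd s] ->
  yields e3 x (mx_code (lword (wd s))) -> yields e4 x (mx_code (zmx K (zz s))) ->
  yields e5 x [seq item_code it | it <- items s] ->
  yields e6 x [seq pair_code it | it <- items s] ->
  yields e7 x (mx_code (hh s)) -> yields e8 x [seq mx_code y | y <- rem s] ->
  yields (mkst e1 e2 e3 e4 e5 e6 e7 e8) x (code s).
Proof. 
move=> h1 h2 h3 h4 h5 h6 h7 h8; apply: (y_fork h1); apply: (y_fork (y_fork h2 h3)).
exact: (y_fork h4 (y_fork (y_fork h5 h6) (y_fork h7 h8))). Qed.

Let y_snd a b (u : D a) (v : D b) : yields (Snd a b) ((u, v) : D (Prod a b)) v.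
Proof. by []. Qed.
Let y_fst a b (u : D a) (v : D b) : yields (Fst a b) ((u, v) : D (Prod a b)) u.
Proof. by []. Qed.

Let y_one a (x : D a) : yields (cmat a (1, 0, 0, 1)) x (mx_code (1 : 'M[K]_2)).
Proof.
have -> : 1 = zmx K (1, 0, 0, 1) by rewrite one2E /zmx /= mulr1z mulr0z.
exact: y_cmat.
Qed.

Let onth_map T U (f : T -> U) l k : onth (map f l) k = omap f (onth l k).
Proof. by elim: l k => [|x l IH] [|k] //=. Qed.

Let onth_enum (i : 'I_g) : onth (input_code gamma) i = Some (mx_code (gamma i)).
Proof.
rewrite /input_code onth_map (_ : onth (enum 'I_g) i = Some i) //.
suff h (l : seq 'I_g) k x0 : (k < size l)%N -> onth l k = Some (nth x0 l k).
  by rewrite (h _ _ i) ?size_enum_ord // nth_ord_enum.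
by elim: l k => [|x l IH] [|k] //= /IH.
Qed.

Let y_prepend a (e : prog a StTy) x s i b : yields e x (code s) ->
  yields (prepend_letter i b e) x
    (code (State ((i, b) :: wd s) (zz s) (items s) (hh s) (rem s))).
Proof.
move=> he; rewrite /prepend_letter.
have h1 : yields (Comp (sgl e) (onthP Mat i)) x (inr (mx_code (gamma i)) : D (Sum Unit Mat)).
  by apply: y_comp (y_sgl he) _; have := y_onth p abs i (input_code gamma); rewrite onth_enum.
apply: (y_on_inr _ h1).
have he' : yields (Comp (Snd Mat a) e) ((mx_code (gamma i), x) : D (Prod Mat a)) (code s).
  by apply: y_comp (y_snd _ _) he.
apply: y_mkst; [exact: y_sgl he'| | |exact: y_szz he'|exact: y_sit he'|exact: y_sed he'|
  exact: y_shh he'|exact: y_srm he'].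
  have hl : yields (Fork (cint _ i) (cbool _ b) : prog (Prod Mat a) LetterTy)
      (mx_code (gamma i), x) (letter_code (i, b)) by apply: y_fork.
  exact: (y_lcons hl (y_swd he')).
apply: y_mmul (y_smx he'); rewrite /lmx /=; case: b => //.
by apply: y_madj.
Qed.

Let y_letter i b s : yields (letterP i b) (code s) (code (opf (OLetter i b) s)).
Proof.
have hid : yields (Id StTy) (code s) (code s) by [].
rewrite /letterP /=.
have := y_swd hid; case E: (wd s) => [|[j c] w] hw.
  apply: (y_on_inl _ (y_uncons_nil hw)).
  by have := y_prepend i b (@y_snd Unit StTy tt (code s)); rewrite E.
apply: (y_on_inr _ (y_uncons_cons hw)).
have hd : yields (p1 (Fst (Prod LetterTy (List LetterTy)) StTy))
    ((letter_code (j, c), [seq letter_code l | l <- w]), code s) (letter_code (j, c)) by [].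
have -> : ((j, c) == inv_letter (i, b)) =
    ((j : int) <= (i : int)) && (((i : int) <= (j : int)) && (if b then ~~ c else c)).
  rewrite /inv_letter xpair_eqE /= -val_eqE /= eqn_leq -andbA !lez_nat.
  by case: b; case: (c).
apply: (y_ite (v := ((j : int) <= (i : int)) && (((i : int) <= (j : int)) && (if b then ~~ c else c)))).
- set x : D (Prod (Prod LetterTy (List LetterTy)) StTy) := (_, code s) in hd *.
  have h1 : yields (p1 (p1 (Fst (Prod LetterTy (List LetterTy)) StTy))) x (Posz j) := y_p1 hd.
  have h2 : yields (p2 (p1 (Fst (Prod LetterTy (List LetterTy)) StTy))) x c := y_p2 hd.
  have h3 : yields (cint _ (Posz i)) x (Posz i) by [].
  apply: y_band; first exact: (y_ile h1 h3).
  apply: y_band; first exact: (y_ile h3 h1).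
  by case: b; [exact: (y_bneg h2)|exact: h2].
- by move=> ->; apply: y_snd.
- by move=> /negbTE ->; have := y_prepend i b (@y_snd (Prod LetterTy (List LetterTy)) StTy (letter_code (j, c), [seq letter_code l | l <- w]) (code s)); rewrite E.
Qed.

Let y_oadd z s : yields (oaddP z) (code s) (code (opf (OAdd g z) s)).
Proof.
have hid : yields (Id StTy) (code s) (code s) by [].
apply: y_mkst; [exact: y_sgl hid|exact: y_swd hid|exact: y_smx hid| |exact: y_sit hid|
  exact: y_sed hid|exact: y_shh hid|exact: y_srm hid].
apply: y_comp (y_fork (y_szz hid) (y_cmat _ _ _ _)) _ => /=.
have -> : zmx K (zadd (zz s) z) = zmx K (zz s) + zmx K z.
  by apply: mx2_inj; rewrite /zmx !mxE2 /zadd /= !rmorphD.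
exact: y_addP.
Qed.

Let y_rev s : yields (revP p) (code s) (mx_code (rev_edge (cur_item s))).
Proof.
have hid : yields (Id StTy) (code s) (code s) by [].
apply: y_mmul; first by apply: y_adjmul; [exact: y_smx hid|exact: y_szz hid].
have -> : Jmx p K = zmx K (0, p%:Z, 1, 0) by rewrite /zmx /= !mulr0z mulr1z.
exact: y_cmat.
Qed.

Let y_compat (it it' : 'M[K]_2 * 'M[K]_2) : (forall i j, Qp abs (it.2 i j)) -> (forall i j, Qp abs (it'.2 i j)) ->
  (forall i j, Qp abs (rev_edge it i j)) -> (forall i j, Qp abs (rev_edge it' i j)) ->
  yields compatP ((pair_code it, pair_code it') : D (Prod (Prod Mat Mat) (Prod Mat Mat)))
    (compat it it').
Proof.
move=> q1 q2 q3 q4; set x := (pair_code it, _).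
have h := y_id p abs (x : D (Prod (Prod Mat Mat) (Prod Mat Mat))).
have X := y_p1 (y_p1 h); have X' := y_p2 (y_p1 h).
have Y := y_p1 (y_p2 h); have Y' := y_p2 (y_p2 h).
apply: y_band; first by apply: y_comp (y_adjmul X Y) _; apply: (y_dom hp hK); apply: Qadjmul.
apply: y_band; first by apply: y_comp (y_adjmul X Y') _; apply: (y_dom hp hK); apply: Qadjmul.
apply: y_band; first by apply: y_comp (y_adjmul X' Y) _; apply: (y_dom hp hK); apply: Qadjmul.
by apply: y_comp (y_adjmul X' Y') _; apply: (y_dom hp hK); apply: Qadjmul.
Qed.

Let y_push s : valid s -> yields (pushP p g) (code s) (code (opf (OPush g) s)).
Proof.
move=> vs; have hid : yields (Id StTy) (code s) (code s) by [].
have [Qc Qr] := Qcur s.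
apply: (y_ite (v := pushable s)) => /= [|ps|/negbTE ->]; last exact: hid.
  have hz : yields (Comp (szz (Id StTy)) detP) (code s) (\det (zmx K (zz s))).
    by apply: y_comp (y_szz hid) (y_det _ _ _).
  have z0 := y_num p abs 0 (code s); rewrite mulr0z in z0.
  rewrite /pushable -[X in _ && X]/(_ && _); apply: y_band; first exact: (y_bneg (y_neqn hz z0)).
  apply: y_band.
    by apply: y_comp (y_adjmul (y_szz hid) (y_rev s)) _; apply: (y_dom hp hK); apply: Qadjmul.
  apply: y_comp (y_fork (y_fork (y_szz hid) (y_rev s)) (y_sed hid)) _.
  apply: (@y_all p R K abs (Prod Mat Mat) (Prod Mat Mat) _ pair_code g.-1 compatP (compat (cur_item s)) (pair_code (cur_item s))) => it hit.
  have [q1 q2] := Qitem vs hit; exact: y_compat.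
rewrite ps; have /and4P[d0 _ _ _] := ps.
have vz : vertex abs (zmx K (zz s)) by split.
have vr : vertex abs (rev_edge (cur_item s)).
  split=> //; rewrite !det2M det_adj2 det_Jmx !mulf_neq0 ?oppr_eq0 ?(pK_neq0 hp hK) //.
  by case: (vertex_lword hp hK ug hgQ (wd s)).
apply: y_mkst; [exact: y_sgl hid|by []|exact: y_one| | | |exact: y_shh hid|exact: y_srm hid].
- exact: y_cmat.
- apply: y_lcons (y_sit hid); apply: y_fork; first exact: y_smx hid.
  apply: y_fork; first by apply: y_comp (y_szz hid) _; apply: (y_ball hp hK).
  by apply: y_comp (y_rev s) _; apply: (y_ball hp hK).
- by apply: y_lcons (y_sed hid); apply: y_fork (y_szz hid) (y_rev s).
Qed.

Let y_omul i b s : yields (omulP i b) (code s) (code (opf (OMul i b) s)).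
Proof.
have hid : yields (Id StTy) (code s) (code s) by [].
have := y_comp (y_sit hid) (y_onth p abs i _); rewrite onth_map /omulP /=.
case: (onth (items s) i) => [it|] /= h; last by apply: (y_on_inl _ h).
apply: (y_on_inr _ h).
have he := @y_snd ItemTy StTy (item_code it) (code s).
apply: y_mkst; [exact: y_sgl he|exact: y_swd he|exact: y_smx he|exact: y_szz he|
  exact: y_sit he|exact: y_sed he| |exact: y_srm he].
have hy := y_p1 (@y_fst ItemTy StTy (item_code it) (code s)).
by apply: y_mmul (y_shh he); case: b => //; apply: y_madj.
Qed.

Let y_verify s : yields verifyP (code s) (code (opf (OVerify g) s)).
Proof.
have hid : yields (Id StTy) (code s) (code s) by [].
rewrite /verifyP /=; have := y_srm hid; case E: (rem s) => [|y r] h.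
  by apply: (y_on_inl _ (y_uncons_nil h)).
apply: (y_on_inr _ (y_uncons_cons h)).
set u : D (Prod Mat (List Mat)) := (mx_code y, _).
have he := @y_snd _ StTy u (code s); have hu := @y_fst _ StTy u (code s).
apply: (y_ite (v := is_scalar_mx (adj2 (hh s) * y))) => [| ->|/negbTE -> //].
  by apply: y_comp (y_adjmul (y_shh he) (y_p1 hu)) (y_scal _ _ _).
apply: y_mkst; [exact: y_sgl he|exact: y_swd he|exact: y_smx he|exact: y_szz he|
  exact: y_sit he|exact: y_sed he|exact: y_one|exact: (y_p2 hu)].
Qed.

Lemma y_op o s : valid s -> yields (opP p o) (code s) (code (opf o s)).
Proof.
by case: o => *; [exact: y_letter|exact: y_oadd|exact: y_push|exact: y_omul|exact: y_verify].
Qed.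

Let firsts_mono it l : span (firsts l) `<=` span (firsts (it :: l)).
Proof.
by apply: span_mono => x [it' h ->]; exists it' => //; rewrite inE h orbT.
Qed.

Let onth_mem (T : eqType) (l : seq T) k x : onth l k = Some x -> x \in l.
Proof.
elim: l k => [|y l IH] [|k] //=; first by case=> ->; rewrite mem_head.
by move=> /IH h; rewrite inE h orbT.
Qed.

Lemma valid_op o s : valid s -> valid (opf o s).
Proof.
move=> vs; have [v1 v2 v3 v4 v5 v6 v7] := vs; case: o => [i b|z||i b|] /=.
- case: ifP => // hm; have r : reduced ((i, b) :: wd s).
    by rewrite reduced_cons v1 andbT; move: hm; case: (wd s) => [//|m w'] /negbT.
  by split.
- by split.
- case: ifP => // /and4P[d0 dr sz hc]; split=> //=.
  + move=> it; rewrite inE => /orP[/eqP ->|/v2 //]; split=> //=.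
      exact: span_lword.
    by exists (zz s).
  + by rewrite hc.
  + by rewrite (leq_ltn_trans sz) // prednK.
  + exact: firsts_mono v5.
  + move=> j; have [h|[c [x [c0 hx e]]]] := v7 j; [by left|right].
    by exists c, x; split=> //; apply: firsts_mono.
- case E: (onth (items s) i) => [it|//]; have hit := onth_mem E.
  have fit : firsts (items s) it.1 by exists it.
  by split=> //=; case: b; [apply: span_adjl|apply: span_mull].
- case E: (rem s) => [//|y r]; case: ifP => // sc; split=> //=.
  + exact: span1.
  + by move=> x xr; apply: v6; rewrite E inE xr orbT.
  (* If [adj2 (hh s) * y] is scalar, then y is a nonzero multiple of [hh s], because both have
     nonzero determinant. *)
  + move=> j; have [|h] := v7 j; last by right.
    rewrite E inE => /orP[/eqP ejy|]; [right|by left].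
    move/is_scalar_mxP: sc => [c ec]; rewrite ejy.
    have h0 : \det (hh s) != 0.
      apply: span_det v5 => x [it /v2[/(span_vertex hp hK ug hgQ)[_ d0] _ _ _] ->].
      exact: d0.
    have y0 : \det y != 0 by rewrite -ejy -unitmx2.
    have e : \det (hh s) *: y = c *: hh s.
      by rewrite -[LHS]mulSmx -mul_adj2 -mulrA ec mulmxS.
    have c0 : c != 0.
      have m0 : \det (adj2 (hh s) * y) != 0 by rewrite det2M det_adj2 mulf_neq0.
      by apply: contraNneq m0 => c0; rewrite ec c0 scal2E !mxE2 mul0r subr0.
    exists (c / \det (hh s)), (hh s); split=> //; first by rewrite mulf_neq0 ?invr_eq0.
    by rewrite mulrC -scalerA -e scalerA mulVf // scale1r.
Qed.

Definition good_output s : option (D OutputTy) :=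
  if nilp (rem s) && (size (items s) == g)
  then Some (inl [seq item_code it | it <- items s]) else None.

(** The empty word is scalar without being a relation, hence the first test. *)
Definition check s : option (D OutputTy) :=
  if nilp (wd s) then good_output s
  else if is_scalar_mx (lword (wd s)) then Some (inr (inl [seq letter_code l | l <- wd s]))
  else if abs (\tr (lword (wd s)) * \tr (lword (wd s))) <= abs (\det (lword (wd s)))
  then Some (inr (inr (mx_code (lword (wd s)))))
  else good_output s.

Definition result_code (o : option (D OutputTy)) : D (Sum Unit OutputTy) :=
  if o is Some y then inr y else inl tt.

Let y_good s : valid s -> yields (goodP g) (code s) (result_code (good_output s)).
Proof.
move=> vs; have hid : yields (Id StTy) (code s) (code s) by [].
rewrite /goodP /good_output; have := y_srm hid; case: (rem s) => [|y r] h; last first.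
  by apply: (y_on_inr _ (y_uncons_cons h)).
apply: (y_on_inl _ (y_uncons_nil h)).
have he := @y_snd Unit StTy tt (code s).
have := y_comp (y_sit he) (y_onth p abs g.-1 _); rewrite onth_map.
have sz : (onth (items s) g.-1 : bool) = (size (items s) == g).
  have := valid_size vs; rewrite leq_eqVlt => /orP[/eqP e|lt].
    rewrite e eqxx; have : (g.-1 < size (items s))%N by rewrite e prednK.
    by elim: (items s) (g.-1) => [|x l IH] [|k] //=; apply: IH.
  rewrite (ltn_eqF lt); have : (size (items s) <= g.-1)%N by rewrite -ltnS prednK.
  by elim: (items s) (g.-1) => [|x l IH] [|k] //=; apply: IH.
case: (onth (items s) g.-1) sz => [it|] /= <- h'.
  apply: (y_on_inr _ h'); apply: y_inr; apply: y_inl.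
  by apply: y_sit; apply: y_p2 (y_snd _ _).
by apply: (y_on_inl _ h').
Qed.

Lemma y_check s : valid s -> yields (checkP g) (code s) (result_code (check s)).
Proof.
move=> vs; have hid : yields (Id StTy) (code s) (code s) by [].
rewrite /checkP /check; have := y_swd hid; case E: (wd s) => [|l w] h.
  apply: (y_on_inl _ (y_uncons_nil h)).
  by apply: y_comp (y_snd _ _) (y_good vs).
apply: (y_on_inr _ (y_uncons_cons h)); rewrite -E.
have -> : nilp (wd s) = false by rewrite E.
set u : D (Prod LetterTy (List LetterTy)) := (letter_code l, _).
have he := @y_snd _ StTy u (code s).
have QM := Qlword (wd s).
apply: (y_ite (v := is_scalar_mx (lword (wd s)))) => [| ->|/negbTE ->].
- exact: (y_comp (y_smx he) (y_scal _ _ _)).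
- by rewrite [result_code _]/=; apply: y_inr; apply: y_inr; apply: y_inl; apply: y_swd.
have ht := y_comp (y_smx he) (y_tr p abs _).
apply: (y_ite (y_nabsle hp hK (y_nmul ht ht) (y_comp (y_smx he) (y_det p abs _)) _ _)) => [| | ->|/negbTE ->].
- by apply: (QpM hp hK); apply: (Qp_tr2 hp hK).
- exact: (Qp_det2 hp hK).
- by rewrite [result_code _]/=; apply: y_inr; apply: y_inr; apply: y_inr; apply: y_smx.
- by apply: y_comp he (y_good vs).
Qed.

End Semantics.

Lemma iterateS (A B : Type) (f : A -> option (A + B)) n x :
  iterate f n.+1 x = match f x with
                     | Some (inl x') => iterate f n x'
                     | Some (inr y) => Some y
                     | None => None
                     end.
Proof. by []. Qed.

Lemma In_cat T (x : T) l m : List.In x (l ++ m) <-> List.In x l \/ List.In x m.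
Proof. by elim: l => [|y l IH] /=; [split; [right|case]|rewrite IH or_assoc]. Qed.

Lemma In_map T U (f : T -> U) y l : List.In y (map f l) <-> exists x, f x = y /\ List.In x l.
Proof.
elim: l => [|z l IH] /=; first by split=> [|[x []]].
rewrite IH; split=> [[<-|[x [<- xl]]]|[x [<- [->|xl]]]]; [| |by left|right].
- by exists z; split=> //; left.
- by exists x; split=> //; right.
- by exists x.
Qed.

(** * Termination and correctness of the search *)

Section Search.
Variables (p : nat) (R : realType) (K : fieldType) (abs : K -> R).
Hypotheses (hp : prime p) (hK : is_Cp abs p).
Variables (g : nat) (gamma : 'I_g -> 'M[K]_2).
Hypotheses (hg0 : (0 < g)%N) (ug : forall i, gamma i \in unitmx).
Hypothesis hgQ : forall i j k, Qp abs (gamma i j k).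

Local Notation D := (den K).
Local Notation yields := (yields p abs).
Local Notation lword := (lword gamma).
Local Notation state := (state K g).
Local Notation code := (code p abs gamma).
Local Notation valid := (valid p abs gamma).
Local Notation check := (check p abs gamma).
Local Notation opf := (opf p abs gamma).
Local Notation rev_edge := (rev_edge p).

Section Loop.
Variable os : seq (op g).

Local Notation step := (stepP p os).

Lemma y_children s next l : valid s ->
  yields (childrenP p l) (code s, map code next)
    (map code (map (fun o => opf o s) l ++ next)).
Proof.
move=> vs; elim: l => [//|o l IH] /=.
have h : yields (Fst StTy (List StTy)) ((code s, map code next) : D (Prod StTy (List StTy)))
  (code s) by [].
exact: (y_lcons (y_comp h (y_op hp hK ug hgQ o vs)) IH).
Qed.

Lemma y_step_nil next : yields step ([::], map code next)
  (inl (map code next, [::]) : D (Sum (Prod (List StTy) (List StTy)) OutputTy)).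
Proof. by []. Qed.

Lemma y_step_cons s cur next : valid s ->
  yields step (map code (s :: cur), map code next)
    (if check s is Some o then inr o
     else inl (map code cur, map code (map (fun o => opf o s) os ++ next))
     : D (Sum (Prod (List StTy) (List StTy)) OutputTy)).
Proof.
move=> vs; set x : D (Prod (List StTy) (List StTy)) := (_, _).
have h : yields (Comp (Fst (List StTy) (List StTy)) (Uncons StTy)) x
  (inr (code s, map code cur) : D (Sum Unit (Prod StTy (List StTy)))) by [].
apply: (y_on_inr _ h).
have hc : yields (Comp (p1 (Fst (Prod StTy (List StTy)) (Prod (List StTy) (List StTy))))
    (checkP g)) ((code s, map code cur), x) (result_code (check s)).
  set u : D (Prod (Prod StTy (List StTy)) (Prod (List StTy) (List StTy))) := (_, x).
  have h1 : yields (p1 (Fst (Prod StTy (List StTy)) (Prod (List StTy) (List StTy)))) u (code s) by [].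
  exact: (y_comp h1 (y_check hp hK hg0 ug hgQ vs)).
case: (check s) hc => [y|] /= hc.
  by apply: (y_on_inr _ hc).
apply: (y_on_inl _ hc); apply: y_inl; apply: y_fork => //.
set u : D (Prod Unit (Prod (Prod StTy (List StTy)) (Prod (List StTy) (List StTy)))) := (_, (_, x)).
have h1 : yields (Fork (p1 (p1 (Snd Unit (Prod (Prod StTy (List StTy)) (Prod (List StTy) (List StTy))))))
    (p2 (p2 (Snd Unit (Prod (Prod StTy (List StTy)) (Prod (List StTy) (List StTy)))))))
    u ((code s, map code next) : D (Prod StTy (List StTy))) by [].
exact: (y_comp h1 (y_children next os vs)).
Qed.

(** The body of the loop has no loop inside, so its own bound m is arbitrary and only the number N
    of rounds counts. *)
Definition ends (x : D (Prod (List StTy) (List StTy))) (o : D OutputTy) :=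
  exists N, forall m, iterate (run p abs m step) N x = Some o.

Lemma ends_inl x x' o : yields step x (inl x') -> ends x' o -> ends x o.
Proof. by move=> h [N hN]; exists N.+1 => m; rewrite iterateS h. Qed.

Lemma ends_inr x o : yields step x (inr o) -> ends x o.
Proof. by move=> h; exists 1%N => m; rewrite iterateS h. Qed.

Definition solved (cur next : seq state) :=
  exists t o, [/\ valid t, check t = Some o & ends (map code cur, map code next) o].

(** Induction on [cur], the children of each state going to [next]. If no state of the level ends
    the search, L is the complete next level. *)
Lemma expand_level cur next : (forall s, List.In s cur -> valid s) ->
  (forall s, List.In s next -> valid s) ->
  solved cur next \/
  (forall s, List.In s cur -> check s = None) /\
  exists L, [/\ forall s, List.In s L -> valid s,
    forall s o, List.In s cur -> List.In o os -> List.In (opf o s) L,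
    forall s, List.In s next -> List.In s L &
    solved L [::] -> solved cur next].
Proof.
elim: cur next => [|s cur IH] next vc vn.
  right; split=> //; exists next; split=> // -[t [y [vt ct et]]].
  by exists t, y; split=> //; apply: ends_inl et; apply: y_step_nil.
have vs : valid s by apply: vc; left.
have hs := y_step_cons cur next vs.
case E: (check s) hs => [y|] hs.
  by left; exists s, y; split=> //; apply: ends_inr hs.
have vn' t : List.In t (map (fun o => opf o s) os ++ next) -> valid t.
  move=> /In_cat[/In_map[y [<- _]]|/vn //].
  exact: (valid_op hp hK hg0 ug hgQ).
have up : solved cur (map (fun o => opf o s) os ++ next) -> solved (s :: cur) next.
  by move=> [t [y [vt ct et]]]; exists t, y; split=> //; apply: ends_inl et.
have [|[hn [L [vL cL nL sL]]]] := IH _ (fun t ht => vc t (or_intror ht)) vn'.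
  by left; apply: up.
right; split; first by move=> t [<-//|/hn].
exists L; split=> //.
- move=> t o [<-|tc] ho; last exact: cL.
  by apply: nL; apply/In_cat; left; apply/In_map; exists o.
- by move=> t tn; apply: nL; apply/In_cat; right.
- by move=> h; apply: up; apply: sL.
Qed.

Definition reach_by (s t : state) :=
  exists l, (forall o, List.In o l -> List.In o os) /\ t = foldl (fun s o => opf o s) s l.

Lemma reach_refl s : reach_by s s. Proof. by exists [::]. Qed.

Lemma reach_trans s t u : reach_by s t -> reach_by t u -> reach_by s u.
Proof.
move=> [l [hl ->]] [l' [hl' ->]]; exists (l ++ l'); rewrite foldl_cat; split=> // o.
by move=> /In_cat[/hl|/hl'].
Qed.

Lemma reach_op o s : List.In o os -> reach_by s (opf o s).
Proof. by move=> ho; exists [:: o]; split=> // o' [<-|]. Qed.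

(** The states on the path to t lie on successive levels, so the search ends at some state t' before
    t is passed over. *)
Lemma search_terminates s t o : valid s -> reach_by s t -> check t = Some o ->
  exists t' o', [/\ valid t', check t' = Some o' & ends ([:: code s], [::]) o'].
Proof.
move=> vs [l [hl ->]] ct.
suff h L : (forall s, List.In s L -> valid s) -> List.In s L -> solved L [::].
  by apply: (h [:: s]); [move=> ? [<-|]|left].
elim: l s {vs} hl ct L => [|o' l IH] s hl /= ct L vL sL.
  have [//|[hn _]] := expand_level vL (fun s (h : List.In s [::]) => match h with end).
  by rewrite (hn _ sL) in ct.
have [//|[_ [L' [vL' cL' _ sol]]]] := expand_level vL (fun s (h : List.In s [::]) => match h with end).
apply: sol; apply: (IH (opf o' s)) => //; last by apply: cL' => //; apply: hl; left.
by move=> o'' ho; apply: hl; right.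
Qed.

End Loop.

(** [outcome_good] contains the Schottky property; the freeness of gamma added here makes it exclude
    the other two outcomes. *)
Definition sound (y : D OutputTy) :=
  (outcome_good p abs gamma y /\ freely_generate gamma) \/
  (outcome_relation gamma y \/ outcome_not_hyperbolic abs gamma y).

Let good_sound s y : valid s -> good_output p abs s = Some y -> sound y.
Proof.
move=> vs; rewrite /good_output; case: ifP => // /andP[/nilP rs /eqP sz] [<-]; left.
pose a (i : 'I_g) := (nth (0, 0) (items s) i).1; pose A (i : 'I_g) := (nth (0, 0) (items s) i).2.
have mem (i : 'I_g) : nth (0, 0) (items s) i \in items s by rewrite mem_nth ?sz.
have ha i : span (range gamma) (a i) by have [] := valid_items vs (mem i).
have vA i : vertex abs (A i).
  have [_ [z ez] d0 _] := valid_items vs (mem i); split=> //.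
  by rewrite /A ez; apply: Qp_mx2; apply: (Qp_int hp hK).
have gen j : spanZ (range a) (gamma j).
  have [|[c [x [c0 hx e]]]] := valid_done vs j; first by rewrite rs.
  exists c, x; split=> //; apply: span_mono hx => _ [it hit ->].
  have hk : (index it (items s) < g)%N by move: hit; rewrite -index_mem sz.
  by exists (Ordinal hk) => //; rewrite /a /= nth_index.
have eF i : edge p a A (i, false) = (nth (0, 0) (items s) i).2 by [].
have eT i : edge p a A (i, true) = rev_edge (nth (0, 0) (items s) i) by [].
(* [valid_compat] covers only i < j. The adjugate keeps the norm and only changes the sign of the
   entry (0, 1). *)
have sym X Y : dom abs (adj2 X * Y) -> dom abs (adj2 Y * X).
  have -> : adj2 Y * X = adj2 (adj2 X * Y) by rewrite adj2M adj2K.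
  by rewrite /dom (mxnorm_adj hK) [adj2 (_ * _) _ _]mx2E (absN hK).
have lt (i j : 'I_g) b c : (i < j)%N -> dom abs (adj2 (edge p a A (i, b)) * edge p a A (j, c)).
  move=> ij; have /(pairwiseP (0, 0)) h := valid_compat vs.
  have := h i j; rewrite !inE !sz !ltn_ord => /(_ isT isT ij) /and4P[h1 h2 h3 h4].
  by case: b c => [] [].
have hd u v : u != v -> dom abs (adj2 (edge p a A u) * edge p a A v).
  move: u v => [i b] [j c] nuv; case: (ltngtP i j) => [|ji|/val_inj ij]; first exact: lt.
    by apply: sym; apply: lt.
  rewrite -ij in nuv *; have [_ _ _ hs] := valid_items vs (mem i).
  by case: b c nuv => [] []; rewrite ?eqxx // => _; apply: sym.
split; last exact: (good_certificate_free hp hK ug hgQ ha vA gen hd).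
have := good_certificate_sound hp hK ug hgQ ha vA gen hd.
congr (outcome_good _ _ _ (inl _)).
transitivity [seq item_code p abs (nth (0, 0) (items s) (nat_of_ord i)) | i <- enum 'I_g] => //.
rewrite (map_comp (fun k => item_code p abs (nth (0, 0) (items s) k)) (@nat_of_ord g)).
rewrite val_enum_ord (map_comp (item_code p abs) (nth (0, 0) (items s))).
by congr map; rewrite -[RHS](mkseq_nth (0, 0)) /mkseq sz.
Qed.

Lemma check_sound s y : valid s -> check s = Some y -> sound y.
Proof.
move=> vs; rewrite /check; case: ifP => [_|/nilP w0]; first exact: good_sound.
have [c c0 e] := lword_value ug (wd s).
case: ifP => [sc [<-]|/negbT nsc].
  right; left; exists (wd s); have rw := valid_wd vs.
  have sw : is_scalar_mx (word_value gamma (wd s)) by rewrite -lword_scalar.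
  split=> //; first exact/eqP.
  by move=> h; apply: (h _ rw _ sw); apply/eqP.
case: ifP => [le [<-]|_]; last exact: good_sound.
have gM := lword_generated ug (wd s).
have nh : ~ hyperbolic abs (lword (wd s)).
  by move=> /(hyperbolic_tr hK); rewrite ltNge expr2 -(absM hK) le.
right; right; exists (lword (wd s)); split=> //; first exact/negP.
by move=> [_ h]; apply: nh; apply: h => //; apply/negP.
Qed.

(** Adding these leads from 0 to every integral matrix, although each state has only finitely many
    children. *)
Definition zunits : seq (int * int * int * int) :=
  [:: (1, 0, 0, 0); (-1, 0, 0, 0); (0, 1, 0, 0); (0, -1, 0, 0);
      (0, 0, 1, 0); (0, 0, -1, 0); (0, 0, 0, 1); (0, 0, 0, -1)].

Definition all_ops : seq (op g) :=
  [seq OLetter u.1 u.2 | u <- enum {: 'I_g * bool}] ++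
  [seq OMul u.1 u.2 | u <- enum {: 'I_g * bool}] ++
  [seq OAdd g z | z <- zunits] ++ [:: OPush g; OVerify g].

Local Notation reach := (reach_by all_ops).

Let mem_In (T : eqType) (x : T) l : x \in l -> List.In x l.
Proof.
elim: l => [//|y l IH]; rewrite inE => /orP[/eqP ->|/IH]; [by left|by right].
Qed.

Let In_letter i b : List.In (OLetter i b) all_ops.
Proof.
apply/In_cat; left; apply/In_map; exists (i, b); split=> //.
by apply: mem_In; rewrite mem_enum.
Qed.

Let In_mul i b : List.In (OMul i b) all_ops.
Proof.
apply/In_cat; right; apply/In_cat; left.
by apply/In_map; exists (i, b); split=> //; apply: mem_In; rewrite mem_enum.
Qed.

Let In_add z : z \in zunits -> List.In (OAdd g z) all_ops.
Proof.
move=> hz; apply/In_cat; right; apply/In_cat; right.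
by apply/In_cat; left; apply/In_map; exists z; split=> //; apply: mem_In.
Qed.

Let In_push : List.In (OPush g) all_ops.
Proof. by do 3!(apply/In_cat; right); left. Qed.

Let In_verify : List.In (OVerify g) all_ops.
Proof. by do 3!(apply/In_cat; right); right; left. Qed.

(** Letters are prepended, and every suffix of a reduced word is reduced, so no letter is
    refused. *)
Lemma reach_word w z it h r : reduced w ->
  reach (State [::] z it h r) (State w z it h r).
Proof.
elim: w => [_|l w IH]; first exact: reach_refl.
rewrite reduced_cons => /andP[hl rw]; apply: reach_trans (IH rw) _.
have := reach_op (State w z it h r) (In_letter l.1 l.2); rewrite /= -surjective_pairing.
by case: w hl {IH rw} => [//|m w] /negbTE ->.
Qed.

Let reach_int (f : int -> state) : (forall x, reach (f x) (f (x + 1))) ->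
  (forall x, reach (f x) (f (x - 1))) -> forall x y, reach (f x) (f y).
Proof.
move=> up down x y; rewrite -[y](subrK x) addrC.
case: (y - x) => n; rewrite ?NegzE.
  elim: n => [|n IH]; first by rewrite addr0; exact: reach_refl.
  by apply: reach_trans IH _; have := up (x + n%:Z); rewrite -addrA intS [1 + _]addrC.
elim: n => [|n IH]; first exact: down.
by apply: reach_trans IH _; have := down (x - n.+1%:Z); rewrite -addrA -opprD [_ + 1]addrC -intS.
Qed.

Lemma reach_add w z z' it h r : reach (State w z it h r) (State w z' it h r).
Proof.
case: z z' => [[[a b] c] d] [[[a' b'] c'] d'].
have op x y : y \in zunits -> reach (State w x it h r) (State w (zadd x y) it h r).
  by move=> hy; apply: (reach_op (State w x it h r) (In_add hy)).
apply: reach_trans (_ : reach _ (State w (a', b, c, d) it h r)) _.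
  apply: (reach_int (f := fun x => State w (x, b, c, d) it h r)) => x.
    by have := op (x, b, c, d) (1, 0, 0, 0) isT; rewrite /zadd /= !addr0.
  by have := op (x, b, c, d) (-1, 0, 0, 0) isT; rewrite /zadd /= !addr0.
apply: reach_trans (_ : reach _ (State w (a', b', c, d) it h r)) _.
  apply: (reach_int (f := fun x => State w (a', x, c, d) it h r)) => x.
    by have := op (a', x, c, d) (0, 1, 0, 0) isT; rewrite /zadd /= !addr0.
  by have := op (a', x, c, d) (0, -1, 0, 0) isT; rewrite /zadd /= !addr0.
apply: reach_trans (_ : reach _ (State w (a', b', c', d) it h r)) _.
  apply: (reach_int (f := fun x => State w (a', b', x, d) it h r)) => x.
    by have := op (a', b', x, d) (0, 0, 1, 0) isT; rewrite /zadd /= !addr0.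
  by have := op (a', b', x, d) (0, 0, -1, 0) isT; rewrite /zadd /= !addr0.
apply: (reach_int (f := fun x => State w (a', b', c', x) it h r)) => x.
  by have := op (a', b', c', x) (0, 0, 0, 1) isT; rewrite /zadd /= !addr0.
by have := op (a', b', c', x) (0, 0, 0, -1) isT; rewrite /zadd /= !addr0.
Qed.

Lemma reach_mul w z it x h r : (size it <= g)%N -> span (firsts it) x ->
  reach (State w z it h r) (State w z it (x * h) r).
Proof.
move=> sz.
have hit y : firsts it y -> exists i : 'I_g, exists2 t, onth it i = Some t & t.1 = y.
  move=> [t ht ->]; have hk : (index t it < g)%N by rewrite (leq_trans _ sz) ?index_mem.
  exists (Ordinal hk), t => //=; elim: it ht {sz hk} => [//|u l IH].
  by rewrite inE /= eq_sym; case: eqP => [-> //|_ /= /IH].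
elim=> [|y u /hit[i [t et ey]] _ IH|y u /hit[i [t et ey]] _ IH].
- by rewrite mul1r; exact: reach_refl.
- apply: reach_trans IH _; have := reach_op (State w z it (u * h) r) (In_mul i false).
  by rewrite /= et ey mulrA.
- apply: reach_trans IH _; have := reach_op (State w z it (u * h) r) (In_mul i true).
  by rewrite /= et ey mulrA.
Qed.

Lemma reach_verify w z it r : (size it <= g)%N ->
  (forall y, y \in r -> spanZ (firsts it) y) ->
  reach (State w z it 1 r) (State w z it 1 [::]).
Proof.
move=> sz; elim: r => [_|y r IH hr]; first exact: reach_refl.
have [c [x [c0 hx e]]] := hr y (mem_head _ _).
apply: reach_trans (reach_mul w z 1 (y :: r) sz hx) _; rewrite mulr1.
apply: reach_trans (IH _); last by move=> t tr; apply: hr; rewrite inE tr orbT.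
have := reach_op (State w z it x (y :: r)) In_verify.
by rewrite /= e mul2Zr adj2_mul scale_scalar_mx scalar_mx_is_scalar.
Qed.

Definition initial : state := State [::] (0, 0, 0, 0) [::] 1 [seq gamma i | i <- enum 'I_g].

Lemma valid_initial : valid initial.
Proof.
split=> //=; first exact: span1.
  by move=> y /mapP[i _ ->]; exists i.
by move=> j; left; apply: map_f; rewrite mem_enum.
Qed.

Section GoodTarget.
Variables (w : 'I_g -> seq ('I_g * bool)) (z : 'I_g -> int * int * int * int).
Hypotheses (rw : forall i, reduced (w i)) (gen : forall j, spanZ (range (lword \o w)) (gamma j)).
Hypothesis z0 : forall i, \det (zmx K (z i)) != 0.
Hypothesis hd : forall u v, u != v ->
  dom abs (adj2 (edge p (lword \o w) (fun i => zmx K (z i)) u) *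
           edge p (lword \o w) (fun i => zmx K (z i)) v).

Let item i := (lword (w i), zmx K (z i)).

Lemma reach_items L : uniq L ->
  reach initial (State [::] (0, 0, 0, 0) [seq item i | i <- L] 1 (rem initial)).
Proof.
elim: L => [_|i L IH]; first exact: reach_refl.
move=> /[dup] /card_uniqP cU /=; case/andP=> iL /IH{}IH; apply: reach_trans IH _.
apply: reach_trans (reach_word _ _ _ _ (rw i)) _; apply: reach_trans (reach_add _ _ (z i) _ _ _) _.
have := reach_op (State (w i) (z i) [seq item j | j <- L] 1 (rem initial)) In_push.
rewrite /=; case: ifP => // /negP[]; apply/and4P; split.
- exact: z0.
- by apply: (@hd (i, false) (i, true)); rewrite xpair_eqE andbF.
(* The indices i and L are distinct, so L has at most g - 1 of them and there is room for one more
   item. *)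
- rewrite size_map -ltnS prednK //; have := max_card (mem (i :: L)).
  by rewrite cU card_ord.
- apply/allP => _ /mapP[j jL ->].
  have nij : i != j by apply: contraNneq iL => ->.
  have n (b c : bool) : (i, b) != (j, c) by rewrite xpair_eqE (negbTE nij).
  apply/and4P; split.
  + exact: (hd (n false false)).
  + exact: (hd (n false true)).
  + exact: (hd (n true false)).
  + exact: (hd (n true true)).
Qed.

Lemma reach_good : exists t o, reach initial t /\ check t = Some o.
Proof.
exists (State [::] (0, 0, 0, 0) [seq item i | i <- enum 'I_g] 1 [::]).
rewrite /check /= /good_output /= size_map size_enum_ord eqxx; eexists; split; last by [].
apply: reach_trans (reach_items (enum_uniq _)) _; apply: reach_verify.
  by rewrite size_map size_enum_ord.
move=> _ /mapP[j _ ->]; have [c [x [c0 hx e]]] := gen j; exists c, x; split=> //.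
apply: span_mono hx => _ [i _ <-]; exists (item i) => //.
by apply: map_f; rewrite mem_enum.
Qed.
End GoodTarget.

Lemma reach_bad w : reduced w -> w != [::] ->
  is_scalar_mx (lword w) || (abs (\tr (lword w) * \tr (lword w)) <= abs (\det (lword w))) ->
  exists t o, reach initial t /\ check t = Some o.
Proof.
move=> rw w0 h; exists (State w (0, 0, 0, 0) [::] 1 (rem initial)).
rewrite /check /= (_ : nilp w = false); last by case: w w0 {rw h}.
case: ifP h => [_ _|_ /= ->].
  by eexists; split; [exact: reach_word|reflexivity].
by eexists; split; [exact: reach_word|reflexivity].
Qed.

(** If gamma is not free, some reduced word is scalar. If it is free but the group is not Schottky,
    a non-scalar element that is not hyperbolic is a reduced word up to a factor, and fails the
    trace test. Otherwise there is a good certificate. *)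
Lemma target_exists : exists t o, reach initial t /\ check t = Some o.
Proof.
have [fr|/existsNP[w]] := pselect (freely_generate gamma); last first.
  move=> /not_implyP[rw /not_implyP[w0 /contrapT sw]].
  by apply: (reach_bad rw w0); rewrite lword_scalar // sw.
have [sch|nsch] := pselect (Schottky_group abs (generated_group gamma)).
  have [w [z [rw gen z0 hd]]] := good_certificate_exists hp hK ug hgQ sch fr.
  exact: (reach_good rw gen z0 hd).
have : ~ forall M, generated_group gamma M -> ~ is_scalar_mx M -> hyperbolic abs M.
  by move=> h; apply: nsch; split=> //; exists g, gamma.
move=> /existsNP[M /not_implyP[gM /not_implyP[nM nh]]].
have [c [x [c0 hx eM]]] : spanZ (range gamma) M by rewrite -spanZ_generated.
have [w [d [rw d0 ew]]] := reduced_lword ug hx.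
have nx : ~ is_scalar_mx x by move=> h; apply: nM; rewrite eM is_scalarZ2.
apply: (reach_bad rw).
  apply: contra_notN nx => /eqP w0; rewrite -(is_scalarZ2 _ d0) -ew w0.
  by rewrite -[lword [::]]/(1%:M) scalar_mx_is_scalar.
apply/orP; right; rewrite leNgt; apply/negP => lt; apply: nh.
rewrite eM; apply: (hyperbolicZ hK c0).
have di : d^-1 != 0 by rewrite invr_eq0.
have -> : x = d^-1 *: lword w by rewrite ew scalerA mulVf // scale1r.
apply: (hyperbolicZ hK di); apply: (tr_hyperbolic hp hK).
  by case: (vertex_lword hp hK ug hgQ w).
by rewrite expr2 -(absM hK).
Qed.

Lemma search_correct :
  exists n y, run p abs n (searchP p all_ops) (input_code gamma) = Some y /\ sound y.
Proof.
have [t [y0 [rt ct]]] := target_exists.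
have [t' [y [vt cy [N hN]]]] := search_terminates valid_initial rt ct.
exists N, y; split; last exact: check_sound cy.
have hinit : yields initP (input_code gamma) ([:: code initial], [::]).
  have y1 : yields (cmat InputTy (1, 0, 0, 1)) (input_code gamma) (mx_code (1 : 'M[K]_2)).
    by rewrite (_ : 1 = zmx K (1, 0, 0, 1)) ?one2E //; apply: y_cmat.
  apply: y_fork => //; apply: y_lcons => //.
  by apply: y_mkst => //; [exact: y_cmat|rewrite /= -map_comp].
have -> : run p abs N (searchP p all_ops) (input_code gamma) =
    obind (run p abs N (Loop (stepP p all_ops))) (run p abs N initP (input_code gamma)) by [].
by rewrite hinit; exact: hN.
Qed.

End Search.

Theorem mainTheorem3 (p g : nat) (hp : prime p) (hg : (2 <= g)%N) :
  exists P : prog InputTy OutputTy,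
    forall (R : realType) (K : fieldType) (abs : K -> R), is_Cp abs p ->
    forall gamma : 'I_g -> 'M[K]_2,
      (forall i, gamma i \in unitmx) ->
      (forall i j k, Qp abs (gamma i j k)) ->
      exists (n : nat) (y : den K OutputTy),
        [/\ run p abs n P (input_code gamma) = Some y,
            outcome_good p abs gamma y \/ outcome_relation gamma y \/
              outcome_not_hyperbolic abs gamma y,
            Schottky_group abs (generated_group gamma) /\
              freely_generate gamma -> outcome_good p abs gamma y &
            ~ (Schottky_group abs (generated_group gamma) /\
               freely_generate gamma) ->
              outcome_relation gamma y \/
              outcome_not_hyperbolic abs gamma y].
Proof.
exists (searchP p (all_ops g)) => R K abs hK gamma ug hgQ.
have [n [y [hn hy]]] := search_correct hp hK (ltnW hg) ug hgQ.
exists n, y; split=> //.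
- by case: hy => [[]|]; [left|right].
(* Outcome (ii) contradicts freeness, and outcome (iii) the Schottky property. *)
- move=> [sch fr]; case: hy => [[] //|[[w [_ _ _ _ nf]]|[M [_ _ _ _ ns]]]] //.
- move=> nsf; case: hy => [[hgood fr]|//]; case: nsf; split=> //.
  by case: hgood => a [b [b' [F []]]].
Qed.
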